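(* Let $1<p<\infty$, let $\mathcal{A}_1,\mathcal{A}_2$ be separable Banach spaces, let $\psi,\psi^{(-1)}:\mathcal{A}_2\to B(l^p)$ be maps, let $\eta:\mathcal{A}_2\to B(l^p\oplus l^p)$ be a bounded linear map, and for each $t\in[0,1]$ let $\tau_t:\mathcal{A}_1\to\mathcal{A}_2$ be a bounded linear map. Assume (1) $\eta(a)-\psi(a)\oplus\psi^{(-1)}(a)$ is compact for all $a\in\mathcal{A}_2$, and (2) for each $a\in\mathcal{A}_1$ the function $t\mapsto\tau_t(a)$ is continuous from $[0,1]$ to $\mathcal{A}_2$. Then there exist dyadic numbers $v(1),v(2),\ldots$ in $[0,1]$ such that $(\psi\circ\tau_0)\oplus\big(\bigoplus_{k\ge1}\eta\circ\tau_{v(k)}\big)$ is $16$-similar modulo compact operators to $(\psi\circ\tau_1)\oplus\big(\bigoplus_{k\ge1}\eta\circ\tau_{v(k)}\big)$. If $p=2$, they are unitarily equivalent modulo compact operators.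
   Context: Direct sums are $l^p$-direct sums of spaces and operators. Maps $\rho_1:\Lambda\to B(\mathcal{Y}_1)$, $\rho_2:\Lambda\to B(\mathcal{Y}_2)$ are $\lambda$-similar modulo compact operators if there is an invertible $S:\mathcal{Y}_1\to\mathcal{Y}_2$ with $\|S\|\|S^{-1}\|\le\lambda$ and $\rho_2(a)-S\rho_1(a)S^{-1}$ compact for all $a$; unitary equivalence modulo compact operators means the same with $S$ unitary. *)

(* Defs.v *)
From Stdlib Require Import Reals List.
Open Scope R_scope.

Definition Cx := (R * R)%type.
Definition C0 : Cx := (0, 0).
Definition C1 : Cx := (1, 0).
Definition Cadd (z w : Cx) : Cx := (fst z + fst w, snd z + snd w).
Definition Copp (z : Cx) : Cx := (- fst z, - snd z).
Definition Csub (z w : Cx) : Cx := Cadd z (Copp w).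
Definition Cmul (z w : Cx) : Cx :=
  (fst z * fst w - snd z * snd w, fst z * snd w + snd z * fst w).
Definition Cmod (z : Cx) : R := sqrt (fst z ^ 2 + snd z ^ 2).

(** x^p for x >= 0 and real p > 0 (with 0^p = 0). *)
Definition rpow (x p : R) : R := if Rlt_dec 0 x then Rpower x p else 0.

Record NormedSpace := {
  ns_car :> Type;
  ns_zero : ns_car;
  ns_add : ns_car -> ns_car -> ns_car;
  ns_opp : ns_car -> ns_car;
  ns_scal : Cx -> ns_car -> ns_car;
  ns_norm : ns_car -> R;
  ns_add_assoc : forall x y z, ns_add x (ns_add y z) = ns_add (ns_add x y) z;
  ns_add_comm : forall x y, ns_add x y = ns_add y x;
  ns_add_0 : forall x, ns_add x ns_zero = x;
  ns_add_opp : forall x, ns_add x (ns_opp x) = ns_zero;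
  ns_scal_1 : forall x, ns_scal C1 x = x;
  ns_scal_assoc : forall a b x, ns_scal a (ns_scal b x) = ns_scal (Cmul a b) x;
  ns_scal_distr_l : forall a x y, ns_scal a (ns_add x y) = ns_add (ns_scal a x) (ns_scal a y);
  ns_scal_distr_r : forall a b x, ns_scal (Cadd a b) x = ns_add (ns_scal a x) (ns_scal b x);
  ns_norm_nonneg : forall x, 0 <= ns_norm x;
  ns_norm_eq0 : forall x, ns_norm x = 0 -> x = ns_zero;
  ns_norm_scal : forall a x, ns_norm (ns_scal a x) = Cmod a * ns_norm x;
  ns_norm_triangle : forall x y, ns_norm (ns_add x y) <= ns_norm x + ns_norm y
}.

Arguments ns_zero {_}.
Arguments ns_add {_} _ _.
Arguments ns_opp {_} _.
Arguments ns_scal {_} _ _.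
Arguments ns_norm {_} _.

Definition ns_sub {V : NormedSpace} (x y : V) : V := ns_add x (ns_opp y).

Definition complete (V : NormedSpace) : Prop :=
  forall u : nat -> V,
    (forall eps, 0 < eps -> exists N, forall m n, (N <= m)%nat -> (N <= n)%nat ->
        ns_norm (ns_sub (u m) (u n)) < eps) ->
    exists l : V, forall eps, 0 < eps -> exists N, forall n, (N <= n)%nat ->
        ns_norm (ns_sub (u n) l) < eps.

Definition separable (V : NormedSpace) : Prop :=
  exists d : nat -> V, forall (x : V) eps, 0 < eps ->
    exists n, ns_norm (ns_sub x (d n)) < eps.

Definition bounded_linear {V W : NormedSpace} (f : V -> W) : Prop :=
  (forall x y, f (ns_add x y) = ns_add (f x) (f y)) /\
  (forall a x, f (ns_scal a x) = ns_scal a (f x)) /\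
  (exists M, forall x, ns_norm (f x) <= M * ns_norm x).

(** * l^p(I) spaces over a (countable) index type I, and operators.
    An l^p-direct sum of spaces l^p(I_k) is (isometrically, canonically)
    l^p of the disjoint union of the I_k; we use that representation. *)
Definition vec (I : Type) := I -> Cx.
Definition op (I J : Type) := vec I -> vec J.

Definition vadd {I} (x y : vec I) : vec I := fun i => Cadd (x i) (y i).
Definition vsub {I} (x y : vec I) : vec I := fun i => Csub (x i) (y i).
Definition vscal {I} (a : Cx) (x : vec I) : vec I := fun i => Cmul a (x i).

Definition psum {I} (p : R) (x : vec I) (l : list I) : R :=
  fold_right (fun i acc => rpow (Cmod (x i)) p + acc) 0 l.

(** lp_bound p x c  <->  ||x||_p^p <= c *)
Definition lp_bound {I} (p : R) (x : vec I) (c : R) : Prop :=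
  forall l : list I, NoDup l -> psum p x l <= c.

Definition in_lp {I} (p : R) (x : vec I) : Prop := exists c, lp_bound p x c.

Definition is_lin_op {I J} (p : R) (T : op I J) : Prop :=
  (forall x, in_lp p x -> in_lp p (T x)) /\
  (forall x y, in_lp p x -> in_lp p y -> forall j, T (vadd x y) j = Cadd (T x j) (T y j)) /\
  (forall a x, in_lp p x -> forall j, T (vscal a x) j = Cmul a (T x j)).

(** op_bound p T al  <->  ||T x||_p <= al ||x||_p for all x in l^p *)
Definition op_bound {I J} (p : R) (T : op I J) (al : R) : Prop :=
  forall x c, in_lp p x -> lp_bound p x c -> lp_bound p (T x) (rpow al p * c).

Definition is_bdd_op {I J} (p : R) (T : op I J) : Prop :=
  is_lin_op p T /\ exists al, 0 <= al /\ op_bound p T al.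

Definition is_compact_op {I J} (p : R) (T : op I J) : Prop :=
  is_bdd_op p T /\
  forall xs : nat -> vec I,
    (forall n, in_lp p (xs n) /\ lp_bound p (xs n) 1) ->
    exists (phi : nat -> nat) (y : vec J),
      (forall n, (phi n < phi (S n))%nat) /\ in_lp p y /\
      forall eps, 0 < eps -> exists N, forall n, (N <= n)%nat ->
        lp_bound p (vsub (T (xs (phi n))) y) (rpow eps p).

Definition op_sub {I J} (T1 T2 : op I J) : op I J := fun x j => Csub (T1 x j) (T2 x j).
Definition op_comp {I J K} (T1 : op J K) (T2 : op I J) : op I K := fun x => T1 (T2 x).

Definition is_invertible {I J} (p : R) (S : op I J) (Sinv : op J I) : Prop :=
  is_bdd_op p S /\ is_bdd_op p Sinv /\
  (forall x, in_lp p x -> forall i, Sinv (S x) i = x i) /\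
  (forall y, in_lp p y -> forall j, S (Sinv y) j = y j).

Definition is_isometry {I J} (p : R) (S : op I J) : Prop :=
  forall x, in_lp p x -> forall c, lp_bound p x c <-> lp_bound p (S x) c.

Definition similar_mod_compact {L I J : Type} (p : R)
    (rho1 : L -> op I I) (rho2 : L -> op J J) (lam : R) : Prop :=
  exists (S : op I J) (Sinv : op J I) (al be : R),
    is_invertible p S Sinv /\ 0 <= al /\ 0 <= be /\
    op_bound p S al /\ op_bound p Sinv be /\ al * be <= lam /\
    forall a, is_compact_op p (op_sub (rho2 a) (op_comp S (op_comp (rho1 a) Sinv))).

Definition unitarily_equiv_mod_compact {L I J : Type} (p : R)
    (rho1 : L -> op I I) (rho2 : L -> op J J) : Prop :=
  exists (S : op I J) (Sinv : op J I),
    is_invertible p S Sinv /\ is_isometry p S /\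
    forall a, is_compact_op p (op_sub (rho2 a) (op_comp S (op_comp (rho1 a) Sinv))).

Definition dsum2 {I1 J1 I2 J2} (T1 : op I1 J1) (T2 : op I2 J2) : op (I1 + I2) (J1 + J2) :=
  fun x j => match j with
             | inl j1 => T1 (fun i => x (inl i)) j1
             | inr j2 => T2 (fun i => x (inr i)) j2
             end.

Definition dsum_seq {I J} (T : nat -> op I J) : op (nat * I) (nat * J) :=
  fun x kj => T (fst kj) (fun i => x (fst kj, i)) (snd kj).

Definition dyadic (x : R) : Prop := exists m n : nat, x = INR m / 2 ^ n.

(* Main.v *)
From Stdlib Require Import Reals List Lra Lia Permutation Cantor.
From Stdlib Require Import FunctionalExtensionality ClassicalEpsilon Classical.
Require Import Defs.
Open Scope R_scope.

(** The points of a dense dyadic sequence are inserted one at a time into [0,1], each at the midpoint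
    of a gap.  The position space is [nat], with position 0 carrying the time 0 in the source and the
    time 1 in the target.  After n insertions the cyclic permutation sending every point to its right
    neighbour moves times by at most the mesh, and inserting one more point multiplies it by a
    transposition.  A transposition [s] is joined to the identity by the path [1 + b (s - 1)], with [b]
    on the circle [|b|^2 = Re b], which is unitary for p = 2 and has norm at most 2 on l^p.  Letting
    [b] be a function on the index set of l^p, equal to 0 on a large finite set and to 1 far out, and
    almost commuting with the operators [eta a] (a quasicentral multiplier, found by making finitely
    many operators almost block tridiagonal), one performs the n-th insertion only on far out
    coordinates.  The resulting operator S commutes with the ampliations of all [eta a] modulo compact
    operators, since the commutator is an absolutely convergent sum of compact ones, and intertwines
    [h(time)] for Lipschitz [h] modulo compact operators, since the mesh tends to 0.  Piecewise linear
    interpolation of t |-> tau_t(a) combines the two facts. *)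

(** * Complex scalars *)

(** The two sums differ only at position 0, where [psi] stands alone: the second copy of l^p is
    missing there, so a cyclic permutation of positions cannot act on the second copies. The
    multipliers therefore tend to the projection [chi] onto the first copy rather than to 1, and S
    is the identity on second copies, where source and target times agree at every position that has
    one. Condition (1) allows this: [dsum2 (psi a) (psim1 a)] commutes with [chi], so the commutator
    of [eta a] with [chi] is compact.

    Compactness is handled as uniform decay of rows ([apx]), which is equivalent to it on l^p and
    stable under sums, products and norm limits. Decay of columns ([coapx]) is deduced from it; both
    kinds of decay are needed to make an operator almost block tridiagonal. Almost commutation then
    comes from letting the multiplier vary slowly from block to block, a method that lets its values
    be prescribed on a curve.

    The estimate for S and for its inverse is 2 at every p, coming from |b| <= 1 and |1 - b| <= 1;
    the product 4 lies well below the required 16. *)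

Definition RtoCx (x : R) : Cx := (x, 0).
Definition Cconj (z : Cx) : Cx := (fst z, - snd z).

Lemma Cx_ring : ring_theory C0 C1 Cadd Cmul Csub Copp eq.
Proof.
  constructor; repeat intros [? ?]; unfold Csub, Cadd, Cmul, Copp, C0, C1; cbn;
    try reflexivity; f_equal; ring.
Qed.
Add Ring Cx_ring_inst : Cx_ring.

Lemma Cmod_nonneg z : 0 <= Cmod z.
Proof. apply sqrt_pos. Qed.

Lemma Cmod_sqr z : Cmod z * Cmod z = fst z ^ 2 + snd z ^ 2.
Proof. unfold Cmod. apply sqrt_sqrt. nra. Qed.

Lemma sqr_le_le x y : 0 <= y -> x * x <= y * y -> x <= y.
Proof. intros; nra. Qed.

Lemma sqr_eq_eq x y : 0 <= x -> 0 <= y -> x * x = y * y -> x = y.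
Proof. intros; nra. Qed.

Lemma Cmod_mul z w : Cmod (Cmul z w) = Cmod z * Cmod w.
Proof.
  pose proof (Cmod_nonneg z). pose proof (Cmod_nonneg w).
  apply sqr_eq_eq; [apply Cmod_nonneg | nra |].
  replace (Cmod z * Cmod w * (Cmod z * Cmod w))
    with ((Cmod z * Cmod z) * (Cmod w * Cmod w)) by ring.
  rewrite !Cmod_sqr. destruct z, w; unfold Cmul; cbn [fst snd]; ring.
Qed.

Lemma Cmod_add z w : Cmod (Cadd z w) <= Cmod z + Cmod w.
Proof.
  pose proof (Cmod_nonneg z). pose proof (Cmod_nonneg w).
  apply sqr_le_le; [lra |].
  rewrite Cmod_sqr.
  replace ((Cmod z + Cmod w) * (Cmod z + Cmod w))
    with (Cmod z * Cmod z + Cmod w * Cmod w + 2 * (Cmod z * Cmod w)) by ring.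
  rewrite !Cmod_sqr.
  assert (fst z * fst w + snd z * snd w <= Cmod z * Cmod w).
  { apply sqr_le_le; [nra |].
    replace (Cmod z * Cmod w * (Cmod z * Cmod w))
      with ((Cmod z * Cmod z) * (Cmod w * Cmod w)) by ring.
    rewrite !Cmod_sqr.
    pose proof (pow2_ge_0 (fst z * snd w - snd z * fst w)). nra. }
  destruct z, w; unfold Cadd; cbn [fst snd] in *; nra.
Qed.

Lemma Cmod_0 : Cmod C0 = 0.
Proof. unfold Cmod, C0; cbn [fst snd]. replace (0 ^ 2 + 0 ^ 2) with 0 by ring. apply sqrt_0. Qed.

Lemma Cmod_1 : Cmod C1 = 1.
Proof. unfold Cmod, C1; cbn [fst snd]. replace (1 ^ 2 + 0 ^ 2) with 1 by ring. apply sqrt_1. Qed.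

Lemma Cmod_opp z : Cmod (Copp z) = Cmod z.
Proof. unfold Cmod, Copp; cbn [fst snd]. f_equal. ring. Qed.

Lemma Cmod_sub z w : Cmod (Csub z w) <= Cmod z + Cmod w.
Proof. unfold Csub. rewrite <- (Cmod_opp w). apply Cmod_add. Qed.

Lemma Cmod_RtoCx x : Cmod (RtoCx x) = Rabs x.
Proof.
  unfold Cmod, RtoCx; cbn [fst snd]. rewrite <- sqrt_Rsqr_abs. f_equal. unfold Rsqr. ring.
Qed.

Lemma Cmod_eq0 z : Cmod z = 0 -> z = C0.
Proof.
  intros H. pose proof (Cmod_sqr z) as H1. rewrite H in H1.
  destruct z as [a b]; cbn [fst snd] in H1. unfold C0; f_equal; nra.
Qed.

Lemma Cmod_le_parts z : Cmod z <= Rabs (fst z) + Rabs (snd z).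
Proof.
  pose proof (Rabs_pos (fst z)). pose proof (Rabs_pos (snd z)).
  apply sqr_le_le; [lra |]. rewrite Cmod_sqr, <- (pow2_abs (fst z)), <- (pow2_abs (snd z)). nra.
Qed.

Lemma fst_le_Cmod z : Rabs (fst z) <= Cmod z.
Proof.
  apply sqr_le_le; [apply Cmod_nonneg |]. rewrite Cmod_sqr, <- (pow2_abs (fst z)). nra.
Qed.

Lemma snd_le_Cmod z : Rabs (snd z) <= Cmod z.
Proof.
  apply sqr_le_le; [apply Cmod_nonneg |]. rewrite Cmod_sqr, <- (pow2_abs (snd z)). nra.
Qed.

(** * Powers *)

Class exponent (p : R) : Prop := exponent_gt1 : 1 < p.

Section Powers.
Context (p : R) {Hp : exponent p}.

Lemma p_gt1 : 1 < p. Proof. exact exponent_gt1. Qed.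

Lemma rpow_0 : rpow 0 p = 0.
Proof. unfold rpow. destruct (Rlt_dec 0 0); [lra | reflexivity]. Qed.

Lemma rpow_Rpower x : 0 < x -> rpow x p = Rpower x p.
Proof. intros. unfold rpow. destruct (Rlt_dec 0 x); [reflexivity | lra]. Qed.

Lemma rpow_pos x : 0 < x -> 0 < rpow x p.
Proof. intros. rewrite rpow_Rpower by assumption. apply exp_pos. Qed.

Lemma rpow_nonneg x : 0 <= rpow x p.
Proof. unfold rpow. destruct (Rlt_dec 0 x); [left; apply exp_pos | lra]. Qed.

Lemma rpow_lt x y : 0 <= x < y -> rpow x p < rpow y p.
Proof.
  intros [[Hx|<-] Hy].
  - rewrite !rpow_Rpower by lra. unfold Rpower. apply exp_increasing.
    pose proof p_gt1. pose proof (ln_increasing x y Hx Hy). nra.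
  - rewrite rpow_0. apply rpow_pos; lra.
Qed.

Lemma rpow_le x y : 0 <= x <= y -> rpow x p <= rpow y p.
Proof.
  intros [Hx [Hy|<-]]; [| lra]. left. apply rpow_lt; lra.
Qed.

Lemma rpow_le_inv x y : 0 <= y -> rpow x p <= rpow y p -> x <= y.
Proof.
  intros Hy H. destruct (Rle_or_lt x y) as [|Hlt]; [assumption |].
  pose proof (rpow_lt y x (conj Hy Hlt)). lra.
Qed.

Lemma rpow_mul x y : 0 <= x -> 0 <= y -> rpow (x * y) p = rpow x p * rpow y p.
Proof.
  intros [Hx|<-] [Hy|<-]; rewrite ?Rmult_0_l, ?Rmult_0_r, ?rpow_0, ?Rmult_0_l, ?Rmult_0_r;
    try reflexivity.
  rewrite !rpow_Rpower by nra. apply eq_sym, Rpower_mult_distr; assumption.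
Qed.

Lemma rpow_1 : rpow 1 p = 1.
Proof. rewrite rpow_Rpower by lra. unfold Rpower. rewrite ln_1, Rmult_0_r. apply exp_0. Qed.

Lemma rpow_root c : 0 <= c -> exists r, 0 <= r /\ rpow r p = c.
Proof.
  intros [Hc|<-].
  - exists (Rpower c (/ p)). assert (0 < Rpower c (/ p)) by apply exp_pos. split; [lra |].
    rewrite rpow_Rpower by assumption. rewrite Rpower_mult.
    rewrite Rinv_l by (pose proof p_gt1; lra). apply Rpower_1; assumption.
  - exists 0. rewrite rpow_0. lra.
Qed.

(** Convexity of exp between 0 and x. The tangent inequality [1 + y <= exp y] is used at
    [(1 - l) * x] and at [- (l * x)]; with weights l and 1 - l the linear terms cancel. *)
Lemma exp_weighted l x : 0 <= l <= 1 -> exp (l * x) <= l * exp x + (1 - l).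
Proof.
  intros Hl.
  assert (H1 : exp (l * x) * (1 + (1 - l) * x) <= exp x).
  { replace x with (l * x + (1 - l) * x) at 3 by ring. rewrite exp_plus.
    apply Rmult_le_compat_l; [left; apply exp_pos | apply exp_ineq1_le]. }
  assert (H2 : exp (l * x) * (1 + - (l * x)) <= 1).
  { replace 1 with (exp (l * x) * exp (- (l * x))) at 2
      by (rewrite <- exp_plus, Rplus_opp_r; apply exp_0).
    apply Rmult_le_compat_l; [left; apply exp_pos | apply exp_ineq1_le]. }
  nra.
Qed.

(** The tangent to u^p at u = 1, obtained from [exp_weighted] with weight 1/p at the point p ln
    u. *)
Lemma rpow_bernoulli u : 0 <= u -> 1 + p * (u - 1) <= rpow u p.
Proof.
  pose proof p_gt1.
  intros [Hu|<-]; [| rewrite rpow_0; lra].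
  rewrite rpow_Rpower by assumption. unfold Rpower.
  assert (Hl : 0 <= / p <= 1).
  { split; [left; apply Rinv_0_lt_compat; lra |].
    rewrite <- Rinv_1. apply Rinv_le_contravar; lra. }
  pose proof (exp_weighted (/ p) (p * ln u) Hl) as H1.
  replace (/ p * (p * ln u)) with (ln u) in H1 by (field; lra).
  rewrite exp_ln in H1 by assumption.
  apply (Rmult_le_compat_l p) in H1; [| lra].
  replace (p * (/ p * exp (p * ln u) + (1 - / p))) with (exp (p * ln u) + p - 1) in H1
    by (field; lra).
  lra.
Qed.

(** Bernoulli's inequality rescaled gives the tangent at the intermediate point z; averaging it at x
    and y kills the linear term. *)
Lemma rpow_convex t x y : 0 <= t <= 1 -> 0 <= x -> 0 <= y ->
  rpow (t * x + (1 - t) * y) p <= t * rpow x p + (1 - t) * rpow y p.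
Proof.
  intros Ht Hx Hy. set (z := t * x + (1 - t) * y).
  pose proof (rpow_nonneg x). pose proof (rpow_nonneg y).
  assert (Hz : 0 <= z) by (unfold z; nra).
  destruct Hz as [Hz|Hz]; [| rewrite <- Hz, rpow_0; nra].
  assert (Htan : forall u, 0 <= u -> rpow z p * (1 + p * (u / z - 1)) <= rpow u p).
  { intros u Hu. assert (0 <= u / z) by (apply Rmult_le_pos; [lra | left; apply Rinv_0_lt_compat; lra]).
    replace (rpow u p) with (rpow z p * rpow (u / z) p).
    - apply Rmult_le_compat_l; [apply rpow_nonneg | apply rpow_bernoulli; assumption].
    - rewrite <- rpow_mul by lra. f_equal. field. lra. }
  pose proof (Htan x Hx) as H1. pose proof (Htan y Hy) as H2.
  apply (Rmult_le_compat_l t) in H1; [| lra].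
  apply (Rmult_le_compat_l (1 - t)) in H2; [| lra].
  replace (rpow z p) with (t * (rpow z p * (1 + p * (x / z - 1))) + (1 - t) * (rpow z p * (1 + p * (y / z - 1)))); [lra |].
  replace (t * (rpow z p * (1 + p * (x / z - 1))) + (1 - t) * (rpow z p * (1 + p * (y / z - 1))))
    with (rpow z p * (1 + p * ((t * x + (1 - t) * y) / z - 1))) by (field; lra).
  fold z. field. lra.
Qed.

End Powers.

(** * Norm bounds in l^p *)

Definition msk {I} (A : I -> Prop) (x : vec I) : vec I :=
  fun i => if excluded_middle_informative (A i) then x i else C0.
Definition mul {I} (m : I -> Cx) (x : vec I) : vec I := fun i => Cmul (m i) (x i).
Definition vzero {I} : vec I := fun _ => C0.
(** Reindexing along a partial map. With [pinj] this one notion covers permutations of coordinates,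
    inclusions of summands and projections onto them, all of norm at most 1. *)
Definition pull {I J} (f : J -> option I) (x : vec I) : vec J :=
  fun j => match f j with Some i => x i | None => C0 end.
Definition pinj {I J} (f : J -> option I) : Prop :=
  forall j j' i, f j = Some i -> f j' = Some i -> j = j'.

(** [nb p x r]: the l^p norm of [x] is at most [r]. *)
Definition nb {I} (p : R) (x : vec I) (r : R) : Prop := 0 <= r /\ lp_bound p x (rpow r p).

Section Norms.
Context {p : R} {Hp : exponent p}.

Lemma psum_nonneg {I} (x : vec I) l : 0 <= psum p x l.
Proof.
  induction l as [|i l IH]; cbn; [lra |]. pose proof (rpow_nonneg p (Cmod (x i))).
  unfold psum in IH. lra.
Qed.

Lemma psum_app {I} (x : vec I) l l' : psum p x (l ++ l') = psum p x l + psum p x l'.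
Proof.
  induction l as [|i l IH]; [symmetry; apply Rplus_0_l |].
  change (rpow (Cmod (x i)) p + psum p x (l ++ l') = rpow (Cmod (x i)) p + psum p x l + psum p x l').
  rewrite IH. ring.
Qed.

Lemma psum_perm {I} (x : vec I) l l' : Permutation l l' -> psum p x l = psum p x l'.
Proof.
  induction 1 as [|i l l' _ IH|i j l|l l' l'' _ IH _ IH']; [reflexivity | | |].
  - cbn. unfold psum in IH. rewrite IH. reflexivity.
  - cbn. lra.
  - congruence.
Qed.

Lemma psum_mono {I} (x y : vec I) l :
  (forall i, Cmod (x i) <= Cmod (y i)) -> psum p x l <= psum p y l.
Proof.
  intros H. induction l as [|i l IH]; cbn in *; [lra |].
  pose proof (rpow_le p (Cmod (x i)) (Cmod (y i)) (conj (Cmod_nonneg _) (H i))).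
  unfold psum in *; lra.
Qed.

Lemma psum_pull {I J} (f : J -> option I) (x : vec I) l :
  psum p (pull f x) l =
  psum p x (flat_map (fun j => match f j with Some i => i :: nil | None => nil end) l).
Proof.
  induction l as [|j l IH]; [reflexivity |]. cbn [flat_map]. rewrite psum_app, <- IH.
  cbn. unfold pull. destruct (f j); cbn; rewrite ?Cmod_0, ?rpow_0; unfold psum; lra.
Qed.

Lemma NoDup_pull {I J} (f : J -> option I) l : pinj f -> NoDup l ->
  NoDup (flat_map (fun j => match f j with Some i => i :: nil | None => nil end) l).
Proof.
  intros Hf Hl. induction Hl as [|j l Hj Hl IH]; [constructor |]. cbn.
  destruct (f j) as [i|] eqn:E; cbn; [| assumption]. constructor; [| assumption].
  intros Hin. apply in_flat_map in Hin as [j' [Hj' Hi]].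
  destruct (f j') as [i'|] eqn:E'; [| contradiction]. destruct Hi as [->|[]].
  apply Hj. rewrite (Hf j j' i E E'). assumption.
Qed.

Lemma lp_bound_pull {I J} (f : J -> option I) (x : vec I) c :
  pinj f -> lp_bound p x c -> lp_bound p (pull f x) c.
Proof. intros Hf Hx l Hl. rewrite psum_pull. apply Hx, NoDup_pull; assumption. Qed.

Lemma lp_bound_nonneg {I} (x : vec I) c : lp_bound p x c -> 0 <= c.
Proof. intros H. apply (H nil). constructor. Qed.

Lemma lp_bound_le {I} (x : vec I) c c' : c <= c' -> lp_bound p x c -> lp_bound p x c'.
Proof. intros H H' l Hl. specialize (H' l Hl). lra. Qed.

Lemma nb_le {I} (x : vec I) r r' : r <= r' -> nb p x r -> nb p x r'.
Proof.
  intros H [Hr Hx]. split; [lra |]. eapply lp_bound_le; [| eassumption]. apply rpow_le; try exact _; lra.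
Qed.

Lemma nb_nonneg {I} (x : vec I) r : nb p x r -> 0 <= r.
Proof. intros []; assumption. Qed.

Lemma nb_in {I} (x : vec I) r : nb p x r -> in_lp p x.
Proof. intros [_ H]. eexists; eassumption. Qed.

Lemma lp_bound_nb {I} (x : vec I) c : lp_bound p x c -> exists r, rpow r p = c /\ nb p x r.
Proof.
  intros H. destruct (rpow_root p c (lp_bound_nonneg _ _ H)) as [r [Hr <-]].
  exists r; split; [reflexivity | split; assumption].
Qed.

Lemma in_nb {I} (x : vec I) : in_lp p x -> exists r, nb p x r.
Proof. intros [c Hc]. destruct (lp_bound_nb _ _ Hc) as [r [_ H]]. eauto. Qed.

Lemma nb_pull {I J} (f : J -> option I) (x : vec I) r : pinj f -> nb p x r -> nb p (pull f x) r.
Proof. intros Hf [Hr Hx]. split; [assumption | apply lp_bound_pull; assumption]. Qed.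

Lemma nb_reindex {I J} (f : J -> I) (x : vec I) r :
  (forall j j', f j = f j' -> j = j') -> nb p x r -> nb p (fun j => x (f j)) r.
Proof.
  intros Hf. apply (nb_pull (fun j => Some (f j))). intros j j' i [= <-] [= E]. auto.
Qed.

Lemma nb_mono {I} (x y : vec I) r : (forall i, Cmod (x i) <= Cmod (y i)) -> nb p y r -> nb p x r.
Proof.
  intros H [Hr Hy]. split; [assumption |]. intros l Hl.
  eapply Rle_trans; [apply (psum_mono x y); assumption | apply Hy; assumption].
Qed.

Lemma nb_coord {I} (x : vec I) r i : nb p x r -> Cmod (x i) <= r.
Proof.
  intros [Hr H]. specialize (H (i :: nil) (NoDup_cons _ (@in_nil _ i) (NoDup_nil _))).
  cbn in H. apply (rpow_le_inv p); lra.
Qed.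

Lemma nb_zero {I} : nb p (@vzero I) 0.
Proof.
  split; [lra |]. intros l _. rewrite rpow_0. induction l as [|i l IH]; cbn; [lra |].
  unfold vzero at 1. rewrite Cmod_0, rpow_0. unfold psum in IH. lra.
Qed.

Lemma nb_0_inv {I} (x : vec I) : nb p x 0 -> x = vzero.
Proof.
  intros H. extensionality i. apply Cmod_eq0. pose proof (nb_coord x 0 i H).
  pose proof (Cmod_nonneg (x i)). lra.
Qed.

Lemma nb_scal {I} a (x : vec I) r : nb p x r -> nb p (vscal a x) (Cmod a * r).
Proof.
  intros [Hr H]. pose proof (Cmod_nonneg a). split; [nra |]. intros l Hl.
  rewrite rpow_mul by (exact _ || assumption).
  replace (psum p (vscal a x) l) with (rpow (Cmod a) p * psum p x l).
  - apply Rmult_le_compat_l; [apply rpow_nonneg | apply H; assumption].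
  - clear Hl. induction l as [|i l IH]; cbn in *; [lra |]. unfold vscal at 1.
    rewrite Cmod_mul, rpow_mul by (exact _ || apply Cmod_nonneg). unfold psum in *. lra.
Qed.

Lemma nb_add {I} (x y : vec I) r s : nb p x r -> nb p y s -> nb p (vadd x y) (r + s).
Proof.
  intros Hx Hy. pose proof (nb_nonneg _ _ Hx) as [Hr|<-].
  2:{ rewrite (nb_0_inv x Hx), Rplus_0_l. eapply nb_mono; [| exact Hy]. intros i.
      unfold vadd, vzero. right. f_equal. ring. }
  pose proof (nb_nonneg _ _ Hy) as [Hs|<-].
  2:{ rewrite (nb_0_inv y Hy), Rplus_0_r. eapply nb_mono; [| exact Hx]. intros i.
      unfold vadd, vzero. right. f_equal. ring. }
  split; [lra |]. intros l Hl.
  pose proof (rpow_pos p r Hr) as Pr. pose proof (rpow_pos p s Hs) as Ps.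
  (* Minkowski by convexity: with this weight, x + y is r + s times a convex combination of x/r and
     y/s. The factors [A] and [B] are then such that A r^p + B s^p = (r + s)^p. *)
  set (t := r / (r + s)).
  assert (Ht : 0 <= t <= 1).
  { unfold t. split; [apply Rmult_le_pos; [lra | left; apply Rinv_0_lt_compat; lra] |].
    apply (Rmult_le_reg_r (r + s)); [lra |]. unfold Rdiv. rewrite Rmult_assoc, Rinv_l by lra. lra. }
  set (A := rpow (r + s) p * t / rpow r p). set (B := rpow (r + s) p * (1 - t) / rpow s p).
  assert (HA : 0 <= A).
  { unfold A. apply Rmult_le_pos; [apply Rmult_le_pos; [apply rpow_nonneg | lra] |].
    left. apply Rinv_0_lt_compat; assumption. }
  assert (HB : 0 <= B).
  { unfold B. apply Rmult_le_pos; [apply Rmult_le_pos; [apply rpow_nonneg | lra] |].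
    left. apply Rinv_0_lt_compat; assumption. }
  assert (Hpt : forall i, rpow (Cmod (vadd x y i)) p <= A * rpow (Cmod (x i)) p + B * rpow (Cmod (y i)) p).
  { intros i. pose proof (Cmod_nonneg (x i)) as Px. pose proof (Cmod_nonneg (y i)) as Py.
    assert (Pxr : 0 <= Cmod (x i) / r) by (apply Rmult_le_pos; [lra | left; apply Rinv_0_lt_compat; lra]).
    assert (Pys : 0 <= Cmod (y i) / s) by (apply Rmult_le_pos; [lra | left; apply Rinv_0_lt_compat; lra]).
    apply Rle_trans with (rpow ((r + s) * (t * (Cmod (x i) / r) + (1 - t) * (Cmod (y i) / s))) p).
    { apply rpow_le; [exact _ |]. split; [apply Cmod_nonneg |].
      replace ((r + s) * (t * (Cmod (x i) / r) + (1 - t) * (Cmod (y i) / s))) with (Cmod (x i) + Cmod (y i))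
        by (unfold t; field; lra).
      apply Cmod_add. }
    rewrite rpow_mul by (exact _ || nra).
    assert (E1 : rpow (Cmod (x i)) p = rpow r p * rpow (Cmod (x i) / r) p).
    { rewrite <- rpow_mul by (exact _ || lra). f_equal. field. lra. }
    assert (E2 : rpow (Cmod (y i)) p = rpow s p * rpow (Cmod (y i) / s) p).
    { rewrite <- rpow_mul by (exact _ || lra). f_equal. field. lra. }
    rewrite E1, E2. unfold A, B.
    replace (rpow (r + s) p * t / rpow r p * (rpow r p * rpow (Cmod (x i) / r) p) +
             rpow (r + s) p * (1 - t) / rpow s p * (rpow s p * rpow (Cmod (y i) / s) p))
      with (rpow (r + s) p * (t * rpow (Cmod (x i) / r) p + (1 - t) * rpow (Cmod (y i) / s) p))
      by (field; lra).
    apply Rmult_le_compat_l; [apply rpow_nonneg | apply rpow_convex; assumption]. }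
  apply Rle_trans with (A * psum p x l + B * psum p y l).
  { clear Hl. induction l as [|i l IH]; cbn in *; [lra |]. specialize (Hpt i). unfold psum in *. lra. }
  destruct Hx as [_ Hx], Hy as [_ Hy]. specialize (Hx l Hl). specialize (Hy l Hl).
  replace (rpow (r + s) p) with (A * rpow r p + B * rpow s p) by (unfold A, B; field; lra).
  nra.
Qed.

Lemma nb_sub {I} (x y : vec I) r s : nb p x r -> nb p y s -> nb p (vsub x y) (r + s).
Proof.
  intros Hx Hy. apply (nb_mono _ (vadd x (vscal (Copp C1) y))).
  - intros i. right. f_equal. unfold vsub, vadd, vscal. ring.
  - apply nb_add; [assumption |]. replace s with (Cmod (Copp C1) * s) by (rewrite Cmod_opp, Cmod_1; ring).
    apply nb_scal; assumption.
Qed.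

Lemma nb_closed {I} (x : vec I) r : 0 <= r -> (forall d, 0 < d -> nb p x (r + d)) -> nb p x r.
Proof.
  intros Hr H. split; [assumption |]. intros l Hl.
  destruct (Rle_or_lt (psum p x l) (rpow r p)) as [|Hlt]; [assumption |].
  destruct (rpow_root p (psum p x l) (psum_nonneg x l)) as [s [Hs Es]].
  assert (r < s).
  { destruct (Rlt_or_le r s); [assumption |]. pose proof (rpow_le p s r (conj Hs H0)). lra. }
  destruct (H ((s - r) / 2)) as [_ Hx]; [lra |]. specialize (Hx l Hl).
  assert (rpow (r + (s - r) / 2) p < rpow s p) by (apply rpow_lt; [exact _ | lra]). lra.
Qed.

Lemma nb_ext {I} (x y : vec I) r : (forall i, x i = y i) -> nb p y r -> nb p x r.
Proof. intros H. apply nb_mono. intros i. rewrite H. lra. Qed.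

Lemma nb_mul {I} (m : I -> Cx) (x : vec I) C r :
  0 <= C -> (forall i, Cmod (m i) <= C) -> nb p x r -> nb p (mul m x) (C * r).
Proof.
  intros HC Hm Hx. apply (nb_mono _ (vscal (RtoCx C) x)).
  - intros i. unfold mul, vscal. rewrite !Cmod_mul, Cmod_RtoCx, Rabs_pos_eq by assumption.
    apply Rmult_le_compat_r; [apply Cmod_nonneg | apply Hm].
  - replace C with (Cmod (RtoCx C)) at 2 by (rewrite Cmod_RtoCx, Rabs_pos_eq; auto).
    apply nb_scal; assumption.
Qed.

Lemma nb_msk {I} (A : I -> Prop) (x : vec I) r : nb p x r -> nb p (msk A x) r.
Proof.
  apply nb_mono. intros i. unfold msk. destruct (excluded_middle_informative (A i)); [lra |].
  rewrite Cmod_0. apply Cmod_nonneg.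
Qed.

Lemma nb_single {I} (i : I) (x : vec I) : (forall j, j <> i -> x j = C0) -> nb p x (Cmod (x i)).
Proof.
  intros H. split; [apply Cmod_nonneg |]. intros l Hl.
  assert (H0 : forall l, ~ In i l -> psum p x l = 0).
  { intros l' Hl'. induction l' as [|j l' IH]; cbn in *; [reflexivity |].
    rewrite H by (intros ->; auto). rewrite Cmod_0, rpow_0. unfold psum in IH. rewrite IH by tauto. lra. }
  destruct (classic (In i l)) as [Hi|Hi]; [| rewrite H0 by assumption; apply rpow_nonneg].
  apply in_split in Hi as [l1 [l2 ->]].
  rewrite (psum_perm x _ (i :: l1 ++ l2)) by (symmetry; apply Permutation_middle).
  cbn. change (rpow (Cmod (x i)) p + psum p x (l1 ++ l2) <= rpow (Cmod (x i)) p).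
  apply NoDup_remove_2 in Hl. rewrite H0 by assumption. lra.
Qed.

Lemma nb_fin {I} (l : list I) (x : vec I) e : 0 <= e ->
  (forall i, ~ In i l -> x i = C0) -> (forall i, Cmod (x i) <= e) -> nb p x (INR (length l) * e).
Proof.
  intros He. revert x. induction l as [|i l IH]; intros x H Hx.
  - cbn. rewrite Rmult_0_l. eapply nb_ext; [| apply nb_zero]. intros i. apply H. auto.
  - apply (nb_ext _ (vadd (msk (fun j => j = i) x) (msk (fun j => j <> i) x))).
    { intros j. unfold vadd, msk. destruct (excluded_middle_informative (j = i)), (excluded_middle_informative (j <> i));
        try tauto; ring. }
    replace (INR (length (i :: l)) * e) with (e + INR (length l) * e) by (cbn [length]; rewrite S_INR; ring).
    apply nb_add.
    + eapply nb_le; [| apply (nb_single i)].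
      * unfold msk. destruct (excluded_middle_informative (i = i)); [apply Hx | rewrite Cmod_0; lra].
      * intros j Hj. unfold msk. destruct (excluded_middle_informative (j = i)); tauto.
    + apply IH.
      * intros j Hj. unfold msk. destruct (excluded_middle_informative (j <> i)) as [Hn|]; [| reflexivity].
        apply H. cbn. intros [->|]; tauto.
      * intros j. unfold msk. destruct (excluded_middle_informative (j <> i)); [apply Hx | rewrite Cmod_0; lra].
Qed.

Lemma finite_eventually {I} (l : list I) (P : I -> nat -> Prop) :
  (forall i, exists N, forall n, (N <= n)%nat -> P i n) ->
  exists N, forall n, (N <= n)%nat -> forall i, In i l -> P i n.
Proof.
  intros H. induction l as [|i l [N HN]].
  - exists 0%nat. intros n _ i [].
  - destruct (H i) as [M HM]. exists (Nat.max M N). intros n Hn j [<-|Hj].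
    + apply HM. lia.
    + apply HN; [lia | assumption].
Qed.

Definition coord_cvg {I} (y : nat -> vec I) (z : vec I) : Prop :=
  forall i eps, 0 < eps -> exists N, forall n, (N <= n)%nat -> Cmod (Csub (z i) (y n i)) <= eps.

(** The norm is tested on finite lists, and on a finite list coordinatewise convergence is norm
    convergence. This is how bounds pass to limits that are not norm limits. *)
Lemma nb_fatou {I} (y : nat -> vec I) (z : vec I) r : 0 <= r ->
  coord_cvg y z -> (exists N, forall n, (N <= n)%nat -> nb p (y n) r) -> nb p z r.
Proof.
  intros Hr Hc [N0 HN0]. split; [assumption |]. intros l Hl.
  assert (H : nb p (msk (fun i => In i l) z) r).
  { apply nb_closed; [assumption |]. intros d Hd.
    set (e := d / (INR (length l) + 1)).
    pose proof (pos_INR (length l)) as Pl.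
    assert (He : 0 < e) by (unfold e; apply Rdiv_lt_0_compat; lra).
    destruct (finite_eventually l (fun i n => Cmod (Csub (z i) (y n i)) <= e)) as [N HN].
    { intros i. apply Hc. assumption. }
    set (n := Nat.max N N0).
    apply (nb_ext _ (vadd (msk (fun i => In i l) (y n)) (msk (fun i => In i l) (vsub z (y n))))).
    { intros i. unfold vadd, msk, vsub. destruct (excluded_middle_informative (In i l)); ring. }
    apply nb_add; [apply nb_msk, HN0; lia |].
    apply nb_le with (INR (length l) * e).
    { unfold e. apply (Rmult_le_reg_r (INR (length l) + 1)); [lra |].
      replace (INR (length l) * (d / (INR (length l) + 1)) * (INR (length l) + 1)) with (INR (length l) * d) by (field; lra).
      nra. }
    apply nb_fin; [lra | |]; intros i; unfold msk; destruct (excluded_middle_informative (In i l)); try tauto.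
    - apply HN; [lia | assumption].
    - rewrite Cmod_0. lra. }
  destruct H as [_ H]. specialize (H l Hl). eapply Rle_trans; [| exact H]. right.
  clear. assert (G : forall l', (forall i, In i l' -> In i l) ->
    psum p z l' = psum p (msk (fun i => In i l) z) l').
  { induction l' as [|i l' IH]; intros Hs; [reflexivity |]. cbn. unfold psum in IH. rewrite IH.
    - unfold msk at 2. destruct (excluded_middle_informative (In i l)) as [|Hn]; [reflexivity |].
      exfalso. apply Hn, Hs. now left.
    - intros j Hj. apply Hs. now right. }
  apply G. auto.
Qed.

(** Choose a list whose partial sum is within eps^p of the supremum; any list disjoint from it can
    add at most eps^p. *)
Lemma nb_tail {I} (x : vec I) eps : in_lp p x -> 0 < eps ->
  exists l, nb p (msk (fun i => ~ In i l) x) eps.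
Proof.
  intros [c Hc] He.
  destruct (completeness (fun s => exists l, NoDup l /\ s = psum p x l)) as [m [Hub Hlub]].
  { exists c. intros s [l [Hl ->]]. apply Hc, Hl. }
  { exists 0, nil. split; [constructor | reflexivity]. }
  pose proof (rpow_pos p eps He) as Pe.
  destruct (classic (exists l, NoDup l /\ m - rpow eps p < psum p x l)) as [[l [Hl Hml]]|Hn].
  - exists l. split; [lra |]. intros l2 Hl2.
    assert (G : forall l2, NoDup l2 -> exists l3, NoDup l3 /\ (forall i, In i l3 -> In i l2 /\ ~ In i l) /\
       psum p (msk (fun i => ~ In i l) x) l2 = psum p x l3).
    { clear. induction 1 as [|i l2 Hi H2 [l3 [H3 [H4 H5]]]].
      - exists nil. repeat split; [constructor | | ]; contradiction.
      - cbn. unfold msk at 1. destruct (excluded_middle_informative (~ In i l)) as [Hil|Hil].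
        + exists (i :: l3). split; [| split].
          * constructor; [| assumption]. intros Hi3. apply Hi, H4, Hi3.
          * intros j [<-|Hj]; [tauto |]. destruct (H4 j Hj). tauto.
          * cbn. unfold psum in H5. rewrite H5. reflexivity.
        + exists l3. split; [assumption | split].
          * intros j Hj. destruct (H4 j Hj). tauto.
          * rewrite Cmod_0, rpow_0. unfold psum in H5. rewrite H5. unfold psum; lra. }
    destruct (G l2 Hl2) as [l3 [H3 [H4 ->]]].
    assert (psum p x (l ++ l3) <= m).
    { apply Hub. eexists; split; [| reflexivity]. apply NoDup_app; try assumption.
      intros i Hi Hi3. destruct (H4 i Hi3). contradiction. }
    rewrite psum_app in H. lra.
  - exfalso. assert (m <= m - rpow eps p); [| lra]. apply Hlub. intros s [l [Hl ->]].
    destruct (Rle_or_lt (psum p x l) (m - rpow eps p)); [assumption |]. exfalso. eauto.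
Qed.

End Norms.

(** * Bounded operators *)

Ltac em := match goal with |- context [excluded_middle_informative ?P] =>
  destruct (excluded_middle_informative P) end.

(** Stated with norms instead of p-th powers, so that bounds add and multiply; [op_bound_ob] and
    [ob_op_bound] translate. *)
Definition ob {I J} (p : R) (T : op I J) (al : R) : Prop :=
  0 <= al /\ forall x r, nb p x r -> nb p (T x) (al * r).

Definition bdd {I J} (p : R) (T : op I J) : Prop := is_lin_op p T /\ exists al, ob p T al.

Definition oadd {I J} (T1 T2 : op I J) : op I J := fun x => vadd (T1 x) (T2 x).
Definition oscal {I J} (a : Cx) (T : op I J) : op I J := fun x => vscal a (T x).
Definition ozero {I J} : op I J := fun _ => vzero.
Fixpoint osum {I J} (n : nat) (T : nat -> op I J) : op I J :=
  match n with O => ozero | S n => oadd (osum n T) (T n) end.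

Definition onto {I} (l : list I) : op I I := msk (fun i => In i l).
Definition off {I} (l : list I) : op I I := msk (fun i => ~ In i l).

Section Operators.
Context {p : R} {Hp : exponent p}.

Lemma op_bound_ob {I J} (T : op I J) al : 0 <= al -> op_bound p T al -> ob p T al.
Proof.
  intros Hal H. split; [assumption |]. intros x r Hx. pose proof (nb_in _ _ Hx) as Hi.
  destruct Hx as [Hr Hx]. split; [nra |]. rewrite rpow_mul by (exact _ || assumption). apply H; assumption.
Qed.

Lemma ob_op_bound {I J} (T : op I J) al : ob p T al -> op_bound p T al.
Proof.
  intros [Hal H] x c _ Hc. destruct (lp_bound_nb _ _ Hc) as [r [<- Hr]].
  pose proof (nb_nonneg _ _ Hr). rewrite <- rpow_mul by (exact _ || assumption). apply H. assumption.
Qed.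

Lemma is_bdd_op_bdd {I J} (T : op I J) : is_bdd_op p T <-> bdd p T.
Proof.
  split; intros [H [al H']]; split; try assumption; exists al.
  - apply op_bound_ob; tauto.
  - split; [apply H' | apply ob_op_bound; assumption].
Qed.

Lemma ob_in {I J} (T : op I J) al x : ob p T al -> in_lp p x -> in_lp p (T x).
Proof. intros [_ H] Hx. destruct (in_nb x Hx) as [r Hr]. eapply nb_in, H, Hr. Qed.

Lemma bdd_in {I J} (T : op I J) x : bdd p T -> in_lp p x -> in_lp p (T x).
Proof. intros [_ [al H]]. apply (ob_in _ al); assumption. Qed.

Lemma ob_le {I J} (T : op I J) al be : al <= be -> ob p T al -> ob p T be.
Proof.
  intros Hle [Ha H]. split; [lra |]. intros x r Hx. eapply nb_le; [| apply H, Hx].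
  pose proof (nb_nonneg _ _ Hx). nra.
Qed.

Lemma in_vadd {I} (x y : vec I) : in_lp p x -> in_lp p y -> in_lp p (vadd x y).
Proof.
  intros Hx Hy. destruct (in_nb x Hx), (in_nb y Hy). eapply nb_in, nb_add; eassumption.
Qed.

Lemma in_vscal {I} a (x : vec I) : in_lp p x -> in_lp p (vscal a x).
Proof. intros Hx. destruct (in_nb x Hx). eapply nb_in, nb_scal; eassumption. Qed.

Lemma in_vzero {I} : in_lp p (@vzero I).
Proof. eapply nb_in, nb_zero. Qed.

Lemma in_msk {I} A (x : vec I) : in_lp p x -> in_lp p (msk A x).
Proof. intros Hx. destruct (in_nb x Hx). eapply nb_in, nb_msk; eassumption. Qed.

Lemma lin_add {I J} (T : op I J) x y : is_lin_op p T -> in_lp p x -> in_lp p y ->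
  T (vadd x y) = vadd (T x) (T y).
Proof. intros H Hx Hy. extensionality j. apply H; assumption. Qed.

Lemma lin_scal {I J} (T : op I J) a x : is_lin_op p T -> in_lp p x ->
  T (vscal a x) = vscal a (T x).
Proof. intros H Hx. extensionality j. apply H; assumption. Qed.

Lemma vsub_vadd {I} (x y : vec I) : vsub x y = vadd x (vscal (Copp C1) y).
Proof. extensionality i. unfold vsub, vadd, vscal. ring. Qed.

Lemma lin_sub {I J} (T : op I J) x y : is_lin_op p T -> in_lp p x -> in_lp p y ->
  T (vsub x y) = vsub (T x) (T y).
Proof.
  intros H Hx Hy. rewrite !vsub_vadd, lin_add, lin_scal; auto. apply in_vscal; assumption.
Qed.

Lemma lin_zero {I J} (T : op I J) : is_lin_op p T -> T vzero = vzero.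
Proof.
  intros H. replace (@vzero I) with (vscal C0 (@vzero I)) by (extensionality i; unfold vscal, vzero; ring).
  rewrite lin_scal by (assumption || apply in_vzero). extensionality j. unfold vscal, vzero. ring.
Qed.

(** An [op] is a function on all families, about which nothing is known outside l^p. Operator
    identities are therefore only asked to hold on [in_lp] vectors, and properties are transported
    along such agreement. *)
Lemma lin_eqv {I J} (T T' : op I J) : (forall x, in_lp p x -> T x = T' x) ->
  is_lin_op p T' -> is_lin_op p T.
Proof.
  intros E H. split; [| split].
  - intros x Hx. rewrite E by assumption. apply H, Hx.
  - intros x y Hx Hy j. rewrite !E by (assumption || apply in_vadd; assumption). apply H; assumption.
  - intros a x Hx j. rewrite !E by (assumption || apply in_vscal; assumption). apply H; assumption.
Qed.

Lemma ob_eqv {I J} (T T' : op I J) al : (forall x, in_lp p x -> T x = T' x) ->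
  ob p T' al -> ob p T al.
Proof.
  intros E [Ha H]. split; [assumption |]. intros x r Hx. rewrite E by (eapply nb_in, Hx). auto.
Qed.

Lemma bdd_eqv {I J} (T T' : op I J) : (forall x, in_lp p x -> T x = T' x) -> bdd p T' -> bdd p T.
Proof.
  intros E [H [al H']]. split; [eapply lin_eqv | exists al; eapply ob_eqv]; eassumption.
Qed.

Lemma ob_add {I J} (T T' : op I J) al be : ob p T al -> ob p T' be -> ob p (oadd T T') (al + be).
Proof.
  intros [Ha H] [Hb H']. split; [lra |]. intros x r Hx. rewrite Rmult_plus_distr_r.
  apply nb_add; auto.
Qed.

Lemma ob_sub {I J} (T T' : op I J) al be : ob p T al -> ob p T' be -> ob p (op_sub T T') (al + be).
Proof.
  intros [Ha H] [Hb H']. split; [lra |]. intros x r Hx. rewrite Rmult_plus_distr_r.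
  apply (nb_sub (T x) (T' x)); auto.
Qed.

Lemma ob_comp {I J K} (T : op J K) (T' : op I J) al be :
  ob p T al -> ob p T' be -> ob p (op_comp T T') (al * be).
Proof.
  intros [Ha H] [Hb H']. split; [nra |]. intros x r Hx. rewrite Rmult_assoc. apply H, H', Hx.
Qed.

Lemma ob_zero {I J} : ob p (@ozero I J) 0.
Proof. split; [lra |]. intros x r _. rewrite Rmult_0_l. apply nb_zero. Qed.

Lemma ob_sum {I J} n (T : nat -> op I J) al : 0 <= al -> (forall k, (k < n)%nat -> ob p (T k) al) ->
  ob p (osum n T) (INR n * al).
Proof.
  intros Ha. induction n as [|n IH]; intros H; cbn [osum].
  - rewrite Rmult_0_l. apply ob_zero.
  - rewrite S_INR, Rmult_plus_distr_r, Rmult_1_l. apply ob_add; auto.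
Qed.

Lemma ob_msk {I} (A : I -> Prop) : ob p (msk A) 1.
Proof. split; [lra |]. intros x r Hx. rewrite Rmult_1_l. apply nb_msk, Hx. Qed.

Lemma ob_mul {I} (m : I -> Cx) C : 0 <= C -> (forall i, Cmod (m i) <= C) -> ob p (mul m) C.
Proof. intros HC Hm. split; [assumption |]. intros x r Hx. apply nb_mul; assumption. Qed.

Lemma ob_pull {I J} (f : J -> option I) : pinj f -> ob p (pull f) 1.
Proof. intros Hf. split; [lra |]. intros x r Hx. rewrite Rmult_1_l. apply nb_pull; assumption. Qed.

Lemma ob_reindex {I J} (f : J -> I) : (forall j j', f j = f j' -> j = j') ->
  ob p (fun x : vec I => fun j => x (f j)) 1.
Proof. intros Hf. split; [lra |]. intros x r Hx. rewrite Rmult_1_l. apply nb_reindex; assumption. Qed.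

Lemma bdd_intro {I J} (T : op I J) al : ob p T al ->
  (forall x y, in_lp p x -> in_lp p y -> T (vadd x y) = vadd (T x) (T y)) ->
  (forall a x, in_lp p x -> T (vscal a x) = vscal a (T x)) -> bdd p T.
Proof.
  intros H H1 H2. split; [| exists al; assumption]. split; [| split].
  - intros x. apply (ob_in _ al), H.
  - intros x y Hx Hy j. rewrite H1 by assumption. reflexivity.
  - intros a x Hx j. rewrite H2 by assumption. reflexivity.
Qed.

Lemma bdd_add {I J} (T T' : op I J) : bdd p T -> bdd p T' -> bdd p (oadd T T').
Proof.
  intros [L [al H]] [L' [be H']]. apply (bdd_intro _ _ (ob_add _ _ _ _ H H')).
  - intros x y Hx Hy. unfold oadd. rewrite !lin_add by assumption. extensionality j. unfold vadd. ring.
  - intros a x Hx. unfold oadd. rewrite !lin_scal by assumption. extensionality j. unfold vadd, vscal. ring.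
Qed.

Lemma bdd_sub {I J} (T T' : op I J) : bdd p T -> bdd p T' -> bdd p (op_sub T T').
Proof.
  intros [L [al H]] [L' [be H']]. apply (bdd_intro _ _ (ob_sub _ _ _ _ H H')).
  - intros x y Hx Hy. unfold op_sub. rewrite !lin_add by assumption. extensionality j. unfold vadd. ring.
  - intros a x Hx. unfold op_sub. rewrite !lin_scal by assumption. extensionality j. unfold vscal. ring.
Qed.

Lemma bdd_comp {I J K} (T : op J K) (T' : op I J) : bdd p T -> bdd p T' -> bdd p (op_comp T T').
Proof.
  intros [L [al H]] [L' [be H']]. apply (bdd_intro _ _ (ob_comp _ _ _ _ H H')).
  - intros x y Hx Hy. unfold op_comp. rewrite !lin_add; auto; apply L'; assumption.
  - intros a x Hx. unfold op_comp. rewrite !lin_scal; auto; apply L'; assumption.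
Qed.

Lemma bdd_zero {I J} : bdd p (@ozero I J).
Proof.
  apply (bdd_intro _ _ ob_zero); intros; unfold ozero; extensionality j; unfold vadd, vscal, vzero; ring.
Qed.

Lemma bdd_msk {I} (A : I -> Prop) : bdd p (msk A).
Proof.
  apply (bdd_intro _ _ (ob_msk A)); intros; extensionality i; unfold msk, vadd, vscal; em; ring.
Qed.

Lemma bdd_mul {I} (m : I -> Cx) C : 0 <= C -> (forall i, Cmod (m i) <= C) -> bdd p (mul m).
Proof.
  intros HC Hm. apply (bdd_intro _ _ (ob_mul m C HC Hm)); intros; extensionality i;
    unfold mul, vadd, vscal; ring.
Qed.

Lemma bdd_pull {I J} (f : J -> option I) : pinj f -> bdd p (pull f).
Proof.
  intros Hf. apply (bdd_intro _ _ (ob_pull f Hf)); intros; extensionality i;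
    unfold pull, vadd, vscal; destruct (f i); ring.
Qed.

Lemma bdd_reindex {I J} (f : J -> I) : (forall j j', f j = f j' -> j = j') ->
  bdd p (fun x : vec I => fun j => x (f j)).
Proof. intros Hf. apply (bdd_intro _ _ (ob_reindex f Hf)); reflexivity. Qed.

Lemma bdd_ob_pos {I J} (T : op I J) : bdd p T -> exists al, 0 < al /\ ob p T al.
Proof.
  intros [_ [al H]]. exists (al + 1). destruct H as [Ha H]. split; [lra |].
  apply (ob_le _ al); [lra | split; assumption].
Qed.

(** * Norm limits of operators with finitely many nonzero rows *)

(** The working form of compactness: [apx_compact] and [compact_apx] show that the two coincide for
    a countable target index. *)
Definition apx {I J} (T : op I J) : Prop :=
  bdd p T /\ forall eps, 0 < eps -> exists l, ob p (op_comp (off l) T) eps.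

Definition coapx {I J} (T : op I J) : Prop :=
  forall eps, 0 < eps -> exists l, ob p (op_comp T (off l)) eps.

Lemma apx_bdd {I J} (T : op I J) : apx T -> bdd p T.
Proof. intros []; assumption. Qed.

Lemma apx_eqv {I J} (T T' : op I J) : (forall x, in_lp p x -> T x = T' x) -> apx T' -> apx T.
Proof.
  intros E [H H']. split; [eapply bdd_eqv; eassumption |]. intros eps He.
  destruct (H' eps He) as [l Hl]. exists l. eapply ob_eqv; [| exact Hl].
  intros x Hx. unfold op_comp. rewrite E by assumption. reflexivity.
Qed.

Lemma nb_off_incl {I} (l l' : list I) x r : (forall i, In i l -> In i l') ->
  nb p (off l x) r -> nb p (off l' x) r.
Proof.
  intros H. apply nb_mono. intros i. unfold off, msk.
  destruct (excluded_middle_informative (~ In i l')), (excluded_middle_informative (~ In i l));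
    try lra; [exfalso; auto | rewrite Cmod_0; apply Cmod_nonneg].
Qed.

Lemma ob_off_incl {I J} (l l' : list J) (T : op I J) r : (forall i, In i l -> In i l') ->
  ob p (op_comp (off l) T) r -> ob p (op_comp (off l') T) r.
Proof.
  intros Hl [Hr H]. split; [assumption |]. intros x s Hx. eapply nb_off_incl; [exact Hl | apply H, Hx].
Qed.

Lemma msk_add {I} (A : I -> Prop) x y : msk A (vadd x y) = vadd (msk A x) (msk A y).
Proof. extensionality i. unfold msk, vadd. em; ring. Qed.

Lemma msk_sub {I} (A : I -> Prop) x y : msk A (vsub x y) = vsub (msk A x) (msk A y).
Proof. extensionality i. unfold msk, vsub. em; ring. Qed.

Lemma off_add {I} (l : list I) x y : off l (vadd x y) = vadd (off l x) (off l y).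
Proof. apply msk_add. Qed.

Lemma apx_add {I J} (T T' : op I J) : apx T -> apx T' -> apx (oadd T T').
Proof.
  intros [B H] [B' H']. split; [apply bdd_add; assumption |]. intros eps He.
  destruct (H (eps / 2)) as [l Hl]; [lra |]. destruct (H' (eps / 2)) as [l' Hl']; [lra |].
  exists (l ++ l'). apply (ob_eqv _ (oadd (op_comp (off (l ++ l')) T) (op_comp (off (l ++ l')) T'))).
  { intros x _. apply off_add. }
  replace eps with (eps / 2 + eps / 2) by field.
  apply ob_add; eapply ob_off_incl; try eassumption; intros; apply in_or_app; auto.
Qed.

Lemma apx_lim {I J} (T : op I J) : bdd p T ->
  (forall eps, 0 < eps -> exists T', apx T' /\ ob p (op_sub T T') eps) -> apx T.
Proof.
  intros B H. split; [assumption |]. intros eps He.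
  destruct (H (eps / 2)) as [T' [[_ HT] Ho]]; [lra |]. destruct (HT (eps / 2)) as [l Hl]; [lra |].
  exists l. apply (ob_eqv _ (oadd (op_comp (off l) (op_sub T T')) (op_comp (off l) T'))).
  { intros x _. unfold oadd, op_comp. rewrite <- off_add. f_equal. extensionality j.
    unfold vadd, op_sub. ring. }
  replace eps with (1 * (eps / 2) + eps / 2) by field.
  apply ob_add; [| assumption]. apply ob_comp; [apply ob_msk | assumption].
Qed.

Lemma apx_comp_r {I J K} (T : op J K) (U : op I J) : apx T -> bdd p U -> apx (op_comp T U).
Proof.
  intros [B H] BU. split; [apply bdd_comp; assumption |]. intros eps He.
  destruct (bdd_ob_pos U BU) as [al [Ha HU]]. destruct (H (eps / al)) as [l Hl].
  { apply Rdiv_lt_0_compat; assumption. }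
  exists l. replace eps with (eps / al * al) by (field; lra). apply (ob_comp _ _ _ _ Hl HU).
Qed.

(** On finitely many coordinates U is determined by finitely many vectors of l^p, each of which has
    a small tail. *)
Lemma finite_rows {I J} (U : op I J) (l : list I) : bdd p U -> forall d, 0 < d ->
  exists l', ob p (op_comp (off l') (op_comp U (onto l))) d.
Proof.
  intros BU. induction l as [|i l IH]; intros d Hd.
  - exists nil. apply (ob_eqv _ ozero).
    + intros x _. unfold op_comp. replace (onto nil x) with (@vzero I).
      * rewrite lin_zero by apply BU. extensionality j. unfold off, msk, ozero, vzero. em; reflexivity.
      * extensionality k. unfold onto, msk, vzero. em; [contradiction | reflexivity].
    + apply (ob_le _ 0); [lra | apply ob_zero].
  - destruct (IH (d / 2)) as [l1 H1]; [lra |].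
    (* The basis vector at i, or zero if i already occurs in [l]: the list may have repetitions. *)
    set (e := fun k => if excluded_middle_informative (k = i /\ ~ In i l) then C1 else C0).
    assert (He : in_lp p e).
    { apply (nb_in _ (Cmod (e i))), nb_single. intros k Hk. unfold e. em; [tauto | reflexivity]. }
    assert (HUe : in_lp p (U e)) by (apply BU, He).
    destruct (nb_tail (U e) (d / 2) HUe) as [l2 H2]; [lra |].
    exists (l1 ++ l2).
    apply (ob_eqv _ (oadd (op_comp (off (l1 ++ l2)) (op_comp U (onto l)))
      (fun x => off (l1 ++ l2) (vscal (x i) (U e))))).
    { intros x Hx. unfold oadd, op_comp. rewrite <- off_add. f_equal.
      rewrite <- (lin_scal U) by (assumption || apply BU).
      rewrite <- (lin_add U); [| apply BU | apply in_msk, Hx | apply in_vscal, He].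
      f_equal. extensionality k. unfold onto, msk, vadd, vscal, e.
      destruct (classic (k = i)) as [E|E]; [subst k; destruct (classic (In i l)) | destruct (classic (In i l)), (classic (In k l))];
        repeat em; cbn [In] in *;
        try ring; exfalso; intuition congruence. }
    replace d with (d / 2 + d / 2) by field. apply ob_add.
    + eapply ob_off_incl; [| exact H1]. intros; apply in_or_app; auto.
    + split; [lra |]. intros x r Hx.
      apply (nb_off_incl l2); [intros; apply in_or_app; auto |].
      replace (off l2 (vscal (x i) (U e))) with (vscal (x i) (off l2 (U e))).
      * apply nb_le with (Cmod (x i) * (d / 2)); [| apply nb_scal, H2].
        pose proof (nb_coord _ _ i Hx). pose proof (Cmod_nonneg (x i)). nra.
      * extensionality j. unfold off, msk, vscal. em; ring.
Qed.

(** U may spread out the finitely many large rows of T, but [finite_rows] confines their image again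
    up to a small error. *)
Lemma apx_comp_l {I J K} (U : op J K) (T : op I J) : bdd p U -> apx T -> apx (op_comp U T).
Proof.
  intros BU [B H]. split; [apply bdd_comp; assumption |]. intros eps He.
  destruct (bdd_ob_pos U BU) as [al [Ha HU]]. destruct (bdd_ob_pos T B) as [be [Hb HT]].
  destruct (H (eps / (2 * al))) as [l Hl].
  { apply Rdiv_lt_0_compat; lra. }
  destruct (finite_rows U l BU (eps / (2 * be))) as [l' Hl'].
  { apply Rdiv_lt_0_compat; lra. }
  exists l'.
  apply (ob_eqv _ (oadd (op_comp (off l') (op_comp U (op_comp (off l) T)))
     (op_comp (op_comp (off l') (op_comp U (onto l))) T))).
  { intros x Hx. unfold oadd, op_comp. rewrite <- off_add. f_equal.
    assert (HTx : in_lp p (T x)) by (apply bdd_in; assumption).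
    rewrite <- (lin_add U); [| apply BU | apply in_msk, HTx | apply in_msk, HTx].
    f_equal. extensionality k. unfold onto, off, msk, vadd.
    destruct (excluded_middle_informative (~ In k l)), (excluded_middle_informative (In k l)); try tauto; ring. }
  replace eps with (1 * (al * (eps / (2 * al))) + eps / (2 * be) * be) by (field; lra).
  apply ob_add.
  - apply ob_comp; [apply ob_msk |]. apply ob_comp; assumption.
  - apply ob_comp; assumption.
Qed.

Lemma apx_scal {I J} a (T : op I J) : apx T -> apx (oscal a T).
Proof.
  intros H. apply (apx_eqv _ (op_comp (mul (fun _ => a)) T)); [reflexivity |].
  apply apx_comp_l; [| assumption]. apply (bdd_mul _ (Cmod a)); [apply Cmod_nonneg | intros; lra].
Qed.

Lemma apx_sub {I J} (T T' : op I J) : apx T -> apx T' -> apx (op_sub T T').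
Proof.
  intros H H'. apply (apx_eqv _ (oadd T (oscal (Copp C1) T'))).
  - intros x _. apply (vsub_vadd (T x) (T' x)).
  - apply apx_add, apx_scal; assumption.
Qed.

Lemma apx_zero {I J} : apx (@ozero I J).
Proof.
  split; [apply bdd_zero |]. intros eps He. exists nil. apply (ob_eqv _ ozero).
  - intros x _. extensionality j. unfold op_comp, off, msk, ozero, vzero. em; reflexivity.
  - apply (ob_le _ 0); [lra | apply ob_zero].
Qed.

Lemma apx_sum {I J} n (T : nat -> op I J) : (forall k, apx (T k)) -> apx (osum n T).
Proof. intros H. induction n; cbn [osum]; [apply apx_zero | apply apx_add; auto]. Qed.

Lemma apx_finite_rows {I J} (T : op I J) l : bdd p T ->
  (forall x, in_lp p x -> forall j, ~ In j l -> T x j = C0) -> apx T.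
Proof.
  intros B H. split; [assumption |]. intros eps He. exists l. apply (ob_eqv _ ozero).
  - intros x Hx. extensionality j. unfold op_comp, off, msk, ozero, vzero. em; [apply H; assumption | reflexivity].
  - apply (ob_le _ 0); [lra | apply ob_zero].
Qed.

Lemma apx_onto {I} (l : list I) : apx (onto l).
Proof.
  apply (apx_finite_rows _ l); [apply bdd_msk |]. intros x _ j Hj. unfold onto, msk. em; tauto.
Qed.

Lemma not_ob_witness {I J} (T : op I J) eps : 0 <= eps -> bdd p T -> ~ ob p T eps ->
  exists x, nb p x 1 /\ ~ nb p (T x) eps.
Proof.
  intros He B H. apply NNPP. intros Hn. apply H. split; [assumption |]. intros x r Hx.
  destruct (nb_nonneg _ _ Hx) as [Hr|<-].
  - assert (H1 : nb p (vscal (RtoCx (/ r)) x) 1).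
    { assert (0 < / r) by (apply Rinv_0_lt_compat; assumption).
      apply nb_le with (Cmod (RtoCx (/ r)) * r); [| apply nb_scal, Hx].
      rewrite Cmod_RtoCx, Rabs_pos_eq by lra. right. field. lra. }
    assert (H2 : nb p (T (vscal (RtoCx (/ r)) x)) eps) by (apply NNPP; intros H2; apply Hn; eauto).
    rewrite lin_scal in H2 by (apply B || eapply nb_in, Hx).
    apply (nb_scal (RtoCx r)) in H2. rewrite Cmod_RtoCx, Rabs_pos_eq in H2 by lra.
    rewrite Rmult_comm. eapply nb_ext; [| exact H2]. intros j. unfold vscal, RtoCx, Cmul; cbn [fst snd].
    destruct (T x j) as [u v]. cbn [fst snd]. f_equal; field; lra.
  - rewrite (nb_0_inv x Hx), lin_zero, Rmult_0_r by apply B. apply nb_zero.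
Qed.

End Operators.
Arguments apx p {I J} T.
Arguments coapx p {I J} T.

(** * Compactness *)

Class countable (I : Type) : Prop := countable_enum : exists e : nat -> I, forall i, exists n, e n = i.

#[global] Instance countable_nat : countable nat.
Proof. exists (fun n => n). eauto. Qed.

#[global] Instance countable_prod (I J : Type) : countable I -> countable J -> countable (I * J).
Proof.
  intros [e He] [f Hf]. exists (fun n => let (a, b) := of_nat n in (e a, f b)). intros [i j].
  destruct (He i) as [a <-], (Hf j) as [b <-]. exists (to_nat (a, b)). now rewrite cancel_of_to.
Qed.

#[global] Instance countable_sum (I J : Type) : countable I -> countable J -> countable (I + J).
Proof.
  intros [e He] [f Hf].
  exists (fun n => let (a, b) := of_nat n in if Nat.eqb a 0 then inl (e b) else inr (f b)).
  intros [i|j].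
  - destruct (He i) as [b <-]. exists (to_nat (0%nat, b)). now rewrite cancel_of_to.
  - destruct (Hf j) as [b <-]. exists (to_nat (1%nat, b)). now rewrite cancel_of_to.
Qed.

Definition strict (phi : nat -> nat) : Prop := forall n, (phi n < phi (S n))%nat.

Lemma strict_lt phi : strict phi -> forall m n, (m < n)%nat -> (phi m < phi n)%nat.
Proof. intros H m n. induction 1; [apply H | specialize (H m0); lia]. Qed.

Lemma strict_ge phi : strict phi -> forall n, (n <= phi n)%nat.
Proof. intros H. induction n; [lia | specialize (H n); lia]. Qed.

Lemma strict_comp phi psi : strict phi -> strict psi -> strict (fun n => phi (psi n)).
Proof. intros H H' n. apply strict_lt; [assumption | apply H']. Qed.

Lemma real_subsequence (u : nat -> R) B : (forall n, Rabs (u n) <= B) ->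
  exists phi l, strict phi /\
    forall eps, 0 < eps -> exists N, forall n, (N <= n)%nat -> Rabs (l - u (phi n)) <= eps.
Proof.
  intros HB.
  destruct (Bolzano_Weierstrass u (fun x => - B <= x <= B)) as [l Hl].
  { apply compact_P3. }
  { intros n. specialize (HB n). pose proof (Rle_abs (u n)). pose proof (Rle_abs (- u n)) as H'. rewrite Rabs_Ropp in H'. lra. }
  assert (H : forall nk : nat * nat, exists m, (fst nk < m)%nat /\ Rabs (l - u m) <= / INR (S (snd nk))).
  { intros [n k]. cbn [fst snd].
    assert (Hk : 0 < / INR (S k)) by (apply Rinv_0_lt_compat, lt_0_INR; lia).
    destruct (Hl (disc l (mkposreal _ Hk)) (S n)) as [m [Hm Hd]].
    { exists (mkposreal _ Hk). intros y Hy. exact Hy. }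
    exists m. split; [lia |]. unfold disc in Hd. cbn in Hd. rewrite Rabs_minus_sym. left. exact Hd. }
  apply choice in H as [g Hg].
  set (phi := fix phi n := match n with O => g (0, 0)%nat | S k => g (phi k, S k) end).
  exists phi, l. split.
  - intros n. cbn [phi]. apply (Hg (phi n, S n)).
  - intros eps He. destruct (archimed_cor1 eps He) as [N [HN HN0]]. exists N. intros n Hn.
    apply Rle_trans with (/ INR (S n)).
    + destruct n; cbn [phi]; [apply (Hg (0, 0)%nat) | apply (Hg (phi n, S n))].
    + left. eapply Rle_lt_trans; [| exact HN]. apply Rinv_le_contravar; [apply lt_0_INR; lia | apply le_INR; lia].
Qed.

Lemma Cx_subsequence (u : nat -> Cx) B : (forall n, Cmod (u n) <= B) ->
  exists phi l, strict phi /\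
    forall eps, 0 < eps -> exists N, forall n, (N <= n)%nat -> Cmod (Csub l (u (phi n))) <= eps.
Proof.
  intros HB.
  destruct (real_subsequence (fun n => fst (u n)) B) as [phi [a [Hphi Ha]]].
  { intros n. eapply Rle_trans; [apply fst_le_Cmod | apply HB]. }
  destruct (real_subsequence (fun n => snd (u (phi n))) B) as [psi [b [Hpsi Hb]]].
  { intros n. eapply Rle_trans; [apply snd_le_Cmod | apply HB]. }
  exists (fun n => phi (psi n)), (a, b). split; [apply strict_comp; assumption |].
  intros eps He. destruct (Ha (eps / 2)) as [N HN]; [lra |]. destruct (Hb (eps / 2)) as [M HM]; [lra |].
  exists (Nat.max N M). intros n Hn. eapply Rle_trans; [apply Cmod_le_parts |].
  unfold Csub, Cadd, Copp; cbn [fst snd].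
  pose proof (strict_ge psi Hpsi n). specialize (HN (psi n) ltac:(lia)). specialize (HM n ltac:(lia)).
  unfold Rminus in HN, HM. lra.
Qed.

Lemma diagonal_subsequence {I} {HI : countable I} (u : nat -> vec I) B :
  (forall n i, Cmod (u n i) <= B) -> exists phi y, strict phi /\ coord_cvg (fun n => u (phi n)) y.
Proof.
  intros HB. destruct HI as [e He].
  assert (H : forall sk : (nat -> nat) * nat, exists psi, strict psi /\ exists l,
    forall eps, 0 < eps -> exists N, forall n, (N <= n)%nat ->
      Cmod (Csub l (u (fst sk (psi n)) (e (snd sk)))) <= eps).
  { intros [s k]. destruct (Cx_subsequence (fun n => u (s n) (e k)) B) as [psi [l [H1 H2]]]; [auto |].
    exists psi. split; [assumption |]. exists l. exact H2. }
  apply choice in H as [g Hg].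
  set (Phi := fix Phi k := match k with
                           | O => fun n : nat => n
                           | S k => fun n => Phi k (g (Phi k, k) n) end).
  assert (HPhi : forall k, strict (Phi k)).
  { induction k; cbn [Phi]; [intros n; lia |]. apply strict_comp; [assumption | apply Hg]. }
  (* Each later subsequence is extracted from [Phi k], so the diagonal eventually runs along every
     [Phi k]. *)
  assert (Hsub : forall k d n, exists m, (n <= m)%nat /\ Phi (d + k)%nat n = Phi k m).
  { intros k d. induction d as [|d IH]; intros n; [exists n; split; [lia | reflexivity] |].
    destruct (IH (g (Phi (d + k)%nat, (d + k)%nat) n)) as [m [Hm E]]. exists m. split.
    - pose proof (strict_ge _ (proj1 (Hg (Phi (d + k)%nat, (d + k)%nat))) n). lia.
    - exact E. }
  assert (Hl : forall k, exists l, forall eps, 0 < eps -> exists N, forall n, (N <= n)%nat ->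
    Cmod (Csub l (u (Phi n n) (e k))) <= eps).
  { intros k. destruct (Hg (Phi k, k)) as [_ [l Hlim]]. cbn [fst snd] in Hlim. exists l.
    (* Coordinate [e k] converges from the refinement [Phi (S k)] on, hence the [S k]. *)
    intros eps Heps. destruct (Hlim eps Heps) as [N HN]. exists (Nat.max N (S k)). intros n Hn.
    destruct (Hsub (S k) (n - S k)%nat n) as [m [Hm E]].
    replace (n - S k + S k)%nat with n in E by lia. rewrite E. apply HN. lia. }
  apply choice in Hl as [y Hy].
  apply choice in He as [r Hr].
  exists (fun n => Phi n n), (fun i => y (r i)). split.
  - intros n. cbn [Phi]. apply Nat.lt_le_trans with (Phi n (S n)); [apply HPhi |].
    assert (Hm : (S n <= g (Phi n, n) (S n))%nat) by apply strict_ge, Hg.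
    apply Nat.le_lteq in Hm as [Hm| <-]; [| lia]. apply Nat.lt_le_incl, strict_lt; auto.
  - intros i. specialize (Hy (r i)). rewrite Hr in Hy. exact Hy.
Qed.

Section Compact.
Context {p : R} {Hp : exponent p}.

(** A diagonal subsequence of the images converges coordinatewise; uniformly small tails upgrade
    this to norm convergence. *)
Lemma apx_compact {I J} {HJ : countable J} (T : op I J) : apx p T -> is_compact_op p T.
Proof.
  intros [B H]. split; [apply is_bdd_op_bdd, B |]. intros xs Hxs.
  assert (H1 : forall n, nb p (xs n) 1).
  { intros n. split; [lra |]. rewrite rpow_1 by exact _. apply Hxs. }
  destruct (bdd_ob_pos T B) as [al [Ha HT]].
  assert (H2 : forall n, nb p (T (xs n)) al).
  { intros n. rewrite <- (Rmult_1_r al). apply HT, H1. }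
  destruct (diagonal_subsequence (fun n => T (xs n)) al) as [phi [y [Hphi Hy]]].
  { intros n i. apply nb_coord, H2. }
  exists phi, y. split; [assumption |]. split.
  { apply (nb_in _ al). eapply nb_fatou; [lra | exact Hy | exists 0%nat; intros; apply H2]. }
  intros eps He. destruct (H (eps / 3)) as [l [_ Hl]]; [lra |].
  assert (H3 : forall n, nb p (off l (T (xs n))) (eps / 3)).
  { intros n. rewrite <- (Rmult_1_r (eps / 3)). apply Hl, H1. }
  assert (H4 : nb p (off l y) (eps / 3)).
  { apply (nb_fatou (fun n => off l (T (xs (phi n))))); [lra | | exists 0%nat; intros; apply H3].
    intros i d Hd. destruct (Hy i d Hd) as [N HN]. exists N. intros n Hn. unfold off, msk.
    em; [apply HN, Hn |]. replace (Csub C0 C0) with C0 by ring. rewrite Cmod_0. lra. }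
  set (e := eps / 3 / (INR (length l) + 1)).
  pose proof (pos_INR (length l)) as Pl.
  assert (Pe : 0 < e) by (unfold e; apply Rdiv_lt_0_compat; lra).
  destruct (finite_eventually l (fun i n => Cmod (Csub (y i) (T (xs (phi n)) i)) <= e)) as [N HN].
  { intros i. apply Hy, Pe. }
  exists N. intros n Hn.
  assert (G : nb p (vsub (T (xs (phi n))) y) eps); [| apply G].
  apply (nb_ext _ (vadd (vsub (off l (T (xs (phi n)))) (off l y)) (onto l (vsub (T (xs (phi n))) y)))).
  { intros i. unfold vadd, vsub, off, onto, msk.
    destruct (excluded_middle_informative (~ In i l)), (excluded_middle_informative (In i l)); try tauto; ring. }
  apply nb_le with (eps / 3 + eps / 3 + eps / 3); [lra |].
  apply nb_add; [apply nb_sub; auto |].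
  apply nb_le with (INR (length l) * e).
  { unfold e. apply (Rmult_le_reg_r (INR (length l) + 1)); [lra |].
    replace (INR (length l) * (eps / 3 / (INR (length l) + 1)) * (INR (length l) + 1))
      with (INR (length l) * (eps / 3)) by (field; lra). nra. }
  apply nb_fin; [lra | |]; intros i; unfold onto, msk; em; try tauto.
  - unfold vsub. replace (Csub (T (xs (phi n)) i) (y i)) with (Copp (Csub (y i) (T (xs (phi n)) i))) by ring.
    rewrite Cmod_opp. apply HN; assumption.
  - rewrite Cmod_0. lra.
Qed.

(** Otherwise some unit vectors have images of norm above eps beyond the first n coordinates, for
    every n. A norm limit of a subsequence has a small tail, which contradicts this. *)
Lemma compact_apx {I J} {HJ : countable J} (T : op I J) : is_compact_op p T -> apx p T.
Proof.
  intros [B C]. apply is_bdd_op_bdd in B. split; [assumption |]. intros eps He.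
  apply NNPP. intros Hn. destruct HJ as [e Hsurj].
  assert (H : forall n : nat, exists x, nb p x 1 /\ ~ nb p (off (map e (seq 0 n)) (T x)) eps).
  { intros n. apply (not_ob_witness (op_comp (off (map e (seq 0 n))) T)); [lra | |].
    - apply bdd_comp; [apply bdd_msk | assumption].
    - intros Ho. apply Hn. eauto. }
  apply choice in H as [xs Hxs].
  destruct (C xs) as [phi [y [Hphi [Hy Hlim]]]].
  { intros n. destruct (Hxs n) as [H _]. split; [eapply nb_in, H |]. rewrite <- (rpow_1 p). apply H. }
  destruct (nb_tail y (eps / 2) Hy) as [l Hl]; [lra |].
  destruct (Hlim (eps / 2)) as [N HN]; [lra |].
  destruct (finite_eventually l (fun i n => In i (map e (seq 0 n)))) as [M HM].
  { intros i. destruct (Hsurj i) as [k <-]. exists (S k). intros n Hk. apply in_map, in_seq. lia. }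
  set (n := Nat.max N M). destruct (Hxs (phi n)) as [_ Hbad]. apply Hbad.
  set (L := map e (seq 0 (phi n))).
  apply (nb_ext _ (vadd (off L (vsub (T (xs (phi n))) y)) (off L y))).
  { intros i. unfold vadd, vsub, off, msk. em; ring. }
  replace eps with (eps / 2 + eps / 2) by field. apply nb_add.
  - apply nb_msk. split; [lra |]. apply HN. lia.
  - apply (nb_off_incl l); [| exact Hl]. intros i Hi. apply HM; [| assumption].
    pose proof (strict_ge phi Hphi n). lia.
Qed.

Lemma lp_bound_disjoint {I} (x y : vec I) c d : (forall i, x i = C0 \/ y i = C0) ->
  lp_bound p x c -> lp_bound p y d -> lp_bound p (vadd x y) (c + d).
Proof.
  intros H Hx Hy l Hl. replace (psum p (vadd x y) l) with (psum p x l + psum p y l).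
  - specialize (Hx l Hl). specialize (Hy l Hl). lra.
  - clear Hl. induction l as [|i l IH]; [apply Rplus_0_l |].
    change (rpow (Cmod (x i)) p + psum p x l + (rpow (Cmod (y i)) p + psum p y l) =
      rpow (Cmod (vadd x y i)) p + psum p (vadd x y) l). rewrite <- IH. unfold vadd at 1.
    destruct (H i) as [E|E]; rewrite E; rewrite Cmod_0, rpow_0.
    + replace (Cadd C0 (y i)) with (y i) by ring. lra.
    + replace (Cadd (x i) C0) with (x i) by ring. lra.
Qed.

(** N^(1/p) grows more slowly than k N when p > 1; exp a is the value of N at which the two are
    equal. *)
Lemma sublinear_root k : 0 < k -> exists N, (0 < N)%nat /\ INR N <= rpow (k * INR N) p.
Proof.
  intros Hk. pose proof exponent_gt1 as Hp1.
  set (a := - (p * ln k) / (p - 1)).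
  destruct (INR_archimed 1 (exp a)) as [N HN]; [lra |]. rewrite Rmult_1_r in HN.
  assert (P : 0 < INR N) by (pose proof (exp_pos a); lra).
  exists N. split; [apply INR_lt; exact P |].
  rewrite rpow_Rpower by nra. unfold Rpower.
  rewrite <- (exp_ln (INR N)) at 1 by assumption. rewrite ln_mult by assumption.
  assert (Hl : a < ln (INR N)). { rewrite <- (ln_exp a). apply ln_increasing; [apply exp_pos | lra]. }
  assert (E : (p - 1) * a = - (p * ln k)) by (unfold a; field; lra).
  assert (ln (INR N) <= p * (ln k + ln (INR N))) by nra.
  destruct H as [H|H]; [left; apply exp_increasing, H | right; f_equal; exact H].
Qed.

(* Gliding hump: unit vectors with disjoint supports whose images are all close to one vector y
   would give [N |y| <= C N^(1/p)]; this is where [p > 1] enters. *)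
Lemma compact_coapx {I J} (T : op I J) : is_compact_op p T -> coapx p T.
Proof.
  intros [B C]. apply is_bdd_op_bdd in B. intros eps He. apply NNPP. intros Hn.
  destruct (bdd_ob_pos T B) as [al [Ha HT]].
  (* Making the bad vector finitely supported costs at most al (eps / (4 al)) = eps/4, which leaves
     3/4 eps. *)
  assert (H : forall l : list I, exists wl : vec I * list I, nb p (fst wl) 1 /\
    ~ nb p (T (fst wl)) (3 / 4 * eps) /\
    (forall i, In i l -> fst wl i = C0) /\ (forall i, ~ In i (snd wl) -> fst wl i = C0)).
  { intros l. destruct (not_ob_witness (op_comp T (off l)) eps) as [x [Hx Hbad]]; [lra | | |].
    - apply bdd_comp; [assumption | apply bdd_msk].
    - intros Ho. apply Hn. eauto.
    - set (z := off l x). assert (Hz : nb p z 1) by apply nb_msk, Hx.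
      destruct (nb_tail z (eps / (4 * al)) (nb_in _ _ Hz)) as [l2 Hl2]; [apply Rdiv_lt_0_compat; lra |].
      exists (onto l2 z, l2). cbn [fst snd]. split; [apply nb_msk, Hz |]. split; [| split].
      + intros Hw. apply Hbad. unfold op_comp. fold z.
        replace z with (vadd (onto l2 z) (msk (fun i => ~ In i l2) z)).
        2:{ extensionality i. unfold vadd, onto, msk.
            destruct (excluded_middle_informative (~ In i l2)), (excluded_middle_informative (In i l2)); try tauto; ring. }
        rewrite (lin_add (p := p)); [| apply B | apply in_msk; eapply nb_in, Hz | apply in_msk; eapply nb_in, Hz].
        apply nb_le with (3 / 4 * eps + al * (eps / (4 * al))); [right; field; lra |].
        apply nb_add; [assumption |]. apply HT, Hl2.
      + intros i Hi. unfold onto, z, off, msk. em; [| reflexivity]. em; tauto.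
      + intros i Hi. unfold onto, msk. em; tauto. }
  apply choice in H as [g Hg].
  set (L := fix L n := match n with O => nil | S n => L n ++ snd (g (L n)) end).
  set (w := fun n => fst (g (L n))).
  assert (Lmono : forall m n i, (m <= n)%nat -> In i (L m) -> In i (L n)).
  { intros m n i. induction 1; intros Hi; [assumption |]. cbn [L]. apply in_or_app. auto. }
  assert (Hdisj : forall m n i, (m < n)%nat -> w m i = C0 \/ w n i = C0).
  { intros m n i Hmn. destruct (classic (In i (L (S m)))) as [Hi|Hi].
    - right. destruct (Hg (L n)) as [_ [_ [H0 _]]]. apply H0, (Lmono (S m)); [lia | assumption].
    - left. destruct (Hg (L m)) as [_ [_ [_ H0]]]. apply H0. intros Hi'. apply Hi. cbn [L]. apply in_or_app. auto. }
  destruct (C w) as [phi [y [Hphi [Hy Hlim]]]].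
  { intros n. destruct (Hg (L n)) as [H _]. split; [eapply nb_in, H |]. rewrite <- (rpow_1 p). apply H. }
  destruct (Hlim (eps / 4)) as [M HM]; [lra |].
  destruct (sublinear_root (eps / (4 * al))) as [N [HN HN']]; [apply Rdiv_lt_0_compat; lra |].
  assert (HNpos : 0 < INR N) by (apply lt_0_INR; assumption).
  set (zs := fix zs n := match n with O => vzero | S n => vadd (zs n) (w (phi (M + n)%nat)) end).
  assert (Hzs0 : forall n m i, (n <= m)%nat -> zs n i = C0 \/ w (phi (M + m)%nat) i = C0).
  { intros n m i. induction n as [|n IH]; intros Hnm; cbn [zs]; [left; reflexivity |].
    destruct IH as [IH|IH]; [lia | | auto].
    destruct (Hdisj (phi (M + n)%nat) (phi (M + m)%nat) i) as [E|E]; [apply strict_lt; [assumption | lia] | | auto].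
    left. unfold vadd. rewrite IH, E. ring. }
  assert (Hzs : forall n, lp_bound p (zs n) (INR n)).
  { induction n as [|n IH]; cbn [zs].
    - change (INR 0) with 0. rewrite <- (rpow_0 p). apply nb_zero.
    - rewrite S_INR. apply lp_bound_disjoint; [intros i; apply Hzs0; lia | assumption |].
      rewrite <- (rpow_1 p). apply Hg. }
  assert (HTz : forall n, nb p (vsub (T (zs n)) (vscal (RtoCx (INR n)) y)) (INR n * (eps / 4))).
  { induction n as [|n IH]; cbn [zs].
    - rewrite (lin_zero (p := p)) by apply B. change (INR 0) with 0. rewrite Rmult_0_l. eapply nb_ext; [| apply nb_zero].
      intros j. unfold vsub, vscal, vzero, RtoCx, Csub, Cadd, Cmul, Copp, C0. cbn. f_equal; ring.
    - rewrite (lin_add (p := p)); [| apply B | eexists; apply Hzs | eapply nb_in, Hg].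
      rewrite S_INR, Rmult_plus_distr_r, Rmult_1_l.
      apply (nb_ext _ (vadd (vsub (T (zs n)) (vscal (RtoCx (INR n)) y)) (vsub (T (w (phi (M + n)%nat))) y))).
      { intros j. unfold vsub, vadd, vscal. 
        replace (RtoCx (INR n + 1)) with (Cadd (RtoCx (INR n)) C1)
          by (unfold RtoCx, Cadd, C1; cbn; f_equal; ring). ring. }
      apply nb_add; [assumption |]. split; [lra |]. apply HM. lia. }
  (* N disjoint humps have total norm at most N^(1/p), which is at most N eps / (4 al), and T sends
     their sum to within N eps / 4 of N y. So |y| <= eps/2, and eps/4 + eps/2 contradicts the 3/4
     eps above. *)
  assert (HyN : nb p (vscal (RtoCx (INR N)) y) (INR N * (eps / 2))).
  { apply (nb_ext _ (vsub (T (zs N)) (vsub (T (zs N)) (vscal (RtoCx (INR N)) y)))).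
    { intros j. unfold vsub. ring. }
    apply nb_le with (al * (eps / (4 * al) * INR N) + INR N * (eps / 4)); [right; field; lra |].
    apply nb_sub; [| apply HTz]. apply HT. split.
    - apply Rmult_le_pos; [| lra]. left. apply Rdiv_lt_0_compat; lra.
    - eapply lp_bound_le; [exact HN' | apply Hzs]. }
  assert (Hy2 : nb p y (eps / 2)).
  { apply (nb_scal (RtoCx (/ INR N))) in HyN.
    assert (0 < / INR N) by (apply Rinv_0_lt_compat; assumption).
    rewrite Cmod_RtoCx, Rabs_pos_eq in HyN by lra.
    replace (/ INR N * (INR N * (eps / 2))) with (eps / 2) in HyN by (field; lra).
    eapply nb_ext; [| exact HyN]. intros j. unfold vscal, RtoCx, Cmul. destruct (y j) as [u v]. cbn.
    f_equal; field; lra. }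
  destruct (Hg (L (phi M))) as [_ [Hbad _]]. apply Hbad. fold (w (phi M)).
  apply (nb_ext _ (vadd (vsub (T (w (phi M))) y) y)).
  { intros j. unfold vadd, vsub. ring. }
  replace (3 / 4 * eps) with (eps / 4 + eps / 2) by field. apply nb_add; [| assumption].
  split; [lra |]. apply HM. lia.
Qed.

Lemma apx_coapx {I J} {HJ : countable J} (T : op I J) : apx p T -> coapx p T.
Proof. intros H. apply compact_coapx, apx_compact, H. Qed.

(** * Direct sums *)

Lemma lp_least {I} (x : vec I) : in_lp p x ->
  exists m, lp_bound p x m /\ forall c, lp_bound p x c -> m <= c.
Proof.
  intros [c Hc].
  destruct (completeness (fun s => exists l, NoDup l /\ s = psum p x l)) as [m [Hub Hlub]].
  { exists c. intros s [l [Hl ->]]. apply Hc, Hl. }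
  { exists 0, nil. split; [constructor | reflexivity]. }
  exists m. split.
  - intros l Hl. apply Hub. eauto.
  - intros c' Hc'. apply Hlub. intros s [l [Hl ->]]. apply Hc', Hl.
Qed.

Lemma psum_map {I J} (x : vec J) (f : I -> J) l : psum p x (map f l) = psum p (fun i => x (f i)) l.
Proof. induction l as [|i l IH]; [reflexivity |]. cbn. f_equal. exact IH. Qed.

Lemma psum_eq_in {I} (x y : vec I) l : (forall i, In i l -> x i = y i) -> psum p x l = psum p y l.
Proof.
  intros H. induction l as [|i l IH]; [reflexivity |]. cbn. rewrite H by (left; reflexivity).
  f_equal. apply IH. intros j Hj. apply H. right. exact Hj.
Qed.

Lemma NoDup_map_inj {I J} (f : I -> J) l : (forall i j, f i = f j -> i = j) -> NoDup l -> NoDup (map f l).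
Proof. intros Hf. apply FinFun.Injective_map_NoDup. exact Hf. Qed.

Lemma slice_split {J} (k : nat) (l : list (nat * J)) : NoDup l ->
  exists (a : list J) (b : list (nat * J)), Permutation l (map (pair k) a ++ b) /\ NoDup a /\ NoDup b /\
    (forall g, In g b -> fst g <> k).
Proof.
  induction 1 as [|[k' j] l Hg Hl [a [b [Hp1 [Ha [Hb Hk]]]]]].
  - exists nil, nil. repeat split; try constructor. contradiction.
  - destruct (Nat.eq_dec k' k) as [->|Hne].
    + exists (j :: a), b. repeat split; try assumption.
      * cbn. constructor. assumption.
      * constructor; [| assumption]. intros Hj. apply Hg. rewrite Hp1. apply in_or_app. left.
        now apply in_map.
    + exists a, ((k', j) :: b). repeat split; try assumption.
      * rewrite Hp1. apply Permutation_middle.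
      * constructor; [| assumption]. intros Hj. apply Hg. rewrite Hp1. apply in_or_app. now right.
      * intros g [<-|Hg']; [exact Hne | auto].
Qed.

(** A finite test list meets finitely many summands, so these can be peeled off one at a time, each
    using up its share of the bound [c]. *)
Lemma dsum_seq_psum {I J} (T : nat -> op I J) al : (forall k, ob p (T k) al) ->
  forall ks x c l, lp_bound p x c -> NoDup l -> (forall g, In g l -> In (fst g) ks) ->
    psum p (dsum_seq T x) l <= rpow al p * c.
Proof.
  intros HT ks. induction ks as [|k ks IH]; intros x c l Hx Hl Hks.
  - destruct l as [|g l]; [| exfalso; apply (Hks g); now left]. cbn.
    apply Rmult_le_pos; [apply rpow_nonneg | apply (lp_bound_nonneg _ _ Hx)].
  - destruct (slice_split k l Hl) as [a [b [Hperm [Ha [Hb Hk]]]]].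
    set (xk := fun i => x (k, i)).
    assert (Hxk : in_lp p xk).
    { destruct (lp_bound_nb _ _ Hx) as [r [_ Hr]]. apply (nb_in _ r).
      apply (nb_reindex (fun i => (k, i))); [intros i i' [=]; assumption | exact Hr]. }
    destruct (lp_least xk Hxk) as [m [Hm Hleast]].
    set (x' := msk (fun g => fst g <> k) x).
    (* True only because [m] is the least bound of the slice: a larger one could not be
       subtracted. *)
    assert (Hx' : lp_bound p x' (c - m)).
    { intros l2 Hl2. destruct (slice_split k l2 Hl2) as [a2 [b2 [Hperm2 [Ha2 [Hb2 Hk2]]]]].
      rewrite (psum_perm _ _ _ Hperm2), psum_app.
      assert (E1 : psum p x' (map (pair k) a2) = 0).
      { rewrite psum_map. rewrite (psum_eq_in _ vzero).
        - pose proof (nb_zero (p := p) (I := I)) as [_ Hz]. specialize (Hz a2 Ha2).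
          rewrite rpow_0 in Hz. pose proof (psum_nonneg (p := p) (@vzero I) a2). lra.
        - intros i _. unfold x', msk. em; [| reflexivity]. cbn in *. tauto. }
      assert (E2 : psum p x' b2 = psum p x b2).
      { apply psum_eq_in. intros g Hg. unfold x', msk. em; [reflexivity |]. exfalso. apply (Hk2 g) in Hg. tauto. }
      rewrite E1, E2.
      assert (m <= c - psum p x b2); [| lra]. apply Hleast. intros l3 Hl3.
      assert (G : psum p x (map (pair k) l3 ++ b2) <= c).
      { apply Hx, NoDup_app.
        - apply NoDup_map_inj; [intros i j [=]; assumption | assumption].
        - assumption.
        - intros g Hg Hg'. apply in_map_iff in Hg as [i [<- _]]. apply (Hk2 _ Hg'). reflexivity. }
      rewrite psum_app, psum_map in G. unfold xk. lra. }
    rewrite (psum_perm _ _ _ Hperm), psum_app, psum_map.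
    replace c with (m + (c - m)) by ring. rewrite Rmult_plus_distr_l. apply Rplus_le_compat.
    + change (psum p (T k xk) a <= rpow al p * m). apply (ob_op_bound _ _ (HT k)); assumption.
    + rewrite (psum_eq_in _ (dsum_seq T x')).
      * apply IH; [assumption | assumption |]. intros g Hg.
        destruct (Hks g) as [E|Hin]; [| | assumption].
        -- rewrite Hperm. apply in_or_app. now right.
        -- exfalso. apply (Hk g Hg). auto.
      * intros [k' j] Hg. unfold dsum_seq. cbn [fst snd]. f_equal. extensionality i. unfold x', msk. em; [reflexivity |].
        exfalso. cbn in *. apply (Hk _ Hg). apply NNPP. assumption.
Qed.

Lemma ob_dsum_seq {I J} (T : nat -> op I J) al : (forall k, ob p (T k) al) -> ob p (dsum_seq T) al.
Proof.
  intros H. assert (Ha : 0 <= al) by apply (H 0%nat). apply op_bound_ob; [assumption |].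
  intros x c _ Hc l Hl. apply (dsum_seq_psum T al H (map fst l)); [assumption | assumption |].
  intros g Hg. apply in_map, Hg.
Qed.

Lemma in_slice {I} (x : vec (nat * I)) k : in_lp p x -> in_lp p (fun i => x (k, i)).
Proof.
  intros Hx. destruct (in_nb x Hx) as [r Hr]. apply (nb_in _ r).
  apply (nb_reindex (fun i => (k, i))); [intros i i' [=]; assumption | exact Hr].
Qed.

Lemma bdd_dsum_seq {I J} (T : nat -> op I J) al : (forall k, is_lin_op p (T k)) ->
  (forall k, ob p (T k) al) -> bdd p (dsum_seq T).
Proof.
  intros L H. apply (bdd_intro _ _ (ob_dsum_seq T al H)).
  - intros x y Hx Hy. extensionality g. destruct g as [k j]. unfold dsum_seq, vadd at 2; cbn [fst snd].
    apply (L k); apply in_slice; assumption.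
  - intros a x Hx. extensionality g. destruct g as [k j]. unfold dsum_seq, vscal at 2; cbn [fst snd].
    apply (L k); apply in_slice; assumption.
Qed.

End Compact.

(** * Quasicentral multipliers *)

(** The circle with centre and radius 1/2, that is |1 - 2b| = 1. For a transposition s, the operator
    1 + b (s - 1) has the eigenvalues 1 and 1 - 2b. The circle joins 0 to 1, the values that give 1
    and s. *)
Definition circ (b : Cx) : Prop := fst b = fst b ^ 2 + snd b ^ 2.

Lemma circ_le b : circ b -> Cmod b <= 1.
Proof.
  intros H. pose proof (Cmod_sqr b) as E. rewrite <- H in E. pose proof (fst_le_Cmod b).
  pose proof (Cmod_nonneg b). pose proof (Rle_abs (fst b)). nra.
Qed.

Lemma circ_0 : circ C0.
Proof. unfold circ, C0. cbn. ring. Qed.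

Lemma circ_compl b : circ b -> circ (Csub C1 b).
Proof. destruct b as [u v]. unfold circ, Csub, Cadd, Copp, C1. cbn. intros. nra. Qed.

Lemma abs_increment_le (f f' : R -> R) : (forall x, derivable_pt_lim f x (f' x)) ->
  (forall x, Rabs (f' x) <= 1) -> forall a b, a <= b -> Rabs (f b - f a) <= b - a.
Proof.
  intros Hd H1 a b [Hab| ->]; [| rewrite !Rminus_diag, Rabs_R0; lra].
  destruct (MVT_cor2 f f' a b Hab) as [c [E _]]; [auto |].
  rewrite E, Rabs_mult, (Rabs_pos_eq (b - a)) by lra.
  specialize (H1 c). nra.
Qed.

(* Half the unit circle shifted to [{|b|^2 = Re b}], traversed in [N] steps. *)
Definition arc (N q : nat) : Cx :=
  ((1 - cos (PI * INR q / INR N)) / 2, - sin (PI * INR q / INR N) / 2).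

Lemma arc_circ N q : circ (arc N q).
Proof.
  unfold circ, arc. cbn [fst snd]. set (t := PI * INR q / INR N).
  pose proof (sin2_cos2 t) as H. unfold Rsqr in H. nra.
Qed.

Lemma arc_0 N : arc N 0 = C0.
Proof.
  unfold arc, C0. replace (PI * INR 0 / INR N) with 0 by (cbn; unfold Rdiv; ring).
  rewrite cos_0, sin_0. f_equal; field.
Qed.

Lemma arc_N N : (0 < N)%nat -> arc N N = C1.
Proof.
  intros HN. apply lt_0_INR in HN.
  unfold arc, C1. replace (PI * INR N / INR N) with PI by (field; lra).
  rewrite cos_PI, sin_PI. f_equal; field.
Qed.

Lemma arc_step N q : (0 < N)%nat -> Cmod (Csub (arc N (S q)) (arc N q)) <= PI / INR N.
Proof.
  intros HN. apply lt_0_INR in HN. eapply Rle_trans; [apply Cmod_le_parts |].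
  unfold arc, Csub, Cadd, Copp. cbn [fst snd].
  set (a := PI * INR q / INR N). set (b := PI * INR (S q) / INR N).
  assert (E : b - a = PI / INR N) by (unfold a, b; rewrite S_INR; field; lra).
  assert (0 < PI / INR N) by (apply Rdiv_lt_0_compat; [apply PI_RGT_0 | assumption]).
  assert (H1 : Rabs (cos b - cos a) <= b - a).
  { apply (abs_increment_le cos (fun x => - sin x)); [intros; apply derivable_pt_lim_cos | | lra].
    intros x. rewrite Rabs_Ropp. apply Rabs_le. pose proof (SIN_bound x). lra. }
  assert (H2 : Rabs (sin b - sin a) <= b - a).
  { apply (abs_increment_le sin cos); [intros; apply derivable_pt_lim_sin | | lra].
    intros x. apply Rabs_le. pose proof (COS_bound x). lra. }
  rewrite <- E.
  replace ((1 - cos b) / 2 + - ((1 - cos a) / 2)) with (- ((cos b - cos a) / 2)) by field.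
  replace (- sin b / 2 + - (- sin a / 2)) with (- ((sin b - sin a) / 2)) by field.
  rewrite !Rabs_Ropp. unfold Rdiv. rewrite !Rabs_mult, !(Rabs_pos_eq (/ 2)) by lra. lra.
Qed.

Definition comm {I} (T : op I I) (m : I -> Cx) : op I I :=
  op_sub (op_comp T (mul m)) (op_comp (mul m) T).

(** The projection onto the first copy of l^p, towards which all multipliers tend. *)
Definition chi (i : nat + nat) : Cx := match i with inl _ => C1 | inr _ => C0 end.
Definition rk (i : nat + nat) : nat := match i with inl n | inr n => n end.
Definition below (m : nat) : op (nat + nat) (nat + nat) := msk (fun i => (rk i < m)%nat).
Definition above (m : nat) : op (nat + nat) (nat + nat) := msk (fun i => (m <= rk i)%nat).

Lemma msk_absorb {I} (A B : I -> Prop) x : (forall i, A i -> B i) -> msk B (msk A x) = msk A x.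
Proof.
  intros H. extensionality i. unfold msk.
  destruct (excluded_middle_informative (A i)), (excluded_middle_informative (B i)); auto. exfalso; auto.
Qed.

Lemma msk_absorb' {I} (A B : I -> Prop) x : (forall i, A i -> B i) -> msk A (msk B x) = msk A x.
Proof.
  intros H. extensionality i. unfold msk.
  destruct (excluded_middle_informative (A i)), (excluded_middle_informative (B i)); auto. exfalso; auto.
Qed.

Lemma rk_bound (l : list (nat + nat)) : exists M, forall i, In i l -> (rk i < M)%nat.
Proof.
  induction l as [|i l [M HM]]; [exists 0%nat; contradiction |].
  exists (Nat.max M (S (rk i))). intros j [<-|Hj]; [lia |]. specialize (HM j Hj). lia.
Qed.

Lemma below_onto m : below m = onto (map inl (seq 0 m) ++ map inr (seq 0 m)).
Proof.
  extensionality x. extensionality i. unfold below, onto, msk.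
  assert (H : (rk i < m)%nat <-> In i (map inl (seq 0 m) ++ map inr (seq 0 m))).
  { rewrite in_app_iff, !in_map_iff. split.
    - intros Hi. destruct i as [n|n]; [left | right]; exists n; (split; [reflexivity |]); apply in_seq; cbn in Hi; lia.
    - intros [[n [<- Hn]]|[n [<- Hn]]]; apply in_seq in Hn; cbn; lia. }
  destruct (excluded_middle_informative (rk i < m)%nat), (excluded_middle_informative (In i (map inl (seq 0 m) ++ map inr (seq 0 m)))); tauto.
Qed.

Section Quasicentral.
Context {p : R} {Hp : exponent p}.

Lemma coapx_above {J} (K : op (nat + nat) J) e : coapx p K -> 0 < e ->
  exists M, forall m, (M <= m)%nat -> ob p (op_comp K (above m)) e.
Proof.
  intros H He. destruct (H e He) as [l Hl]. destruct (rk_bound l) as [M HM]. exists M. intros m Hm.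
  apply (ob_eqv _ (op_comp (op_comp K (off l)) (above m))).
  - intros x _. unfold op_comp, off, above. rewrite msk_absorb; [reflexivity |].
    intros i Hi Hin. specialize (HM i Hin). lia.
  - rewrite <- (Rmult_1_r e). apply ob_comp; [exact Hl | apply ob_msk].
Qed.

(** The two corners are small for different reasons: [below m] composed with T is compact, so its
    columns decay by [apx_coapx], whereas T composed with [below m] has decaying rows by
    [finite_rows]. *)
Lemma corners_small (T : op (nat + nat) (nat + nat)) m e : bdd p T -> 0 < e ->
  exists M, forall m', (M <= m')%nat ->
    ob p (op_comp (below m) (op_comp T (above m'))) e /\ ob p (op_comp (above m') (op_comp T (below m))) e.
Proof.
  intros BT He.
  destruct (coapx_above (op_comp (below m) T) e) as [M1 H1]; [| assumption |].
  { apply apx_coapx, apx_comp_r; [| assumption]. rewrite below_onto. apply apx_onto. }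
  destruct (finite_rows T (map inl (seq 0 m) ++ map inr (seq 0 m)) BT e He) as [l Hl].
  rewrite <- below_onto in Hl. destruct (rk_bound l) as [M2 HM2].
  exists (Nat.max M1 M2). intros m' Hm'. split; [apply H1; lia |].
  apply (ob_eqv _ (op_comp (above m') (op_comp (off l) (op_comp T (below m))))).
  - intros x _. unfold op_comp, above, off. rewrite (msk_absorb' (fun i => (m' <= rk i)%nat)); [reflexivity |].
    intros i Hi Hin. specialize (HM2 i Hin). lia.
  - rewrite <- (Rmult_1_l e). apply ob_comp; [apply ob_msk | exact Hl].
Qed.

(* Rows of level [k] see a part of [x] that no other level sees, so this is a compression of
   the direct sum of copies of [T]. *)
Lemma ob_level_blocks {I} (T : op I I) al (lev : I -> nat) (K : I -> nat -> Prop) :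
  ob p T al -> (forall j k k', K j k -> K j k' -> k = k') ->
  ob p (fun x i => T (msk (fun j => K j (lev i)) x) i) al.
Proof.
  intros HT HK.
  set (f := fun g : nat * I => if excluded_middle_informative (K (snd g) (fst g)) then Some (snd g) else None).
  assert (Hf : pinj f).
  { intros [k j] [k' j'] i. unfold f. cbn [fst snd]. repeat em; try discriminate.
    intros [= <-] [= E]. subst j'. f_equal. eapply HK; eassumption. }
  apply (ob_eqv _ (op_comp (fun y i => y (lev i, i)) (op_comp (dsum_seq (fun _ => T)) (pull f)))).
  - intros x _. extensionality i. unfold op_comp, dsum_seq. cbn [fst snd]. f_equal. extensionality j.
    unfold msk, pull, f. cbn [fst snd]. em; reflexivity.
  - replace al with (1 * (al * 1)) by ring. apply ob_comp.
    + apply (ob_reindex (fun i => (lev i, i))). intros i j [=]. assumption.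
    + apply ob_comp; [apply ob_dsum_seq; auto | apply ob_pull, Hf].
Qed.

Lemma osum_select {I J} (lev : J -> nat) (F : nat -> op I J) n x j :
  osum n (fun q x => msk (fun j => lev j = q) (F q x)) x j =
  if excluded_middle_informative (lev j < n)%nat then F (lev j) x j else C0.
Proof.
  induction n as [|n IH]; cbn [osum].
  - em; [lia | reflexivity].
  - unfold oadd, vadd. rewrite IH. unfold msk. repeat em; try lia; subst; try ring.
Qed.

(** A row of level q of the commutator is T applied to (gam - gam q) x, split by the level of the
    column. Level q drops out. Levels q + 1 and q - 1 carry a factor of size d and form block sums
    of norm al, giving 2 d al. Levels at distance 2 or more contribute 2 e in each direction for
    each of the N + 1 row levels. *)
Lemma ob_comm_levels (T : op (nat + nat) (nat + nat)) al d e N (lev : nat + nat -> nat) (gam : nat -> Cx) :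
  bdd p T -> ob p T al -> 0 <= d -> 0 <= e ->
  (forall q, Cmod (gam q) <= 1) -> (forall q, Cmod (Csub (gam (S q)) (gam q)) <= d) ->
  (forall i, (lev i <= N)%nat) ->
  (forall q, ob p (op_comp (msk (fun i => lev i = q)) (op_comp T (msk (fun i => (S (S q) <= lev i)%nat)))) e) ->
  (forall q, ob p (op_comp (msk (fun i => lev i = S (S q))) (op_comp T (msk (fun i => (lev i <= q)%nat)))) e) ->
  ob p (comm T (fun i => gam (lev i))) (2 * d * al + 4 * (INR N + 1) * e).
Proof.
  intros BT HT Hd He Hg1 Hgd HN Hup Hdn.
  set (g := fun i => gam (lev i)).
  set (A1 := op_comp (mul (fun i => Csub (gam (S (lev i))) (g i)))
                     (fun x i => T (msk (fun j => lev j = S (lev i)) x) i)).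
  set (A2 := op_comp (mul (fun i => Csub (gam (pred (lev i))) (g i)))
                     (fun x i => T (msk (fun j => S (lev j) = lev i) x) i)).
  set (F3 := fun q => op_comp (op_comp T (msk (fun i => (S (S q) <= lev i)%nat)))
                              (mul (fun i => Csub (g i) (gam q)))).
  set (F4 := fun q => op_comp (op_comp T (msk (fun i => (S (S (lev i)) <= q)%nat)))
                              (mul (fun i => Csub (g i) (gam q)))).
  set (A3 := osum (S N) (fun q x => msk (fun i => lev i = q) (F3 q x))).
  set (A4 := osum (S N) (fun q x => msk (fun i => lev i = q) (F4 q x))).
  assert (Hm : forall q, ob p (mul (fun i => Csub (g i) (gam q))) 2).
  { intros q. apply ob_mul; [lra |]. intros i. eapply Rle_trans; [apply Cmod_sub |].
    pose proof (Hg1 (lev i)). pose proof (Hg1 q). unfold g. lra. }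
  assert (LT : is_lin_op p T) by apply BT.
  apply (ob_eqv _ (oadd (oadd A1 A2) (oadd A3 A4))).
  - intros x Hx. extensionality i. unfold oadd, A3, A4.
    unfold vadd. rewrite (osum_select lev F3), (osum_select lev F4).
    em; [| specialize (HN i); lia].
    unfold A1, A2, F3, F4, comm, op_sub, op_comp.
    set (q := lev i).
    assert (in_lp p (mul g x)) as Hgx.
    { destruct (in_nb x Hx) as [r Hr]. eapply nb_in, nb_mul; [| | exact Hr]; [apply Rle_0_1 | intros; apply Hg1]. }
    assert (Hqx : in_lp p (mul (fun i => Csub (g i) (gam q)) x)) by (apply (ob_in _ 2); auto).
    assert (E : T (mul g x) i = Cadd (T (mul (fun j => Csub (g j) (gam q)) x) i) (Cmul (gam q) (T x i))).
    { replace (mul g x) with (vadd (mul (fun j => Csub (g j) (gam q)) x) (vscal (gam q) x)).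
      - rewrite (lin_add (p := p) T) by (assumption || apply in_vscal, Hx).
        rewrite (lin_scal (p := p) T) by assumption. reflexivity.
      - extensionality j. unfold vadd, mul, vscal. ring. }
    rewrite E. unfold mul at 2. unfold g at 2. fold q.
    set (y := mul (fun j => Csub (g j) (gam q)) x) in *.
    assert (E2 : T y = vadd (vadd (vscal (Csub (gam (S q)) (gam q)) (T (msk (fun j => lev j = S q) x)))
                   (vscal (Csub (gam (pred q)) (gam q)) (T (msk (fun j => S (lev j) = q) x))))
                 (vadd (T (msk (fun j => (S (S q) <= lev j)%nat) y)) (T (msk (fun j => (S (S (lev j)) <= q)%nat) y)))).
    { transitivity (T (vadd (vadd (vscal (Csub (gam (S q)) (gam q)) (msk (fun j => lev j = S q) x))
                   (vscal (Csub (gam (pred q)) (gam q)) (msk (fun j => S (lev j) = q) x)))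
                 (vadd (msk (fun j => (S (S q) <= lev j)%nat) y) (msk (fun j => (S (S (lev j)) <= q)%nat) y)))).
      2:{ rewrite !(lin_add (p := p) T), !(lin_scal (p := p) T);
          auto using in_vadd, in_vscal, in_msk. }
      f_equal. extensionality j. unfold vadd, vscal, msk, y, mul, g.
      destruct (Nat.lt_trichotomy (lev j) q) as [Hlt|[Heq|Hgt]].
      - destruct (Nat.eq_dec (S (lev j)) q) as [Hs|Hs].
        + replace (pred q) with (lev j) by lia. repeat em; try lia; ring.
        + repeat em; try lia; ring.
      - rewrite Heq. repeat em; try lia; ring.
      - destruct (Nat.eq_dec (lev j) (S q)) as [Hs|Hs].
        + rewrite Hs. repeat em; try lia; ring.
        + repeat em; try lia; ring. }
    rewrite E2. unfold vadd, vscal, mul, g. fold q. ring.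
  - replace (2 * d * al + 4 * (INR N + 1) * e)
      with (d * al + d * al + (INR (S N) * (2 * e) + INR (S N) * (2 * e))) by (rewrite S_INR; ring).
    apply ob_add; apply ob_add.
    + apply ob_comp.
      * apply ob_mul; [assumption |]. intros i. apply Hgd.
      * apply (ob_level_blocks T al lev (fun j k => lev j = S k)); [assumption |]. intros; lia.
    + apply ob_comp.
      (* At level 0 the truncated [pred] gives level 0 again, and the coefficient is zero. *)
      * apply ob_mul; [assumption |]. intros i. unfold g. destruct (lev i) as [|q]; cbn [pred].
        -- replace (Csub (gam 0%nat) (gam 0%nat)) with C0 by ring. rewrite Cmod_0. assumption.
        -- replace (Csub (gam q) (gam (S q))) with (Copp (Csub (gam (S q)) (gam q))) by ring.
           rewrite Cmod_opp. apply Hgd.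
      * apply (ob_level_blocks T al lev (fun j k => S (lev j) = k)); [assumption |]. intros; lia.
    + apply ob_sum; [lra |]. intros q _. replace (2 * e) with (e * 2) by ring.
      apply (ob_comp _ _ _ _ (Hup q) (Hm q)).
    + apply ob_sum; [lra |]. intros q _. replace (2 * e) with (e * 2) by ring.
      apply (ob_comp (op_comp (msk (fun i => lev i = q)) (op_comp T (msk (fun i => (S (S (lev i)) <= q)%nat)))));
        [| apply Hm].
      (* Rows of level 0 or 1 have no column two levels below; from level 2 on [Hdn] applies with
         the index shifted by 2. *)
      destruct q as [|[|q]]; [| |].
      * apply (ob_eqv _ ozero); [| apply (ob_le _ 0); [assumption | apply ob_zero]].
        intros x _. unfold op_comp. replace (msk (fun i => (S (S (lev i)) <= 0)%nat) x) with (@vzero (nat + nat)).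
        -- rewrite (lin_zero (p := p)) by assumption. extensionality j. unfold msk, ozero, vzero. em; reflexivity.
        -- extensionality j. unfold msk, vzero. em; [lia | reflexivity].
      * apply (ob_eqv _ ozero); [| apply (ob_le _ 0); [assumption | apply ob_zero]].
        intros x _. unfold op_comp. replace (msk (fun i => (S (S (lev i)) <= 1)%nat) x) with (@vzero (nat + nat)).
        -- rewrite (lin_zero (p := p)) by assumption. extensionality j. unfold msk, ozero, vzero. em; reflexivity.
        -- extensionality j. unfold msk, vzero. em; [lia | reflexivity].
      * eapply ob_eqv; [| apply (Hdn q)]. intros x _. unfold op_comp. f_equal. f_equal.
        extensionality j. unfold msk. repeat em; try lia; reflexivity.
Qed.

(** For increasing [mm], level q with 0 < q < N is the block from mm (q - 1) up to mm q; level 0 is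
    everything before mm 0, and the last level N is unbounded. *)
Fixpoint level (mm : nat -> nat) (N r : nat) : nat :=
  match N with O => O | S n => if Nat.leb (mm n) r then S n else level mm n r end.

Lemma level_le mm N r : (level mm N r <= N)%nat.
Proof. induction N; cbn; [lia |]. destruct (Nat.leb (mm N) r); lia. Qed.

Lemma level_gt mm N r q : strict mm -> (q < level mm N r)%nat -> (mm q <= r)%nat.
Proof.
  intros Hs. induction N as [|n IH]; cbn; [lia |]. destruct (Nat.leb_spec (mm n) r); [| apply IH].
  intros Hq. destruct (Nat.eq_dec q n) as [->|]; [assumption |].
  pose proof (strict_lt mm Hs q n ltac:(lia)). lia.
Qed.

Lemma level_lt mm N r q : (level mm N r <= q < N)%nat -> (r < mm q)%nat.
Proof.
  induction N as [|n IH]; cbn; [lia |]. destruct (Nat.leb_spec (mm n) r); [lia |]. intros Hq.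
  destruct (Nat.eq_dec q n) as [->|]; [assumption |]. apply IH. lia.
Qed.

(** The multiplier is [chi] times a function that climbs [arc] in N steps along widely spaced
    blocks. Wide spacing makes each T almost block tridiagonal, and small steps make the tridiagonal
    part almost commute. *)
Lemma quasicentral (Ts : list (op (nat + nat) (nat + nat))) :
  (forall T, In T Ts -> bdd p T /\ apx p (comm T chi)) -> forall m eps, 0 < eps ->
  exists m' (b : nat + nat -> Cx), (m <= m')%nat /\ (forall i, circ (b i)) /\ (forall n, b (inr n) = C0) /\
    (forall n, (n < m)%nat -> b (inl n) = C0) /\ (forall n, (m' <= n)%nat -> b (inl n) = C1) /\
    forall T, In T Ts -> ob p (comm T b) eps.
Proof.
  intros HTs m eps Heps.
  destruct (finite_eventually Ts (fun T n => In T Ts -> ob p T (INR n))) as [A HA].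
  { intros T. destruct (classic (In T Ts)) as [Hin|]; [| exists 0%nat; tauto].
    destruct (bdd_ob_pos T) as [al [Hal HT]]; [apply HTs, Hin |].
    destruct (INR_archimed 1 al) as [n0 Hn0]; [lra |]. exists n0. intros n Hn _.
    apply (ob_le _ al); [| assumption]. apply le_INR in Hn. lra. }
  pose proof PI_RGT_0 as HPI. pose proof (pos_INR A) as PA.
  (* N makes the tridiagonal contribution 2 (PI / N) A at most eps/2; the [+ 1] forces N > 0 even
     for A = 0. *)
  destruct (INR_archimed (eps / 2) (2 * PI * INR A + 1)) as [N HN]; [lra |].
  assert (PN : 0 < INR N).
  { destruct N; [cbn in HN; nra | apply lt_0_INR; lia]. }
  assert (PN' : (0 < N)%nat) by (apply INR_lt; exact PN).
  (* The remaining eps/2 is shared by the far corners, 4 (N + 1) e, and the commutator with [chi],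
     one more e. *)
  set (e := eps / 2 / (4 * (INR N + 1) + 1)).
  assert (Pe : 0 < e) by (unfold e; apply Rdiv_lt_0_compat; lra).
  assert (Hnxt : forall k, exists M, (k < M)%nat /\ forall T, In T Ts ->
     ob p (op_comp (below k) (op_comp T (above M))) e /\ ob p (op_comp (above M) (op_comp T (below k))) e).
  { intros k. destruct (finite_eventually Ts (fun T n => In T Ts ->
      ob p (op_comp (below k) (op_comp T (above n))) e /\ ob p (op_comp (above n) (op_comp T (below k))) e)) as [M HM].
    - intros T. destruct (classic (In T Ts)) as [Hin|]; [| exists 0%nat; tauto].
      destruct (corners_small T k e) as [M HM]; [apply HTs, Hin | assumption |]. exists M. auto.
    - exists (Nat.max M (S k)). split; [lia |]. intros T HT. apply HM; [lia | assumption | assumption]. }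
  apply choice in Hnxt as [nxt Hnxt].
  (* The commutators with [chi] are compact but not small. Beyond [M0] their columns are small, and
     the climb starts only there. *)
  destruct (finite_eventually Ts (fun T n => In T Ts -> ob p (op_comp (comm T chi) (above n)) e)) as [M0 HM0].
  { intros T. destruct (classic (In T Ts)) as [Hin|]; [| exists 0%nat; tauto].
    destruct (coapx_above (comm T chi) e) as [M HM]; [apply apx_coapx, HTs, Hin | assumption |]. exists M. auto. }
  set (mm := fix mm k := match k with O => Nat.max m M0 | S k => nxt (mm k) end).
  assert (Hmm : strict mm) by (intros k; apply Hnxt).
  set (lev := fun i => level mm N (rk i)).
  exists (mm N), (fun i => Cmul (chi i) (arc N (lev i))).
  assert (Hlevel0 : forall i, (rk i < mm 0)%nat -> lev i = 0%nat).
  { intros i Hi. unfold lev. destruct (level mm N (rk i)) eqn:E; [reflexivity |].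
    assert (mm 0 <= rk i)%nat by (apply (level_gt mm N); [assumption | lia]). lia. }
  split; [| split; [| split; [| split; [| split]]]].
  - pose proof (strict_ge mm Hmm N). assert (mm 0 <= mm N)%nat.
    { destruct N; [lia | apply Nat.lt_le_incl, strict_lt; [assumption | lia]]. }
    cbn [mm] in *. lia.
  - intros [n|n]; cbn [chi].
    + replace (Cmul C1 (arc N (lev (inl n)))) with (arc N (lev (inl n))) by ring. apply arc_circ.
    + replace (Cmul C0 (arc N (lev (inr n)))) with C0 by ring. apply circ_0.
  - intros n. cbn [chi]. ring.
  - intros n Hn. rewrite Hlevel0 by (cbn; lia). rewrite arc_0. ring.
  - intros n Hn. replace (lev (inl n)) with N.
    + rewrite arc_N by assumption. cbn [chi]. ring.
    + pose proof (level_le mm N n). unfold lev. cbn [rk].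
      destruct (Nat.eq_dec (level mm N n) N) as [->|Hne]; [reflexivity |]. exfalso.
      pose proof (level_lt mm N n (level mm N n) ltac:(lia)).
      pose proof (strict_lt mm Hmm (level mm N n) N ltac:(lia)). lia.
  - intros T HT. destruct (HTs T HT) as [BT HK].
    assert (HTA : ob p T (INR A)) by (apply (HA A); auto).
    set (g := fun i => arc N (lev i)).
    assert (Hg : forall i, Cmod (g i) <= 1) by (intros; apply circ_le, arc_circ).
    assert (Bg : bdd p (mul g)) by (apply (bdd_mul _ 1); [lra | exact Hg]).
    (* Product rule [T, chi g] = [T, chi] g + chi [T, g]. Since [g] vanishes on level 0,
       [above (mm 0)] can be inserted in front of it. *)
    apply (ob_eqv _ (oadd (op_comp (op_comp (comm T chi) (above (mm 0%nat))) (mul g)) (op_comp (mul chi) (comm T g)))).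
    { intros x Hx. unfold oadd, op_comp. replace (above (mm 0%nat) (mul g x)) with (mul g x).
      - unfold comm, op_sub, op_comp. extensionality i. unfold vadd.
        replace (mul (fun i => Cmul (chi i) (arc N (lev i))) x) with (mul chi (mul g x)).
        + generalize (T (mul chi (mul g x))) (T (mul g x)) (T x). intros u v w. unfold mul, g. ring.
        + extensionality j. unfold mul, g. ring.
      - extensionality i. unfold above, msk. em; [reflexivity |]. unfold mul, g.
        rewrite Hlevel0 by lia. rewrite arc_0. ring. }
    apply (ob_le _ (e * 1 + 1 * (2 * (PI / INR N) * INR A + 4 * (INR N + 1) * e))).
    { assert (2 * (PI / INR N) * INR A <= eps / 2).
      { apply (Rmult_le_reg_r (INR N)); [assumption |].
        replace (2 * (PI / INR N) * INR A * INR N) with (2 * PI * INR A) by (field; lra). lra. }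
      assert (e + 4 * (INR N + 1) * e = eps / 2) by (unfold e; field; lra). lra. }
    apply ob_add; apply ob_comp.
    + apply HM0; [cbn [mm]; lia | assumption | assumption].
    + apply ob_mul; [lra | exact Hg].
    + apply ob_mul; [lra |]. intros [n|n]; cbn [chi]; rewrite ?Cmod_1, ?Cmod_0; lra.
    + apply (ob_comm_levels T (INR A) (PI / INR N) e N lev (arc N)); try assumption; try lra.
      * left. apply Rdiv_lt_0_compat; lra.
      * intros q. apply circ_le, arc_circ.
      * intros q. apply arc_step, PN'.
      * intros i. apply level_le.
      (* Level q ends before mm q and level q + 2 starts at mm (q + 1) = nxt (mm q), exactly the gap
         for which [nxt] was chosen. For q >= N there is no level q + 2. *)
      * intros q. destruct (Nat.lt_ge_cases q N) as [Hq|Hq].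
        -- apply (ob_eqv _ (op_comp (msk (fun i => lev i = q)) (op_comp (op_comp (below (mm q)) (op_comp T (above (mm (S q)))))
              (msk (fun i => (S (S q) <= lev i)%nat))))).
           ++ intros x _. unfold op_comp, below, above. rewrite msk_absorb'; [rewrite msk_absorb; [reflexivity |] |].
              ** intros i Hi. apply (level_gt mm N); [assumption | exact Hi].
              ** intros i Hi. apply (level_lt mm N). unfold lev in Hi. lia.
           ++ replace e with (1 * (e * 1)) by ring. apply ob_comp; [apply ob_msk |].
              apply ob_comp; [| apply ob_msk]. apply Hnxt, HT.
        -- apply (ob_eqv _ ozero); [| apply (ob_le _ 0); [lra | apply ob_zero]].
           intros x _. unfold op_comp. replace (msk (fun i => (S (S q) <= lev i)%nat) x) with (@vzero (nat + nat)).
           ++ rewrite (lin_zero (p := p)) by apply BT. extensionality j. unfold msk, ozero, vzero. em; reflexivity.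
           ++ extensionality j. unfold msk, vzero. em; [| reflexivity]. pose proof (level_le mm N (rk j)). unfold lev in *. lia.
      * intros q. destruct (Nat.lt_ge_cases q N) as [Hq|Hq].
        -- apply (ob_eqv _ (op_comp (msk (fun i => lev i = S (S q))) (op_comp (op_comp (above (mm (S q))) (op_comp T (below (mm q))))
              (msk (fun i => (lev i <= q)%nat))))).
           ++ intros x _. unfold op_comp, below, above. rewrite msk_absorb'; [rewrite msk_absorb; [reflexivity |] |].
              ** intros i Hi. apply (level_lt mm N). unfold lev in Hi. lia.
              ** intros i Hi. apply (level_gt mm N); [assumption |]. unfold lev in Hi. lia.
           ++ replace e with (1 * (e * 1)) by ring. apply ob_comp; [apply ob_msk |].
              apply ob_comp; [| apply ob_msk]. apply Hnxt, HT.
        -- apply (ob_eqv _ ozero); [| apply (ob_le _ 0); [lra | apply ob_zero]].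
           intros x _. extensionality j. unfold op_comp. unfold msk at 1. unfold ozero, vzero. em; [| reflexivity].
           pose proof (level_le mm N (rk j)). unfold lev in *. lia.
Qed.

End Quasicentral.

(** * Successive bisection of [0,1] *)

(* Point [n + 1] is the midpoint of the interval whose left end is point [pre n]; the points
   of one dyadic level are treated in turn. *)
Definition pre (n : nat) : nat := (S n - 2 ^ Nat.log2 (S n))%nat.

Definition upd (f : nat -> R) (k : nat) (y : R) : nat -> R := fun l => if Nat.eqb l k then y else f l.

(** The first component gives the points, the second the right end of the gap starting at each of
    them. Splitting leaves the left half to [pre n] and gives the right half to the new point;
    entries beyond n are default values. *)
Fixpoint ends (n : nat) : (nat -> R) * (nat -> R) :=
  match n with
  | O => (fun _ => 0, fun _ => 1)
  | S n => let V := fst (ends n) in let W := snd (ends n) in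
           let mid := (V (pre n) + W (pre n)) / 2 in
           (upd V (S n) mid, upd (upd W (pre n) mid) (S n) (W (pre n)))
  end.

(** [dya n] is the [n]-th point, and [nxt n k] its right neighbour among the first [n] points
    (or [dya k] itself if it has not been inserted yet). *)
Definition dya (n : nat) : R := fst (ends n) n.
Definition nxt (n k : nat) : R := if Nat.leb k n then snd (ends n) k else dya k.
Definition dya1 (k : nat) : R := match k with O => 1 | S _ => dya k end.
Definition mesh (n : nat) : R := (/ 2) ^ Nat.log2 (S n).

Definition sw (n k : nat) : nat :=
  if Nat.eqb k (pre n) then S n else if Nat.eqb k (S n) then pre n else k.

Lemma pre_le n : (pre n <= n)%nat.
Proof.
  unfold pre. assert (2 ^ Nat.log2 (S n) <> 0)%nat by (apply Nat.pow_nonzero; lia).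
  revert H. generalize (2 ^ Nat.log2 (S n))%nat. lia.
Qed.

Lemma sw_sw n k : sw n (sw n k) = k.
Proof.
  pose proof (pre_le n). unfold sw. destruct (Nat.eqb_spec k (pre n)); [| destruct (Nat.eqb_spec k (S n))];
    repeat match goal with |- context [Nat.eqb ?a ?b] => destruct (Nat.eqb_spec a b) end; lia.
Qed.

Lemma sw_big n k : (S n < k)%nat -> sw n k = k.
Proof.
  intros H. pose proof (pre_le n). unfold sw.
  repeat match goal with |- context [Nat.eqb ?a ?b] => destruct (Nat.eqb_spec a b) end; lia.
Qed.

Lemma ends_dya n k : (k <= n)%nat -> fst (ends n) k = dya k.
Proof.
  induction 1; [reflexivity |]. cbn. unfold upd. destruct (Nat.eqb_spec k (S m)); [lia | assumption].
Qed.

Lemma dya_mid n : dya (S n) = (dya (pre n) + snd (ends n) (pre n)) / 2.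
Proof.
  unfold dya at 1. cbn. unfold upd. rewrite Nat.eqb_refl, ends_dya by apply pre_le. reflexivity.
Qed.

Lemma nxt_0 k : nxt 0 k = dya1 k.
Proof. destruct k; reflexivity. Qed.

(** The new point inherits the neighbour of [pre n], and [pre n] gets the new point as its
    neighbour. The latter is [nxt n (S n)] because a point not yet inserted is its own neighbour by
    convention. *)
Lemma nxt_S n k : nxt (S n) k = nxt n (sw n k).
Proof.
  pose proof (pre_le n). unfold sw, nxt. cbn [ends snd]. unfold upd.
  destruct (Nat.eqb_spec k (pre n)) as [->|Hk].
  - destruct (Nat.leb_spec (pre n) (S n)); [| lia]. destruct (Nat.leb_spec (S n) n); [lia |].
    destruct (Nat.eqb_spec (pre n) (S n)); [lia |]. rewrite dya_mid, ends_dya by lia. reflexivity.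
  - destruct (Nat.eqb_spec k (S n)) as [->|Hk'].
    + rewrite Nat.leb_refl. destruct (Nat.leb_spec (pre n) n); [reflexivity | lia].
    + destruct (Nat.leb_spec k (S n)), (Nat.leb_spec k n); try lia; reflexivity.
Qed.

Lemma dyadic_mid x y : dyadic x -> dyadic y -> dyadic ((x + y) / 2).
Proof.
  intros [a [m ->]] [b [n ->]]. exists (a * 2 ^ n + b * 2 ^ m)%nat, (S (m + n)).
  rewrite plus_INR, !mult_INR, !pow_INR. change (INR 2) with 2. cbn [pow]. rewrite pow_add.
  assert (2 ^ m <> 0) by (apply pow_nonzero; lra). assert (2 ^ n <> 0) by (apply pow_nonzero; lra).
  field. auto.
Qed.

Lemma ends_dyadic n k : dyadic (fst (ends n) k) /\ dyadic (snd (ends n) k) /\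
  0 <= fst (ends n) k <= 1 /\ 0 <= snd (ends n) k <= 1.
Proof.
  revert k. induction n as [|n IH]; intros k.
  - cbn. repeat split; try lra; [exists 0%nat, 0%nat | exists 1%nat, 0%nat]; cbn; field.
  - cbn [ends fst snd]. unfold upd. destruct (IH k) as [H1 [H2 [H3 H4]]].
    destruct (IH (pre n)) as [G1 [G2 [G3 G4]]].
    assert (G5 := dyadic_mid _ _ G1 G2).
    destruct (Nat.eqb k (S n)), (Nat.eqb k (pre n)); repeat split; try assumption; lra.
Qed.

Lemma dya_dyadic n : dyadic (dya n) /\ 0 <= dya n <= 1.
Proof. unfold dya. destruct (ends_dyadic n n) as [H1 [_ [H3 _]]]. auto. Qed.

(** After n insertions there are 2^j + r points. The gaps starting at the r first points and at the
    r newest ones have been halved in the current round; the others still have length 2^-j. *)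
Lemma ends_length n : exists j r, S n = (2 ^ j + r)%nat /\ (r < 2 ^ j)%nat /\
  forall k, (k <= n)%nat ->
    0 <= snd (ends n) k - dya k <= (/ 2) ^ j /\
    ((k < r)%nat \/ (2 ^ j <= k)%nat -> snd (ends n) k - dya k <= (/ 2) ^ S j).
Proof.
  induction n as [|n [j [r [E [Hr IH]]]]].
  - exists 0%nat, 0%nat. cbn. split; [reflexivity |]. split; [lia |]. intros k Hk.
    replace k with 0%nat by lia. unfold dya. cbn. split; [lra |]. lia.
  - assert (Epre : pre n = r).
    { unfold pre. rewrite (Nat.log2_unique (S n) j); [lia | lia |]. rewrite E. cbn. lia. }
    assert (Hhalf : (/ 2) ^ S j = (/ 2) ^ j / 2) by (cbn; field).
    assert (Hpos : 0 < (/ 2) ^ j) by (apply pow_lt; lra).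
    destruct (IH r ltac:(lia)) as [Lr _].
    assert (G : forall k, (k <= S n)%nat ->
      0 <= snd (ends (S n)) k - dya k <= (/ 2) ^ j /\
      ((k < S r)%nat \/ (2 ^ j <= k)%nat -> snd (ends (S n)) k - dya k <= (/ 2) ^ S j)).
    { intros k Hk. pose proof (dya_mid n) as Hmid. rewrite Epre in Hmid.
      cbn [ends snd]. unfold upd. rewrite Epre, ends_dya by lia.
      destruct (Nat.eqb_spec k (S n)) as [->|Hk'].
      - rewrite Hmid, Hhalf. split; [lra | intros; lra].
      - destruct (Nat.eqb_spec k r) as [->|Hkr].
        + rewrite Hhalf. split; [lra | intros; lra].
        + destruct (IH k ltac:(lia)) as [H1 H2]. split; [assumption |]. intros H. apply H2. lia. }
    destruct (Nat.eq_dec (S r) (2 ^ j)) as [Er|Er].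
    (* The round is complete: all gaps are halved and r restarts at 0 on the next dyadic level. *)
    + exists (S j), 0%nat. assert (2 ^ S j = 2 ^ j + 2 ^ j)%nat by (cbn; lia).
      split; [lia |]. split; [lia |]. intros k Hk. destruct (G k Hk) as [H1 H2]. split.
      * split; [apply H1 |]. apply H2. lia.
      * intros. lia.
    + exists j, (S r). split; [lia |]. split; [lia |]. exact G.
Qed.

Lemma ends_mesh n k : (k <= n)%nat -> 0 <= snd (ends n) k - dya k <= mesh n.
Proof.
  intros Hk. destruct (ends_length n) as [j [r [E [Hr H]]]]. unfold mesh.
  rewrite (Nat.log2_unique (S n) j); [apply H, Hk | lia |]. rewrite E. cbn. lia.
Qed.

Lemma mesh_pos n : 0 < mesh n.
Proof. apply pow_lt. lra. Qed.

Lemma nxt_near n k : Rabs (nxt n k - dya k) <= mesh n.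
Proof.
  pose proof (mesh_pos n). unfold nxt. destruct (Nat.leb_spec k n) as [Hk|Hk].
  - pose proof (ends_mesh n k Hk). rewrite Rabs_pos_eq; lra.
  - rewrite Rminus_diag, Rabs_R0. lra.
Qed.

(** The transposition only exchanges ends of halves of the gap being split. With [nxt_near] this
    makes both terms of [Sop] at level n harmless. *)
Lemma nxt_sw_near n k : Rabs (nxt n k - dya (sw n k)) <= mesh n.
Proof.
  pose proof (pre_le n) as Hpre. pose proof (ends_mesh n (pre n) Hpre). pose proof (dya_mid n).
  unfold sw. destruct (Nat.eqb_spec k (pre n)) as [->|Hk].
  - unfold nxt. destruct (Nat.leb_spec (pre n) n); [| lia]. rewrite Rabs_pos_eq; lra.
  - destruct (Nat.eqb_spec k (S n)) as [->|Hk']; [| apply nxt_near].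
    unfold nxt. destruct (Nat.leb_spec (S n) n); [lia |]. rewrite Rabs_pos_eq; lra.
Qed.

Lemma mesh_cvg eps : 0 < eps -> exists N, forall n, (N <= n)%nat -> mesh n <= eps.
Proof.
  intros He. destruct (pow_lt_1_zero (/ 2)) with (y := eps) as [J HJ]; [rewrite Rabs_pos_eq; lra | assumption |].
  exists (2 ^ J)%nat. intros n Hn. unfold mesh. left. eapply Rle_lt_trans; [apply Rle_abs | apply HJ].
  unfold ge. rewrite <- (Nat.log2_pow2 J) by lia. apply Nat.log2_le_mono. lia.
Qed.

(** * The accumulated permutations of positions *)

Fixpoint sig (n k : nat) : nat := match n with O => k | S n => sw n (sig n k) end.
Fixpoint sigi (n k : nat) : nat := match n with O => k | S n => sigi n (sw n k) end.

Lemma sigi_sig n k : sigi n (sig n k) = k.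
Proof. revert k. induction n; intros k; cbn; [reflexivity |]. rewrite sw_sw. auto. Qed.

Lemma sig_sigi n k : sig n (sigi n k) = k.
Proof. revert k. induction n; intros k; cbn; [reflexivity |]. rewrite IHn, sw_sw. reflexivity. Qed.

Lemma sig_inj n k k' : sig n k = sig n k' -> k = k'.
Proof. intros H. rewrite <- (sigi_sig n k), H. apply sigi_sig. Qed.

Lemma sigi_inj n k k' : sigi n k = sigi n k' -> k = k'.
Proof. intros H. rewrite <- (sig_sigi n k), H. apply sig_sigi. Qed.

Lemma sig_big n k : (n < k)%nat -> sig n k = k.
Proof. induction n; intros H; cbn; [reflexivity |]. rewrite IHn by lia. apply sw_big. lia. Qed.

(** The invariant behind the whole construction: the target time of k is the right neighbour of
    position [sig n k]. Reading the source at [sig n k] thus changes the time by at most [mesh n],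
    whatever k is. *)
Lemma nxt_sig n k : nxt n (sig n k) = dya1 k.
Proof. induction n; cbn [sig]; [apply nxt_0 |]. rewrite nxt_S, sw_sw. assumption. Qed.

(** * The intertwiner *)

Section Intertwiner.
Context {I : Type} (nn : I -> nat) (bb : I -> Cx).

(** Only positions are mixed; each coordinate i has its own stage [nn i] and its own point [bb i] on
    the path from the permutation [sig n] to [sig (S n)]. *)
Definition Sop : op (nat * I) (nat * I) := fun x g =>
  let n := nn (snd g) in let b := bb (snd g) in
  Cadd (Cmul (Csub C1 b) (x (sig n (fst g), snd g))) (Cmul b (x (sig (S n) (fst g), snd g))).

Definition Sinv : op (nat * I) (nat * I) := fun x g =>
  let n := nn (snd g) in let b := Cconj (bb (snd g)) in
  Cadd (Cmul (Csub C1 b) (x (sigi n (fst g), snd g))) (Cmul b (x (sigi (S n) (fst g), snd g))).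

Context (Hbb : forall i, circ (bb i)).

Lemma circ_conj b : circ b -> circ (Cconj b).
Proof. unfold circ, Cconj. cbn. intros. nra. Qed.

(** From (s - 1)^2 = -2 (s - 1), the product of 1 + b (s - 1) and its conjugate path is 1 + (2 Re b
    - 2 |b|^2)(s - 1), and the bracket vanishes on the circle. Here u and w are the values at two
    exchanged positions. *)
Lemma circ_inverse b u w : circ b ->
  Cadd (Cmul (Csub C1 b) (Cadd (Cmul (Csub C1 (Cconj b)) u) (Cmul (Cconj b) w)))
       (Cmul b (Cadd (Cmul (Csub C1 (Cconj b)) w) (Cmul (Cconj b) u))) = u.
Proof.
  intros H. destruct b as [b1 b2]. unfold circ, Cconj in *. cbn [fst snd] in *.
  replace (Cadd (Cmul (Csub C1 (b1, b2)) (Cadd (Cmul (Csub C1 (b1, - b2)) u) (Cmul (b1, - b2) w)))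
       (Cmul (b1, b2) (Cadd (Cmul (Csub C1 (b1, - b2)) w) (Cmul (b1, - b2) u))))
    with (Cadd u (Cmul (Csub w u) (Csub (Cadd (b1, b2) (b1, - b2))
                (Cadd (Cmul (b1, b2) (b1, - b2)) (Cmul (b1, b2) (b1, - b2)))))) by ring.
  replace (Csub (Cadd (b1, b2) (b1, - b2)) (Cadd (Cmul (b1, b2) (b1, - b2)) (Cmul (b1, b2) (b1, - b2)))) with C0;
    [ring |].
  unfold Csub, Cadd, Cmul, Copp, C0. cbn [fst snd]. f_equal; nra.
Qed.

Lemma Cconj_conj b : Cconj (Cconj b) = b.
Proof. destruct b. unfold Cconj. cbn. f_equal. ring. Qed.

Lemma Sop_Sinv x : Sop (Sinv x) = x.
Proof.
  extensionality g. destruct g as [k i]. unfold Sop, Sinv. cbn [fst snd]. cbv zeta.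
  rewrite !sigi_sig. cbn [sig sigi]. rewrite circ_inverse by apply Hbb. reflexivity.
Qed.

Lemma Sinv_Sop x : Sinv (Sop x) = x.
Proof.
  extensionality g. destruct g as [k i]. unfold Sop, Sinv. cbn [fst snd]. cbv zeta. cbn [sig sigi].
  rewrite !sig_sigi, !sw_sw.
  pose proof (circ_inverse (Cconj (bb i)) (x (k, i)) (x (sw (nn i) k, i))) as H.
  rewrite Cconj_conj in H. apply H, circ_conj, Hbb.
Qed.

Context {p : R} {Hp : exponent p}.

(** Each term is a multiplier of modulus at most 1 after an injective reindexing, hence the bound 1
    + 1. *)
Lemma ob_two_terms (f f' : I -> nat -> nat) (b : I -> Cx) : (forall i, circ (b i)) ->
  (forall i k k', f i k = f i k' -> k = k') -> (forall i k k', f' i k = f' i k' -> k = k') ->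
  bdd p (fun (x : vec (nat * I)) g => Cadd (Cmul (Csub C1 (b (snd g))) (x (f (snd g) (fst g), snd g)))
     (Cmul (b (snd g)) (x (f' (snd g) (fst g), snd g)))) /\
  ob p (fun (x : vec (nat * I)) g => Cadd (Cmul (Csub C1 (b (snd g))) (x (f (snd g) (fst g), snd g)))
     (Cmul (b (snd g)) (x (f' (snd g) (fst g), snd g)))) 2.
Proof.
  intros Hb Hf Hf'.
  assert (Inj : forall h : I -> nat -> nat, (forall i k k', h i k = h i k' -> k = k') ->
    forall g g' : nat * I, (h (snd g) (fst g), snd g) = (h (snd g') (fst g'), snd g') -> g = g').
  { intros h Hh [k i] [k' i'] [= E1 E2]. cbn in *. subst i'. f_equal. eapply Hh, E1. }
  assert (M1 : forall g : nat * I, Cmod (Csub C1 (b (snd g))) <= 1) by (intros; apply circ_le, circ_compl, Hb).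
  assert (M2 : forall g : nat * I, Cmod (b (snd g)) <= 1) by (intros; apply circ_le, Hb).
  split.
  - apply (bdd_add (op_comp (mul (fun g : nat * I => Csub C1 (b (snd g)))) (fun x g => x (f (snd g) (fst g), snd g)))
      (op_comp (mul (fun g : nat * I => b (snd g))) (fun x g => x (f' (snd g) (fst g), snd g))));
      (apply bdd_comp; [apply (bdd_mul _ 1); [lra | assumption] |]);
      [apply (bdd_reindex (fun g => (f (snd g) (fst g), snd g))), Inj, Hf
      |apply (bdd_reindex (fun g => (f' (snd g) (fst g), snd g))), Inj, Hf'].
  - replace 2 with (1 * 1 + 1 * 1) by ring.
    apply (ob_add (op_comp (mul (fun g : nat * I => Csub C1 (b (snd g)))) (fun x g => x (f (snd g) (fst g), snd g)))
      (op_comp (mul (fun g : nat * I => b (snd g))) (fun x g => x (f' (snd g) (fst g), snd g))));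
      (apply ob_comp; [apply ob_mul; [lra | assumption] |]);
      [apply (ob_reindex (fun g => (f (snd g) (fst g), snd g))), Inj, Hf
      |apply (ob_reindex (fun g => (f' (snd g) (fst g), snd g))), Inj, Hf'].
Qed.

Lemma Sop_bdd : bdd p Sop /\ ob p Sop 2.
Proof. apply (ob_two_terms (fun i => sig (nn i)) (fun i => sig (S (nn i))) bb); auto; intros i; apply sig_inj. Qed.

Lemma Sinv_bdd : bdd p Sinv /\ ob p Sinv 2.
Proof.
  apply (ob_two_terms (fun i => sigi (nn i)) (fun i => sigi (S (nn i))) (fun i => Cconj (bb i))).
  - intros i. apply circ_conj, Hbb.
  - intros i. apply sigi_inj.
  - intros i. apply sigi_inj.
Qed.

End Intertwiner.

(** * Contractivity of the intertwiner and its inverse for p = 2 *)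

Lemma rpow_2 x : 0 <= x -> rpow x 2 = x * x.
Proof.
  intros [Hx|<-].
  - unfold rpow. destruct (Rlt_dec 0 x); [| lra]. replace 2 with (INR 2) by (cbn; ring).
    rewrite Rpower_pow by assumption. cbn. ring.
  - rewrite rpow_0. ring.
Qed.

Lemma psum_incl {I} p (x : vec I) l l' : NoDup l -> incl l l' -> psum p x l <= psum p x l'.
Proof.
  revert l'. induction l as [|i l IH]; intros l' Hl Hi; [apply psum_nonneg |].
  inversion Hl; subst. destruct (in_split i l') as [a [b ->]]; [apply Hi; now left |].
  rewrite (psum_perm x _ _ (Permutation_sym (Permutation_middle a b i))).
  apply Rplus_le_compat_l. apply IH; [assumption |]. intros j Hj.
  assert (Hin : In j (a ++ i :: b)) by (apply Hi; now right).
  rewrite in_app_iff in *. cbn in Hin. intuition (subst; contradiction || auto).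
Qed.

#[global] Instance exponent_2 : exponent 2.
Proof. unfold exponent. lra. Qed.

(** On each pair g, kap g this is a 2 by 2 unitary matrix, so the sum of the two squares is
    preserved. *)
Lemma lp_bound_rotation {G} (kap : G -> G) (b : G -> Cx) (x : vec G) c :
  (forall g, kap (kap g) = g) -> (forall g, b (kap g) = b g) -> (forall g, circ (b g)) ->
  lp_bound 2 x c -> lp_bound 2 (fun g => Cadd (Cmul (Csub C1 (b g)) (x g)) (Cmul (b g) (x (kap g)))) c.
Proof.
  intros Hk Hbk Hb Hx l Hl. set (y := fun g => Cadd (Cmul (Csub C1 (b g)) (x g)) (Cmul (b g) (x (kap g)))).
  set (dec := fun u v : G => excluded_middle_informative (u = v)).
  (* The test list is closed under [kap], so that it is a union of whole orbits. *)
  set (L := nodup dec (l ++ map kap l)).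
  assert (HL : NoDup L) by apply NoDup_nodup.
  assert (HkL : Permutation (map kap L) L).
  { apply NoDup_Permutation; [| assumption |].
    - apply NoDup_map_inj; [| assumption]. intros u v E. rewrite <- (Hk u), E. apply Hk.
    - assert (Hin : forall g, In g L -> In (kap g) L).
      { intros g. unfold L. rewrite !nodup_In, !in_app_iff, !in_map_iff. intros [Hg|[g' [<- Hg]]].
        - right. eauto.
        - left. rewrite Hk. assumption. }
      intros g. rewrite in_map_iff. split.
      + intros [g' [<- Hg]]. auto.
      + intros Hg. exists (kap g). auto. }
  assert (Hpt : forall g, rpow (Cmod (y g)) 2 + rpow (Cmod (y (kap g))) 2 = rpow (Cmod (x g)) 2 + rpow (Cmod (x (kap g))) 2).
  { intros g. rewrite !rpow_2 by apply Cmod_nonneg. rewrite !Cmod_sqr. unfold y. rewrite Hk, Hbk.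
    specialize (Hb g). unfold circ in Hb. destruct (b g) as [u v], (x g) as [x1 x2], (x (kap g)) as [z1 z2].
    unfold Csub, Cadd, Cmul, Copp, C1. cbn [fst snd] in *.
    transitivity (x1 ^ 2 + x2 ^ 2 + (z1 ^ 2 + z2 ^ 2)
      - 2 * (u - (u ^ 2 + v ^ 2)) * ((x1 - z1) ^ 2 + (x2 - z2) ^ 2)); [ring | rewrite <- Hb; ring]. }
  (* Summing over pairs counts every element of [L] twice on both sides, which also takes care of
     fixed points of [kap]. *)
  assert (Hsum : forall M, psum 2 y M + psum 2 y (map kap M) = psum 2 x M + psum 2 x (map kap M)).
  { induction M as [|g M IH]; [reflexivity |]. specialize (Hpt g). cbn [map].
    change (rpow (Cmod (y g)) 2 + psum 2 y M + (rpow (Cmod (y (kap g))) 2 + psum 2 y (map kap M)) =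
      rpow (Cmod (x g)) 2 + psum 2 x M + (rpow (Cmod (x (kap g))) 2 + psum 2 x (map kap M))). lra. }
  specialize (Hsum L). rewrite !(psum_perm _ _ _ HkL) in Hsum.
  apply Rle_trans with (psum 2 y L).
  - apply psum_incl; [assumption |]. intros g Hg. unfold L. apply nodup_In, in_or_app. now left.
  - specialize (Hx L HL). lra.
Qed.

Lemma lp_bound_reindex {I J} p (f : J -> I) (x : vec I) c :
  (forall j j', f j = f j' -> j = j') -> lp_bound p x c -> lp_bound p (fun j => x (f j)) c.
Proof.
  intros Hf. apply (lp_bound_pull (fun j => Some (f j))). intros j j' i [= <-] [= E]. auto.
Qed.

(** S is a rotation followed by the reindexing along [sig]; the inverse does the two in the opposite
    order. *)
Lemma Sop_contraction {I} (nn : I -> nat) (bb : I -> Cx) x c : (forall i, circ (bb i)) ->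
  lp_bound 2 x c -> lp_bound 2 (Sop nn bb x) c.
Proof.
  intros Hb Hx.
  assert (H := lp_bound_rotation (fun g : nat * I => (sw (nn (snd g)) (fst g), snd g)) (fun g => bb (snd g)) x c).
  apply (lp_bound_reindex 2 (fun g : nat * I => (sig (nn (snd g)) (fst g), snd g))) in H.
  - exact H.
  - intros [k i] [k' i'] [= E1 E2]. cbn in *. subst i'. f_equal. eapply sig_inj, E1.
  - intros [k i]. cbn. rewrite sw_sw. reflexivity.
  - reflexivity.
  - auto.
  - assumption.
Qed.

Lemma Sinv_contraction {I} (nn : I -> nat) (bb : I -> Cx) x c : (forall i, circ (bb i)) ->
  lp_bound 2 x c -> lp_bound 2 (Sinv nn bb x) c.
Proof.
  intros Hb Hx.
  apply (lp_bound_rotation (fun g : nat * I => (sw (nn (snd g)) (fst g), snd g)) (fun g => Cconj (bb (snd g)))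
    (fun g : nat * I => x (sigi (nn (snd g)) (fst g), snd g)) c).
  - intros [k i]. cbn. rewrite sw_sw. reflexivity.
  - reflexivity.
  - intros. apply circ_conj; auto.
  - apply (lp_bound_reindex 2 (fun g : nat * I => (sigi (nn (snd g)) (fst g), snd g))); [| assumption].
    intros [k i] [k' i'] [= E1 E2]. cbn in *. subst i'. f_equal. eapply sigi_inj, E1.
Qed.

(** * Commutators with the intertwiner *)

Lemma sig_pair_inj {I} (f : I -> nat) (g g' : nat * I) :
  (sig (f (snd g)) (fst g), snd g) = (sig (f (snd g')) (fst g'), snd g') -> g = g'.
Proof.
  destruct g as [k i], g' as [k' i']. intros E. injection E as E1 E2. cbn [fst snd] in *. subst i'.
  f_equal. eapply sig_inj, E1.
Qed.

Definition amp {I J} (T : op I J) : op (nat * I) (nat * J) := dsum_seq (fun _ => T).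

Definition bracket {I J} (T : op J J) (U : op I J) (T' : op I I) : op I J :=
  op_sub (op_comp T U) (op_comp U T').

Section Commutator.
Context {I : Type} {p : R} {Hp : exponent p}.
Context (be : nat -> I -> Cx) (nn : I -> nat).
Context (Hcirc : forall n i, circ (be n i)).
Context (Hbelow : forall n i, (n < nn i)%nat -> be n i = C1).
Context (Habove : forall n i, (nn i < n)%nat -> be n i = C0).

Let bb : I -> Cx := fun i => be (nn i) i.
Let bbN (N : nat) : I -> Cx := fun i => if Nat.ltb (nn i) N then bb i else C0.
Let S0 : op (nat * I) (nat * I) := Sop nn bb.
(** The construction stopped at stage N: coordinates of level N or more all use the permutation
    [sig N]. These are the partial sums of S = 1 + sum of [be n] times [jump n]. *)
Let SN (N : nat) : op (nat * I) (nat * I) := Sop (fun i => Nat.min (nn i) N) (bbN N).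
Let jump (n : nat) : op (nat * I) (nat * I) :=
  op_sub (fun x g => x (sig (S n) (fst g), snd g)) (fun x g => x (sig n (fst g), snd g)).

Lemma circ_bbN N i : circ (bbN N i).
Proof. unfold bbN, bb. destruct (Nat.ltb (nn i) N); [apply Hcirc | apply circ_0]. Qed.

Lemma ob_S0 : bdd p S0 /\ ob p S0 2.
Proof. exact (Sop_bdd nn bb (fun i => Hcirc _ i)). Qed.

Lemma ob_SN N : bdd p (SN N) /\ ob p (SN N) 2.
Proof. exact (Sop_bdd _ _ (circ_bbN N)). Qed.

Lemma SN_0 x : SN 0 x = x.
Proof.
  extensionality g. destruct g as [k i]. unfold SN, Sop. cbn [fst snd]. rewrite Nat.min_0_r.
  unfold bbN. cbn. ring.
Qed.

(** Telescoping: [be N] is 1 on the coordinates that go past stage N, 0 on those already settled,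
    and takes intermediate values only at level N. *)
Lemma SN_S N x : SN (S N) x = vadd (SN N x) (mul (fun g => be N (snd g)) (jump N x)).
Proof.
  extensionality g. destruct g as [k i]. unfold SN, Sop, vadd, mul, jump, op_sub, bbN, bb.
  cbn [fst snd]. cbv zeta.
  destruct (Nat.lt_trichotomy (nn i) N) as [H|[H|H]].
  - rewrite !Nat.min_l by lia. destruct (Nat.ltb_spec (nn i) (S N)); [| lia].
    destruct (Nat.ltb_spec (nn i) N); [| lia]. rewrite (Habove N) by assumption. ring.
  - subst N. rewrite !Nat.min_l by lia. destruct (Nat.ltb_spec (nn i) (S (nn i))); [| lia].
    destruct (Nat.ltb_spec (nn i) (nn i)); [lia |]. ring.
  - rewrite !Nat.min_r by lia. destruct (Nat.ltb_spec (nn i) (S N)); [lia |].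
    destruct (Nat.ltb_spec (nn i) N); [lia |]. rewrite (Hbelow N) by assumption. ring.
Qed.

Lemma SN_stable N x k i : (nn i < N)%nat -> SN N x (k, i) = S0 x (k, i).
Proof.
  intros H. unfold SN, S0, Sop, bbN. cbn [fst snd]. rewrite Nat.min_l by lia.
  destruct (Nat.ltb_spec (nn i) N); [reflexivity | lia].
Qed.

(** Both operators preserve each coordinate i and agree below level M, so only the part of x at
    levels from M on matters. This is strong convergence only, with no uniformity in x. *)
Lemma SN_strong x e : in_lp p x -> 0 < e ->
  exists N, forall M, (N <= M)%nat -> nb p (vsub (S0 x) (SN M x)) e.
Proof.
  intros Hx He. destruct (nb_tail x (e / 4) Hx) as [l Hl]; [lra |].
  destruct (finite_eventually l (fun g M => (nn (snd g) < M)%nat)) as [N HN].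
  { intros g. exists (S (nn (snd g))). intros; lia. }
  exists N. intros M HM. set (y := msk (fun g => (M <= nn (snd g))%nat) x).
  assert (Hy : nb p y (e / 4)).
  { eapply nb_mono; [| exact Hl]. intros g. unfold y, msk. repeat em; try lra; rewrite ?Cmod_0; try apply Cmod_nonneg.
    exfalso. assert (Hg : In g l) by (apply NNPP; assumption). specialize (HN M HM g Hg). lia. }
  apply (nb_ext _ (vsub (S0 y) (SN M y))).
  - intros [k i]. unfold vsub. destruct (Nat.lt_ge_cases (nn i) M) as [Hi|Hi].
    + rewrite !SN_stable by assumption. ring.
    + unfold S0, SN, Sop, y, msk. cbn [fst snd]. repeat em; try lia. reflexivity.
  - replace e with (2 * (e / 4) + 2 * (e / 4)) by field.
    apply nb_sub; [apply (proj2 ob_S0), Hy | apply (proj2 (ob_SN M)), Hy].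
Qed.

Lemma bdd_jump n : bdd p (jump n).
Proof.
  apply bdd_sub; [apply (bdd_reindex (fun g : nat * I => (sig (S n) (fst g), snd g)))
                 |apply (bdd_reindex (fun g : nat * I => (sig n (fst g), snd g)))];
    [apply (sig_pair_inj (fun _ => S n)) | apply (sig_pair_inj (fun _ => n))].
Qed.

Lemma ob_jump n : ob p (jump n) 2.
Proof.
  replace 2 with (1 + 1) by ring.
  apply ob_sub; [apply (ob_reindex (fun g : nat * I => (sig (S n) (fst g), snd g)))
                 |apply (ob_reindex (fun g : nat * I => (sig n (fst g), snd g)))];
    [apply (sig_pair_inj (fun _ => S n)) | apply (sig_pair_inj (fun _ => n))].
Qed.

Lemma bdd_amp {J} (B : op I J) : bdd p B -> bdd p (amp B).
Proof. intros [L [al H]]. apply (bdd_dsum_seq _ al); auto. Qed.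

(** An ampliation repeats B at infinitely many positions, which spoils decay of rows; restricting to
    finitely many positions through U restores it. *)
Lemma apx_amp {J} (B : op I J) (U : op (nat * I) (nat * I)) n : apx p B -> bdd p U ->
  (forall x k i, (n < k)%nat -> U x (k, i) = C0) -> apx p (op_comp (amp B) U).
Proof.
  intros [BB HB] BU HU. split; [apply bdd_comp; [apply bdd_amp |]; assumption |].
  intros eps He. destruct (bdd_ob_pos U BU) as [al [Ha HobU]].
  destruct (HB (eps / al)) as [l Hl]; [apply Rdiv_lt_0_compat; assumption |].
  exists (list_prod (seq 0 (S n)) l).
  assert (H : ob p (op_comp (amp (op_comp (off l) B)) U) eps).
  { replace eps with (eps / al * al) by (field; lra). apply ob_comp; [| assumption].
    apply ob_dsum_seq. auto. }
  destruct H as [H0 H]. split; [assumption |]. intros x r Hx. eapply nb_mono; [| apply H, Hx].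
  intros [k j]. unfold op_comp, amp, dsum_seq, off, msk. cbn [fst snd]. em.
  - em; [lra |]. destruct (Nat.lt_ge_cases n k) as [Hk|Hk].
    + replace (fun i => U x (k, i)) with (@vzero I) by (extensionality i; symmetry; apply HU, Hk).
      rewrite (lin_zero (p := p)) by apply BB. unfold vzero. rewrite Cmod_0. apply Rle_refl.
    + exfalso. apply n0, in_prod; [apply in_seq; lia | apply NNPP; assumption].
  - rewrite Cmod_0. apply Cmod_nonneg.
Qed.

Lemma bracket_step (T : op I I) N x : bdd p T -> in_lp p x ->
  bracket (amp T) (SN (S N)) (amp T) x =
  vadd (bracket (amp T) (SN N) (amp T) x) (op_comp (amp (comm T (be N))) (jump N) x).
Proof.
  intros BT Hx. pose proof (bdd_amp T BT) as BA.
  assert (Hj : in_lp p (jump N x)) by (apply bdd_in; [apply bdd_jump | assumption]).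
  assert (Hm : in_lp p (mul (fun g => be N (snd g)) (jump N x))).
  { destruct (in_nb _ Hj) as [r Hr]. eapply nb_in, nb_mul; [apply Rle_0_1 | | exact Hr].
    intros g. apply circ_le, Hcirc. }
  assert (HS : in_lp p (SN N x)) by (apply bdd_in; [apply ob_SN | assumption]).
  unfold bracket, op_sub, op_comp. rewrite !SN_S.
  rewrite (lin_add (p := p) (amp T)) by (assumption || apply BA).
  extensionality g. destruct g as [k j]. unfold vadd.
  assert (E1 : amp T (mul (fun g => be N (snd g)) (jump N x)) (k, j) = T (mul (be N) (fun i => jump N x (k, i))) j)
    by reflexivity.
  (* [jump] moves positions while [amp T] acts within each position, so the two commute. *)
  assert (E2 : jump N (amp T x) (k, j) = T (fun i => jump N x (k, i)) j).
  { unfold jump, op_sub, amp, dsum_seq. cbn [fst snd].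
    change (Csub (T (fun i => x (sig (S N) k, i)) j) (T (fun i => x (sig N k, i)) j) =
      T (vsub (fun i => x (sig (S N) k, i)) (fun i => x (sig N k, i))) j).
    rewrite (lin_sub (p := p)); [reflexivity | apply BT | apply in_slice, Hx | apply in_slice, Hx]. }
  rewrite E1. unfold mul at 2. rewrite E2. cbn [snd].
  unfold amp at 5, dsum_seq, comm, op_sub, op_comp, mul. cbn [fst snd]. ring.
Qed.

Lemma bracket_sum (T : op I I) N x : bdd p T -> in_lp p x ->
  bracket (amp T) (SN N) (amp T) x = osum N (fun n => op_comp (amp (comm T (be n))) (jump n)) x.
Proof.
  intros BT Hx. induction N as [|N IH].
  - unfold bracket, op_sub, op_comp. rewrite !SN_0. cbn. extensionality g. unfold ozero, vzero. ring.
  - rewrite bracket_step by assumption. cbn [osum]. unfold oadd. rewrite IH. reflexivity.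
Qed.

(** The increments have norm at most 2 (1/2)^n, and their sum from N on is 4 (1/2)^N. Since [SN]
    tends to S only strongly, the bound passes to the limit through [nb_fatou]. *)
Lemma bracket_tail (T : op I I) r0 : bdd p T ->
  (forall n, (r0 <= n)%nat -> ob p (comm T (be n)) ((/ 2) ^ n)) ->
  forall N, (r0 <= N)%nat ->
  ob p (op_sub (bracket (amp T) S0 (amp T)) (bracket (amp T) (SN N) (amp T))) (4 * (/ 2) ^ N).
Proof.
  intros BT Hcomm N HN. assert (Hpos : forall n, 0 < (/ 2) ^ n) by (intros; apply pow_lt; lra).
  pose proof (bdd_amp T BT) as BA.
  split; [specialize (Hpos N); lra |]. intros x r Hx. pose proof (nb_nonneg _ _ Hx) as Hr.
  assert (Hin : in_lp p x) by (eapply nb_in, Hx).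
  set (CM := fun M => bracket (amp T) (SN M) (amp T) x).
  assert (Hpart : forall d, nb p (vsub (CM (d + N)%nat) (CM N)) (4 * ((/ 2) ^ N - (/ 2) ^ (d + N)) * r)).
  { induction d as [|d IH].
    - replace (4 * ((/ 2) ^ N - (/ 2) ^ (0 + N)) * r) with 0 by (cbn [plus]; ring).
      eapply nb_ext; [| apply nb_zero]. intros g. unfold vsub, vzero. cbn [plus]. ring.
    - apply (nb_ext _ (vadd (vsub (CM (d + N)%nat) (CM N)) (op_comp (amp (comm T (be (d + N)%nat))) (jump (d + N)) x))).
      { intros g. unfold CM. cbn [plus]. rewrite bracket_step by assumption. unfold vsub, vadd. ring. }
      replace (4 * ((/ 2) ^ N - (/ 2) ^ (S d + N)) * r)
        with (4 * ((/ 2) ^ N - (/ 2) ^ (d + N)) * r + (/ 2) ^ (d + N) * 2 * r) by (cbn [plus pow]; field).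
      apply nb_add; [assumption |].
      assert (Hob : ob p (op_comp (amp (comm T (be (d + N)%nat))) (jump (d + N))) ((/ 2) ^ (d + N) * 2)).
      { apply ob_comp; [| apply ob_jump]. apply ob_dsum_seq. intros _. apply Hcomm. lia. }
      apply Hob, Hx. }
  apply (nb_fatou (fun M => vsub (CM M) (CM N))).
  - specialize (Hpos N). apply Rmult_le_pos; lra.
  (* The term with T outside converges by [SN_strong]; in the other, coordinate j is already final
     once M exceeds its level. *)
  - intros [k j] eps He. destruct (bdd_ob_pos (amp T) BA) as [al [Ha HA]].
    destruct (SN_strong x (eps / al) Hin) as [N1 HN1]; [apply Rdiv_lt_0_compat; assumption |].
    exists (Nat.max N1 (S (nn j))). intros M HM.
    assert (Hd : nb p (vsub (amp T (S0 x)) (amp T (SN M x))) eps).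
    { rewrite <- (lin_sub (p := p)); [| apply BA | apply bdd_in; [apply ob_S0 | assumption] | apply bdd_in; [apply ob_SN | assumption]].
      replace eps with (al * (eps / al)) by (field; lra). apply HA, HN1. lia. }
    eapply Rle_trans; [| apply (nb_coord _ _ (k, j) Hd)]. right. f_equal.
    unfold vsub, CM, bracket, op_sub, op_comp. rewrite (SN_stable M) by lia. ring.
  - exists N. intros M HM. replace M with ((M - N) + N)%nat by lia.
    eapply nb_le; [| apply Hpart]. specialize (Hpos ((M - N) + N)%nat). nra.
Qed.

Lemma bracket_apx (T : op I I) r0 : bdd p T -> (forall n, apx p (comm T (be n))) ->
  (forall n, (r0 <= n)%nat -> ob p (comm T (be n)) ((/ 2) ^ n)) ->
  apx p (bracket (amp T) (Sop nn (fun i => be (nn i) i)) (amp T)).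
Proof.
  intros BT Hapx Hcomm. fold bb. fold S0. pose proof (bdd_amp T BT) as BA. apply apx_lim.
  - apply bdd_sub; apply bdd_comp; try assumption; apply ob_S0.
  - intros eps He. destruct (pow_lt_1_zero (/ 2)) with (y := eps / 4) as [N0 HN0]; [rewrite Rabs_pos_eq; lra | lra |].
    set (N := Nat.max N0 r0). exists (bracket (amp T) (SN N) (amp T)). split.
    + apply (apx_eqv _ (osum N (fun n => op_comp (amp (comm T (be n))) (jump n)))).
      * intros x Hx. apply bracket_sum; assumption.
      (* Both permutations in [jump n] fix all positions above n + 1. *)
      * apply apx_sum. intros n. apply (apx_amp _ _ (S n)); [apply Hapx | apply bdd_jump |].
        intros x k i Hk. unfold jump, op_sub. cbn [fst snd]. rewrite !sig_big by lia. ring.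
    + apply (ob_le _ (4 * (/ 2) ^ N)); [| apply (bracket_tail T r0); [assumption | assumption | lia]].
      specialize (HN0 N ltac:(lia)). pose proof (Rle_abs ((/ 2) ^ N)). lra.
Qed.

End Commutator.

(** * Functions of the position *)

(** [psi] alone sits at position 0, so its second copy is padding that makes all positions alike.
    There S is the identity although the times 0 and 1 differ. *)
Definition unused (g : nat * (nat + nat)) : Prop := match g with (O, inr _) => True | _ => False end.

Section Positions.
Context {p : R} {Hp : exponent p}.
Context (nn : nat + nat -> nat) (bb : nat + nat -> Cx).
Context (Hcirc : forall i, circ (bb i)).
Context (Hnn : forall n, nn (inr n) = 0%nat) (Hbb : forall n, bb (inr n) = C0).
Context (Hfin : forall N, exists m, forall n, (nn (inl n) < N)%nat -> (n < m)%nat).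

Lemma position_apx (h : R -> R) L : 0 <= L -> (forall t, Rabs (h t) <= 1) ->
  (forall s t, Rabs (h s - h t) <= L * Rabs (s - t)) ->
  apx p (op_comp (msk (fun g => ~ unused g))
    (bracket (mul (fun g => RtoCx (h (dya1 (fst g))))) (Sop nn bb) (mul (fun g => RtoCx (h (dya (fst g))))))).
Proof.
  intros HL Hh HLip.
  set (Z := bracket _ _ _).
  assert (BZ : bdd p Z).
  { unfold Z. apply bdd_sub; apply bdd_comp; try exact (proj1 (Sop_bdd nn bb Hcirc));
      apply (bdd_mul _ 1); try lra; intros; rewrite Cmod_RtoCx; apply Hh. }
  split; [apply bdd_comp; [apply bdd_msk | exact BZ] |].
  intros eps He.
  destruct (mesh_cvg (eps / 2 / (L + 1))) as [N HN]; [apply Rdiv_lt_0_compat; lra |].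
  destruct (Hfin N) as [m Hm].
  (* For n < N, positions from N + 2 on are fixed by [sig n] and [sw n] and not yet inserted, so
     both times equal [dya k]. *)
  exists (list_prod (seq 0 (N + 2)) (map inl (seq 0 m))).
  set (m1 := fun g : nat * (nat + nat) => if Nat.leb N (nn (snd g)) then
     let n := nn (snd g) in let k := sig n (fst g) in
     Cmul (Csub C1 (bb (snd g))) (RtoCx (h (nxt n k) - h (dya k))) else C0).
  set (m2 := fun g : nat * (nat + nat) => if Nat.leb N (nn (snd g)) then
     let n := nn (snd g) in let k := sig n (fst g) in
     Cmul (bb (snd g)) (RtoCx (h (nxt n k) - h (dya (sw n k)))) else C0).
  assert (Hsmall : forall n s t, (N <= n)%nat -> Rabs (s - t) <= mesh n -> Rabs (h s - h t) <= eps / 2).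
  { intros n s t Hn Hst. eapply Rle_trans; [apply HLip |]. specialize (HN n Hn).
    apply Rle_trans with (L * (eps / 2 / (L + 1))); [apply Rmult_le_compat_l; lra |].
    apply (Rmult_le_reg_r (L + 1)); [lra |].
    replace (L * (eps / 2 / (L + 1)) * (L + 1)) with (L * (eps / 2)) by (field; lra). nra. }
  assert (Hm1 : forall g, Cmod (m1 g) <= eps / 2).
  { intros [k i]. unfold m1. cbn [fst snd]. destruct (Nat.leb_spec N (nn i)); [| rewrite Cmod_0; lra].
    rewrite Cmod_mul, Cmod_RtoCx. pose proof (circ_le _ (circ_compl _ (Hcirc i))).
    pose proof (Hsmall (nn i) _ _ H (nxt_near (nn i) (sig (nn i) k))).
    pose proof (Cmod_nonneg (Csub C1 (bb i))). pose proof (Rabs_pos (h (nxt (nn i) (sig (nn i) k)) - h (dya (sig (nn i) k)))).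
    nra. }
  assert (Hm2 : forall g, Cmod (m2 g) <= eps / 2).
  { intros [k i]. unfold m2. cbn [fst snd]. destruct (Nat.leb_spec N (nn i)); [| rewrite Cmod_0; lra].
    rewrite Cmod_mul, Cmod_RtoCx. pose proof (circ_le _ (Hcirc i)).
    pose proof (Hsmall (nn i) _ _ H (nxt_sw_near (nn i) (sig (nn i) k))).
    pose proof (Cmod_nonneg (bb i)). pose proof (Rabs_pos (h (nxt (nn i) (sig (nn i) k)) - h (dya (sw (nn i) (sig (nn i) k))))).
    nra. }
  assert (Ho : ob p (oadd (op_comp (mul m1) (fun x g => x (sig (nn (snd g)) (fst g), snd g)))
                          (op_comp (mul m2) (fun x g => x (sig (S (nn (snd g))) (fst g), snd g)))) eps).
  { replace eps with (eps / 2 * 1 + eps / 2 * 1) by field. apply ob_add; apply ob_comp.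
    - apply ob_mul; [lra | assumption].
    - apply (ob_reindex (fun g => (sig (nn (snd g)) (fst g), snd g))), (sig_pair_inj nn).
    - apply ob_mul; [lra | assumption].
    - apply (ob_reindex (fun g => (sig (S (nn (snd g))) (fst g), snd g))), (sig_pair_inj (fun i => S (nn i))). }
  destruct Ho as [H0 Ho]. split; [assumption |]. intros x r Hx. eapply nb_mono; [| apply Ho, Hx].
  intros g. unfold op_comp, off. unfold msk at 1. em; [| rewrite Cmod_0; apply Cmod_nonneg].
  unfold msk. em; [| rewrite Cmod_0; apply Cmod_nonneg].
  destruct g as [k i].
  assert (E : Z x (k, i) = Cadd
     (Cmul (Cmul (Csub C1 (bb i)) (RtoCx (h (nxt (nn i) (sig (nn i) k)) - h (dya (sig (nn i) k))))) (x (sig (nn i) k, i)))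
     (Cmul (Cmul (bb i) (RtoCx (h (nxt (nn i) (sig (nn i) k)) - h (dya (sw (nn i) (sig (nn i) k)))))) (x (sw (nn i) (sig (nn i) k), i)))).
  { unfold Z, bracket, op_sub, op_comp, Sop, mul. cbn [fst snd sig]. cbv zeta. rewrite nxt_sig.
    assert (RS : forall a b, RtoCx (a - b) = Csub (RtoCx a) (RtoCx b)).
    { intros. unfold RtoCx, Csub, Cadd, Copp. cbn. f_equal; ring. }
    rewrite !RS. ring. }
  unfold oadd, vadd, mul, m1, m2. cbn [fst snd]. destruct (Nat.leb_spec N (nn i)) as [Hi|Hi].
  - rewrite E. cbn [sig]. lra.
  - assert (Z x (k, i) = C0) as ->; [| rewrite Cmod_0; apply Cmod_nonneg].
    rewrite E. destruct i as [q|q].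
    + assert (Hk : (N + 2 <= k)%nat).
      { destruct (Nat.lt_ge_cases k (N + 2)) as [Hlt|]; [| assumption]. exfalso. apply n.
        apply in_prod; [apply in_seq; lia |]. apply in_map, in_seq. specialize (Hm q Hi). lia. }
      rewrite sig_big, sw_big by lia. unfold nxt. destruct (Nat.leb_spec k (nn (inl q))); [lia |].
      rewrite Rminus_diag. unfold RtoCx. fold C0. ring.
    + destruct k as [|k]; [cbn in n0; tauto |].
      rewrite Hbb, Hnn. cbn [sig]. rewrite nxt_0. cbn [dya1]. rewrite Rminus_diag.
      unfold RtoCx. fold C0. ring.
Qed.

End Positions.

(** * Normed spaces *)

Section NormedSpaces.
Context {V : NormedSpace}.
Implicit Types x y z : V.

Lemma ns_scal_0 x : ns_scal C0 x = ns_zero.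
Proof. apply ns_norm_eq0. rewrite ns_norm_scal, Cmod_0. ring. Qed.

Lemma ns_opp_scal x : ns_opp x = ns_scal (Copp C1) x.
Proof.
  assert (H : ns_add x (ns_scal (Copp C1) x) = ns_zero).
  { rewrite <- (ns_scal_1 V x) at 1. rewrite <- ns_scal_distr_r.
    replace (Cadd C1 (Copp C1)) with C0 by ring. apply ns_scal_0. }
  rewrite <- (ns_add_0 V (ns_opp x)), <- H, ns_add_assoc, (ns_add_comm V (ns_opp x)), ns_add_opp.
  rewrite ns_add_comm. apply ns_add_0.
Qed.

Lemma ns_norm_opp x : ns_norm (ns_opp x) = ns_norm x.
Proof. rewrite ns_opp_scal, ns_norm_scal, Cmod_opp, Cmod_1. ring. Qed.

Lemma ns_norm_0 : ns_norm (@ns_zero V) = 0.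
Proof. rewrite <- (ns_scal_0 ns_zero), ns_norm_scal, Cmod_0. ring. Qed.

Lemma ns_sub_diag x : ns_sub x x = ns_zero.
Proof. apply ns_add_opp. Qed.

Lemma ns_add_sub x y : ns_add y (ns_sub x y) = x.
Proof.
  unfold ns_sub. rewrite (ns_add_comm V x), ns_add_assoc, ns_add_opp, ns_add_comm. apply ns_add_0.
Qed.

Lemma ns_norm_sub_sym x y : ns_norm (ns_sub x y) = ns_norm (ns_sub y x).
Proof.
  rewrite <- ns_norm_opp. f_equal. unfold ns_sub. rewrite !ns_opp_scal, ns_scal_distr_l, ns_scal_assoc.
  replace (Cmul (Copp C1) (Copp C1)) with C1 by ring. rewrite ns_scal_1. apply ns_add_comm.
Qed.

Lemma ns_sub_triangle x y z : ns_norm (ns_sub x z) <= ns_norm (ns_sub x y) + ns_norm (ns_sub y z).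
Proof.
  replace (ns_sub x z) with (ns_add (ns_sub x y) (ns_sub y z)); [apply ns_norm_triangle |].
  unfold ns_sub. rewrite <- ns_add_assoc, (ns_add_assoc V (ns_opp y)), (ns_add_comm V (ns_opp y)), ns_add_opp.
  rewrite (ns_add_comm V ns_zero), ns_add_0. reflexivity.
Qed.

Lemma ns_sub_add_le x y z : ns_norm (ns_sub x (ns_add y z)) <= ns_norm (ns_sub x y) + ns_norm z.
Proof.
  eapply Rle_trans; [apply (ns_sub_triangle x y) |]. apply Rplus_le_compat_l. right.
  rewrite ns_norm_sub_sym. f_equal. unfold ns_sub.
  rewrite (ns_add_comm V y), <- ns_add_assoc, ns_add_opp. apply ns_add_0.
Qed.

(** Heine-Cantor by sequences: pairs violating uniformity at scale 1/(n+1) accumulate at a point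
    where continuity fails. *)
Lemma uniform_continuity (c : R -> V) :
  (forall t, 0 <= t <= 1 -> forall eps, 0 < eps -> exists delta, 0 < delta /\
     forall s, 0 <= s <= 1 -> Rabs (s - t) < delta -> ns_norm (ns_sub (c s) (c t)) < eps) ->
  forall eps, 0 < eps -> exists N, (0 < N)%nat /\ forall s t, 0 <= s <= 1 -> 0 <= t <= 1 ->
    Rabs (s - t) <= / INR N -> ns_norm (ns_sub (c s) (c t)) <= eps.
Proof.
  intros Hc eps He. apply NNPP. intros Hn.
  assert (H : forall n : nat, exists st : R * R, 0 <= fst st <= 1 /\ 0 <= snd st <= 1 /\
    Rabs (fst st - snd st) <= / INR (S n) /\ eps < ns_norm (ns_sub (c (fst st)) (c (snd st)))).
  { intros n. apply NNPP. intros H. apply Hn. exists (S n). split; [lia |]. intros s t Hs Ht Hst.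
    apply Rnot_lt_le. intros Hlt. apply H. exists (s, t). auto. }
  apply choice in H as [f Hf].
  destruct (real_subsequence (fun n => fst (f n)) 1) as [phi [l [Hphi Hl]]].
  { intros n. destruct (Hf n) as [H _]. apply Rabs_le. lra. }
  assert (Hl01 : 0 <= l <= 1).
  { split; apply Rnot_lt_le; intros Hlt.
    - destruct (Hl (- l / 2)) as [N HN]; [lra |]. specialize (HN N (le_n _)).
      destruct (Hf (phi N)) as [H _]. rewrite Rabs_minus_sym in HN. pose proof (Rle_abs (fst (f (phi N)) - l)). lra.
    - destruct (Hl ((l - 1) / 2)) as [N HN]; [lra |]. specialize (HN N (le_n _)).
      destruct (Hf (phi N)) as [H _]. pose proof (Rle_abs (l - fst (f (phi N)))). lra. }
  destruct (Hc l Hl01 (eps / 2)) as [d [Hd Hcd]]; [lra |].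
  destruct (Hl (d / 3)) as [N HN]; [lra |].
  destruct (archimed_cor1 (d / 3)) as [M [HM HM0]]; [lra |].
  set (n := Nat.max N M). specialize (HN n ltac:(lia)).
  destruct (Hf (phi n)) as [H1 [H2 [H3 H4]]].
  assert (H5 : / INR (S (phi n)) <= d / 3).
  { left. eapply Rle_lt_trans; [| exact HM]. apply Rinv_le_contravar; [apply lt_0_INR; lia |].
    apply le_INR. pose proof (strict_ge phi Hphi n). lia. }
  assert (H6 : ns_norm (ns_sub (c (fst (f (phi n)))) (c l)) < eps / 2).
  { apply Hcd; [assumption |]. rewrite Rabs_minus_sym. lra. }
  assert (H7 : ns_norm (ns_sub (c (snd (f (phi n)))) (c l)) < eps / 2).
  { apply Hcd; [assumption |].
    replace (snd (f (phi n)) - l) with (- (l - fst (f (phi n))) - (fst (f (phi n)) - snd (f (phi n)))) by ring.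
    eapply Rle_lt_trans; [apply Rabs_triang |]. rewrite !Rabs_Ropp. lra. }
  pose proof (ns_sub_triangle (c (fst (f (phi n)))) (c l) (c (snd (f (phi n))))) as H8.
  rewrite (ns_norm_sub_sym (c l)) in H8. lra.
Qed.

(** * Piecewise linear interpolation of paths *)

Definition clamp (x : R) : R := Rmax 0 (Rmin 1 x).

Lemma clamp_range (x : R) : Rabs (clamp x) <= 1.
Proof. unfold clamp, Rmax, Rmin. apply Rabs_le. repeat destruct (Rle_dec _ _); lra. Qed.

Lemma clamp_lip (x y : R) : Rabs (clamp x - clamp y) <= Rabs (x - y).
Proof.
  unfold clamp, Rmax, Rmin, Rabs. repeat destruct (Rle_dec _ _); repeat destruct (Rcase_abs _); lra.
Qed.

(** Written as a telescoping sum of Lipschitz scalar functions times fixed vectors. A scalar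
    function of time is handled by [position_apx], a fixed vector by the commutator estimate. *)
Fixpoint interp (c : R -> V) (N m : nat) (t : R) : V :=
  match m with
  | O => c 0
  | S m => ns_add (interp c N m t)
             (ns_scal (RtoCx (clamp (INR N * t - INR m))) (ns_sub (c (INR (S m) / INR N)) (c (INR m / INR N))))
  end.

(** After m terms the sum follows c up to the grid point m/N and stays constant beyond it; the
    induction needs both clauses. *)
Lemma interp_near (c : R -> V) eps N : (0 < N)%nat -> 0 < eps ->
  (forall s t, 0 <= s <= 1 -> 0 <= t <= 1 -> Rabs (s - t) <= / INR N -> ns_norm (ns_sub (c s) (c t)) <= eps / 2) ->
  forall m t, (m <= N)%nat -> 0 <= t <= 1 ->
    (INR m / INR N <= t -> interp c N m t = c (INR m / INR N)) /\
    (t < INR m / INR N -> ns_norm (ns_sub (c t) (interp c N m t)) <= eps).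
Proof.
  intros HN He Hc. apply lt_0_INR in HN.
  assert (Hdiv : forall k t, INR k / INR N <= t <-> INR k <= INR N * t).
  { intros k t. split; intros H.
    - apply (Rmult_le_compat_l (INR N)) in H; [| lra]. replace (INR N * (INR k / INR N)) with (INR k) in H by (field; lra). lra.
    - apply (Rmult_le_reg_l (INR N)); [lra |]. replace (INR N * (INR k / INR N)) with (INR k) by (field; lra). lra. }
  intros m. induction m as [|m IH]; intros t Hm Ht.
  - cbn [interp]. replace (INR 0 / INR N) with 0 by (cbn; unfold Rdiv; ring). split; [reflexivity | lra].
  - destruct (IH t ltac:(lia) Ht) as [IH1 IH2]. cbn [interp].
    assert (Hgrid : forall k, (k <= N)%nat -> 0 <= INR k / INR N <= 1).
    { intros k Hk. pose proof (pos_INR k). apply le_INR in Hk. split.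
      - apply Rmult_le_pos; [assumption | left; apply Rinv_0_lt_compat; assumption].
      - apply Hdiv. lra. }
    rewrite S_INR in *. split.
    + intros H. assert (H' := H). rewrite <- S_INR in H'. apply Hdiv in H'. rewrite S_INR in H'.
      rewrite IH1 by (apply Hdiv; lra).
      replace (clamp (INR N * t - INR m)) with 1.
      * change (RtoCx 1) with C1. rewrite ns_scal_1. apply ns_add_sub.
      * unfold clamp, Rmax, Rmin. repeat destruct (Rle_dec _ _); lra.
    + intros H. destruct (Rle_or_lt (INR m / INR N) t) as [H'|H'].
      * rewrite IH1 by assumption. eapply Rle_trans; [apply ns_sub_add_le |].
        rewrite ns_norm_scal, Cmod_RtoCx.
        assert (E : (INR m + 1) / INR N - INR m / INR N = / INR N) by (field; lra).
        assert (G1 : ns_norm (ns_sub (c t) (c (INR m / INR N))) <= eps / 2).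
        { apply Hc; [assumption | apply Hgrid; lia |]. rewrite Rabs_pos_eq; lra. }
        assert (G2 : ns_norm (ns_sub (c ((INR m + 1) / INR N)) (c (INR m / INR N))) <= eps / 2).
        { apply Hc; [rewrite <- S_INR; apply Hgrid; lia | apply Hgrid; lia |].
          rewrite E, Rabs_pos_eq; [lra | left; apply Rinv_0_lt_compat; assumption]. }
        pose proof (clamp_range (INR N * t - INR m)).
        pose proof (Rabs_pos (clamp (INR N * t - INR m))).
        pose proof (ns_norm_nonneg V (ns_sub (c ((INR m + 1) / INR N)) (c (INR m / INR N)))). nra.
      * replace (clamp (INR N * t - INR m)) with 0.
        -- change (RtoCx 0) with C0. rewrite ns_scal_0, ns_add_0. apply IH2. assumption.
        -- assert (~ INR m <= INR N * t) by (rewrite <- Hdiv; lra).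
           unfold clamp, Rmax, Rmin. repeat destruct (Rle_dec _ _); lra.
Qed.

Lemma interp_uniform (c : R -> V) eps N : (0 < N)%nat -> 0 < eps ->
  (forall s t, 0 <= s <= 1 -> 0 <= t <= 1 -> Rabs (s - t) <= / INR N -> ns_norm (ns_sub (c s) (c t)) <= eps / 2) ->
  forall t, 0 <= t <= 1 -> ns_norm (ns_sub (c t) (interp c N N t)) <= eps.
Proof.
  intros HN He Hc t Ht. destruct (interp_near c eps N HN He Hc N t (le_n _) Ht) as [H1 H2].
  destruct (Rle_or_lt (INR N / INR N) t) as [H|H]; [| auto].
  rewrite H1 by assumption. apply lt_0_INR in HN.
  replace (INR N / INR N) with 1 in * by (field; lra). replace t with 1 by lra.
  rewrite ns_sub_diag, ns_norm_0. lra.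
Qed.

End NormedSpaces.

(** * Brackets *)

Section Brackets.
Context {p : R} {Hp : exponent p} {I : Type}.

Lemma bdd_bracket (T U T' : op I I) : bdd p T -> bdd p U -> bdd p T' -> bdd p (bracket T U T').
Proof. intros. apply bdd_sub; apply bdd_comp; assumption. Qed.

Lemma ob_bracket (T U T' : op I I) t u t' : ob p T t -> ob p U u -> ob p T' t' ->
  ob p (bracket T U T') (t * u + u * t').
Proof. intros. apply ob_sub; apply ob_comp; assumption. Qed.

Lemma bracket_sub (T U T' R R' : op I I) x : bdd p U -> bdd p T' -> bdd p R' -> in_lp p x ->
  bracket (op_sub T R) U (op_sub T' R') x = op_sub (bracket T U T') (bracket R U R') x.
Proof.
  intros BU BT BR Hx. unfold bracket, op_sub, op_comp. extensionality g.
  change (fun j => Csub (T' x j) (R' x j)) with (vsub (T' x) (R' x)).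
  rewrite (lin_sub (p := p)); [| apply BU | apply bdd_in; assumption | apply bdd_in; assumption].
  unfold vsub. ring.
Qed.

Lemma bracket_add (T U T' R R' : op I I) x : bdd p U -> bdd p T' -> bdd p R' -> in_lp p x ->
  bracket (oadd T R) U (oadd T' R') x = oadd (bracket T U T') (bracket R U R') x.
Proof.
  intros BU BT BR Hx. unfold bracket, op_sub, op_comp, oadd. extensionality g.
  rewrite (lin_add (p := p)); [| apply BU | apply bdd_in; assumption | apply bdd_in; assumption].
  unfold vadd. ring.
Qed.

End Brackets.

(** * Choice of the multipliers *)

Section Multipliers.
Context {p : R} {Hp : exponent p}.

(** b differs from [chi] at finitely many coordinates only, so the two commutators differ by
    finite-row terms. *)
Lemma apx_comm_of_chi (T : op (nat + nat) (nat + nat)) (b : nat + nat -> Cx) m :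
  bdd p T -> apx p (comm T chi) -> (forall i, circ (b i)) -> (forall n, b (inr n) = C0) ->
  (forall n, (m <= n)%nat -> b (inl n) = C1) -> apx p (comm T b).
Proof.
  intros BT HT Hb Hr Hl. set (f := fun i => Csub (b i) (chi i)).
  assert (Hf : apx p (mul f)).
  { apply (apx_finite_rows _ (map inl (seq 0 m))).
    - apply (bdd_mul _ 2); [lra |]. intros i. unfold f. eapply Rle_trans; [apply Cmod_sub |].
      pose proof (circ_le _ (Hb i)). assert (Cmod (chi i) <= 1); [| lra].
      destruct i; cbn; rewrite ?Cmod_0, ?Cmod_1; lra.
    - intros x _ [n|n] Hn; unfold mul, f; cbn [chi].
      + rewrite Hl; [ring |]. destruct (Nat.lt_ge_cases n m); [| assumption]. exfalso. apply Hn, in_map, in_seq. lia.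
      + rewrite Hr. ring. }
  apply (apx_eqv _ (oadd (comm T chi) (op_sub (op_comp T (mul f)) (op_comp (mul f) T)))).
  - intros x Hx.
    assert (Hc : in_lp p (mul chi x)).
    { destruct (in_nb x Hx) as [r Hr']. eapply nb_in, nb_mul; [apply Rle_0_1 | | exact Hr'].
      intros [n|n]; cbn; rewrite ?Cmod_0, ?Cmod_1; lra. }
    assert (Hfx : in_lp p (mul f x)) by (apply bdd_in; [apply Hf | assumption]).
    unfold comm, oadd, op_sub, op_comp.
    replace (mul b x) with (vadd (mul chi x) (mul f x)) by (extensionality i; unfold vadd, mul, f; ring).
    rewrite (lin_add (p := p) T) by (assumption || apply BT). extensionality i. unfold vadd.
    generalize (T (mul chi x) i) (T (mul f x) i). intros u w. unfold mul, f. ring.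
  - apply apx_add; [assumption |]. apply apx_sub; [apply apx_comp_l | apply apx_comp_r]; assumption.
Qed.

(** The n-th multiplier climbs inside the block from [M n] to [M (S n)] and treats the first n + 1
    operators with tolerance 2^-n. The climbs are disjoint, so [nn] is the number of the block
    containing a coordinate. *)
Lemma multipliers (Ts : nat -> op (nat + nat) (nat + nat)) :
  (forall r, bdd p (Ts r) /\ apx p (comm (Ts r) chi)) ->
  exists (be : nat -> nat + nat -> Cx) (nn : nat + nat -> nat),
    (forall n i, circ (be n i)) /\ (forall n i, (n < nn i)%nat -> be n i = C1) /\
    (forall n i, (nn i < n)%nat -> be n i = C0) /\
    (forall n, nn (inr n) = 0%nat) /\ (forall n m, be n (inr m) = C0) /\
    (forall N, exists m, forall n, (nn (inl n) < N)%nat -> (n < m)%nat) /\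
    (forall r n, apx p (comm (Ts r) (be n))) /\
    (forall r n, (r <= n)%nat -> ob p (comm (Ts r) (be n)) ((/ 2) ^ n)).
Proof.
  intros HT.
  assert (H : forall nm : nat * nat, exists mb : nat * (nat + nat -> Cx), (snd nm < fst mb)%nat /\
    (forall i, circ (snd mb i)) /\ (forall n, snd mb (inr n) = C0) /\
    (forall n, (n < snd nm)%nat -> snd mb (inl n) = C0) /\ (forall n, (fst mb <= n)%nat -> snd mb (inl n) = C1) /\
    forall r, (r <= fst nm)%nat -> ob p (comm (Ts r) (snd mb)) ((/ 2) ^ fst nm)).
  { intros [n m]. cbn [fst snd].
    destruct (quasicentral (map Ts (seq 0 (S n)))) with (m := m) (eps := (/ 2) ^ n)
      as [m' [b [H1 [H2 [H3 [H4 [H5 H6]]]]]]].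
    - intros T HTin. apply in_map_iff in HTin as [r [<- _]]. apply HT.
    - apply pow_lt. lra.
    (* [S m'] keeps the thresholds strictly increasing. *)
    - exists (S m', b). cbn [fst snd]. refine (conj _ (conj H2 (conj H3 (conj H4 (conj _ _))))).
      + lia.
      + intros q Hq. apply H5. lia.
      + intros r Hr. apply H6, in_map, in_seq. lia. }
  apply choice in H as [g Hg].
  set (M := fix M n := match n with O => O | S n => fst (g (n, M n)) end).
  set (be := fun n => snd (g (n, M n))).
  assert (HM : strict M) by (intros n; apply (Hg (n, M n))).
  assert (HM' : strict (fun k => M (S k))) by (intros n; apply HM).
  (* [S q] thresholds suffice because M k >= k. *)
  set (lv := fun q => level (fun k => M (S k)) (S q) q).
  set (nn := fun i : nat + nat => match i with inl q => lv q | inr _ => O end).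
  assert (Hlv : forall q, (q < M (S (lv q)))%nat).
  { intros q. apply (level_lt (fun k => M (S k)) (S q)). fold (lv q). split; [lia |].
    assert (lv q <= S q)%nat by apply level_le.
    destruct (Nat.eq_dec (lv q) (S q)) as [E|]; [| lia].
    assert (M (S q) <= q)%nat by (apply (level_gt (fun k => M (S k)) (S q)); [assumption | fold (lv q); lia]).
    pose proof (strict_ge M HM (S q)). lia. }
  assert (Mmono : forall a b, (a <= b)%nat -> (M a <= M b)%nat).
  { intros a b Hab. destruct (Nat.eq_dec a b) as [->|]; [lia |]. apply Nat.lt_le_incl, strict_lt; [assumption | lia]. }
  exists be, nn. refine (conj _ (conj _ (conj _ (conj _ (conj _ (conj _ (conj _ _))))))).
  - intros n i. apply (Hg (n, M n)).
  - intros n [q|q] Hn; cbn [nn] in Hn; [| lia]. apply (Hg (n, M n)).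
    apply (level_gt (fun k => M (S k)) (S q) q n HM' Hn).
  - intros n [q|q] Hn; cbn [nn] in Hn; [| apply (Hg (n, M n))]. apply (Hg (n, M n)). cbn [snd].
    pose proof (Hlv q). pose proof (Mmono (S (lv q)) n ltac:(lia)). lia.
  - reflexivity.
  - intros n m. apply (Hg (n, M n)).
  - intros N. exists (M N). intros n Hn. cbn [nn] in Hn. pose proof (Hlv n).
    pose proof (Mmono (S (lv n)) N ltac:(lia)). lia.
  - intros r n. apply (apx_comm_of_chi (Ts r) (be n) (M (S n))); [apply HT | apply HT | | |];
      intros; apply (Hg (n, M n)); assumption.
  - intros r n Hr. apply (Hg (n, M n)). assumption.
Qed.

End Multipliers.

(** * Intertwining the fields of operators *)

Section Fields.
Context {p : R} {Hp : exponent p} {A : NormedSpace}.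
Context (eta : A -> op (nat + nat) (nat + nat)) (M : R).
Context (eta_bdd : forall a, bdd p (eta a)).
Context (eta_add : forall a b x, in_lp p x -> eta (ns_add a b) x = vadd (eta a x) (eta b x)).
Context (eta_scal : forall c a x, in_lp p x -> eta (ns_scal c a) x = vscal c (eta a x)).
Context (M_pos : 0 <= M) (eta_ob : forall a, ob p (eta a) (M * ns_norm a)).

Definition field (f : nat -> A) : op (nat * (nat + nat)) (nat * (nat + nat)) := dsum_seq (fun k => eta (f k)).

Lemma eta_sub a b x : in_lp p x -> eta (ns_sub a b) x = vsub (eta a x) (eta b x).
Proof.
  intros Hx. unfold ns_sub. rewrite eta_add, ns_opp_scal, eta_scal by assumption. symmetry. apply vsub_vadd.
Qed.

Lemma field_sub f g x : in_lp p x ->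
  field (fun k => ns_sub (f k) (g k)) x = vsub (field f x) (field g x).
Proof.
  intros Hx. extensionality kj. destruct kj as [k j]. unfold field, dsum_seq, vsub. cbn [fst snd].
  rewrite eta_sub by (apply in_slice, Hx). reflexivity.
Qed.

Lemma field_add_scal f h b x : in_lp p x ->
  field (fun k => ns_add (f k) (ns_scal (h k) b)) x =
  vadd (field f x) (mul (fun g => h (fst g)) (amp (eta b) x)).
Proof.
  intros Hx. extensionality kj. destruct kj as [k j]. unfold field, amp, dsum_seq, vadd, mul. cbn [fst snd].
  rewrite eta_add, eta_scal by (apply in_slice, Hx). reflexivity.
Qed.

Lemma ob_field f B : (forall k, ns_norm (f k) <= B) -> ob p (field f) (M * B).
Proof.
  intros HB. apply ob_dsum_seq. intros k. apply (ob_le _ (M * ns_norm (f k))); [| apply eta_ob].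
  apply Rmult_le_compat_l; [assumption | apply HB].
Qed.

Lemma bdd_field f B : (forall k, ns_norm (f k) <= B) -> bdd p (field f).
Proof.
  intros HB. apply (bdd_dsum_seq _ (M * B)); [intros k; apply eta_bdd |]. intros k.
  apply (ob_le _ (M * ns_norm (f k))); [| apply eta_ob]. apply Rmult_le_compat_l; [assumption | apply HB].
Qed.

Context (nn : nat + nat -> nat) (bb : nat + nat -> Cx).
Context (bb_circ : forall i, circ (bb i)).
Context (nn_inr : forall n, nn (inr n) = 0%nat) (bb_inr : forall n, bb (inr n) = C0).
Context (nn_fin : forall N, exists m, forall n, (nn (inl n) < N)%nat -> (n < m)%nat).
Let S0 := Sop nn bb.
Let E := msk (fun g => ~ unused g).

(** The bracket depends on b linearly with norm at most 4 M |b|, so a dense sequence suffices. *)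
Lemma amp_bracket_dense (d : nat -> A) :
  (forall x eps, 0 < eps -> exists n, ns_norm (ns_sub x (d n)) < eps) ->
  (forall r, apx p (bracket (amp (eta (d r))) S0 (amp (eta (d r))))) ->
  forall b, apx p (bracket (amp (eta b)) S0 (amp (eta b))).
Proof.
  intros Hd Hr b. destruct (Sop_bdd (p := p) nn bb bb_circ) as [BS OS]. fold S0 in BS, OS.
  assert (BA : forall c, bdd p (amp (eta c))) by (intros; apply bdd_amp, eta_bdd).
  apply apx_lim; [apply bdd_bracket; auto |]. intros eps He.
  destruct (Hd b (eps / (4 * (M + 1)))) as [r Hbr]; [apply Rdiv_lt_0_compat; lra |].
  exists (bracket (amp (eta (d r))) S0 (amp (eta (d r)))). split; [apply Hr |].
  set (e := ns_norm (ns_sub b (d r))) in *.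
  assert (Hob : ob p (op_sub (amp (eta b)) (amp (eta (d r)))) (M * e)).
  { apply (ob_eqv _ (field (fun _ => ns_sub b (d r)))).
    - intros x Hx. symmetry. apply (field_sub (fun _ => b) (fun _ => d r) x Hx).
    - apply ob_field. intros; unfold e; lra. }
  eapply ob_eqv; [intros x Hx; symmetry; apply bracket_sub; auto |].
  apply (ob_le _ (M * e * 2 + 2 * (M * e))); [| apply ob_bracket; assumption].
  assert (0 <= e) by apply ns_norm_nonneg.
  assert (E4 : eps / (4 * (M + 1)) * (4 * (M + 1)) = eps) by (field; lra). nra.
Qed.

Context (amp_bracket : forall b, apx p (bracket (amp (eta b)) S0 (amp (eta b)))).

(** Leibniz rule: h1 T S - S h0 T = h1 (T S - S T) + (h1 S - S h0) T, with h1 and h0 the function h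
    at target and source times. *)
Lemma elementary_bracket (h : R -> R) L b : 0 <= L -> (forall t, Rabs (h t) <= 1) ->
  (forall s t, Rabs (h s - h t) <= L * Rabs (s - t)) ->
  apx p (op_comp E (bracket (op_comp (mul (fun g => RtoCx (h (dya1 (fst g))))) (amp (eta b))) S0
                            (op_comp (mul (fun g => RtoCx (h (dya (fst g))))) (amp (eta b))))).
Proof.
  intros HL Hh Hlip. destruct (Sop_bdd (p := p) nn bb bb_circ) as [BS _]. fold S0 in BS.
  assert (Bm : forall v : nat -> R, bdd p (mul (fun g : nat * (nat + nat) => RtoCx (h (v (fst g)))))).
  { intros v. apply (bdd_mul _ 1); [lra |]. intros. rewrite Cmod_RtoCx. apply Hh. }
  pose proof (bdd_amp (eta b) (eta_bdd b)) as BA.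
  apply (apx_eqv _ (oadd
    (op_comp E (op_comp (mul (fun g => RtoCx (h (dya1 (fst g))))) (bracket (amp (eta b)) S0 (amp (eta b)))))
    (op_comp (op_comp E (bracket (mul (fun g => RtoCx (h (dya1 (fst g))))) S0 (mul (fun g => RtoCx (h (dya (fst g)))))))
       (amp (eta b))))).
  - intros x Hx. unfold oadd, bracket, op_sub, op_comp, E, msk, mul, vadd. extensionality g. em; ring.
  - apply apx_add.
    + apply apx_comp_l; [apply bdd_msk |]. apply apx_comp_l; [apply Bm | apply amp_bracket].
    + apply apx_comp_r; [| assumption]. apply (position_apx nn bb bb_circ nn_inr bb_inr nn_fin h L); assumption.
Qed.

(** Induction along the telescoping sum, starting from a constant field, which is an ampliation. *)
Lemma interp_bracket (c : R -> A) N m :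
  bdd p (field (fun k => interp c N m (dya k))) /\ bdd p (field (fun k => interp c N m (dya1 k))) /\
  apx p (op_comp E (bracket (field (fun k => interp c N m (dya1 k))) S0 (field (fun k => interp c N m (dya k))))).
Proof.
  destruct (Sop_bdd (p := p) nn bb bb_circ) as [BS _]. fold S0 in BS.
  induction m as [|m [IH1 [IH2 IH3]]]; cbn [interp].
  - assert (B0 : bdd p (field (fun _ => c 0))) by exact (bdd_amp (eta (c 0)) (eta_bdd _)).
    split; [exact B0 |]. split; [exact B0 |]. apply apx_comp_l; [apply bdd_msk | exact (amp_bracket (c 0))].
  - set (b := ns_sub (c (INR (S m) / INR N)) (c (INR m / INR N))).
    set (h := fun t => clamp (INR N * t - INR m)).
    assert (Hstep : forall v : nat -> R, forall x, in_lp p x ->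
      field (fun k => ns_add (interp c N m (v k)) (ns_scal (RtoCx (clamp (INR N * v k - INR m))) b)) x =
      oadd (field (fun k => interp c N m (v k))) (op_comp (mul (fun g => RtoCx (h (v (fst g))))) (amp (eta b))) x).
    { intros v x Hx. apply field_add_scal, Hx. }
    assert (Bm : forall v : nat -> R, bdd p (op_comp (mul (fun g : nat * (nat + nat) => RtoCx (h (v (fst g))))) (amp (eta b)))).
    { intros v. apply bdd_comp; [| apply bdd_amp, eta_bdd]. apply (bdd_mul _ 1); [lra |].
      intros. rewrite Cmod_RtoCx. apply clamp_range. }
    split; [| split].
    + eapply bdd_eqv; [apply Hstep | apply bdd_add; auto].
    + eapply bdd_eqv; [apply Hstep | apply bdd_add; auto].
    + apply (apx_eqv _ (oadd
        (op_comp E (bracket (field (fun k => interp c N m (dya1 k))) S0 (field (fun k => interp c N m (dya k)))))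
        (op_comp E (bracket (op_comp (mul (fun g => RtoCx (h (dya1 (fst g))))) (amp (eta b))) S0
                            (op_comp (mul (fun g => RtoCx (h (dya (fst g))))) (amp (eta b))))))).
      * intros x Hx. pose proof (bdd_in S0 x BS Hx) as HSx.
        transitivity (E (oadd (bracket (field (fun k => interp c N m (dya1 k))) S0 (field (fun k => interp c N m (dya k))))
          (bracket (op_comp (mul (fun g => RtoCx (h (dya1 (fst g))))) (amp (eta b))) S0
                   (op_comp (mul (fun g => RtoCx (h (dya (fst g))))) (amp (eta b)))) x)); [| apply msk_add].
        rewrite <- bracket_add by auto. unfold op_comp at 1. f_equal. unfold bracket, op_sub, op_comp.
        rewrite (Hstep dya1 (S0 x) HSx), (Hstep dya x Hx). reflexivity.
      * apply apx_add; [assumption |]. apply (elementary_bracket h (INR N)); [apply pos_INR | intros; apply clamp_range |].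
        intros s t. unfold h. eapply Rle_trans; [apply clamp_lip |].
        replace (INR N * s - INR m - (INR N * t - INR m)) with (INR N * (s - t)) by ring.
        rewrite Rabs_mult, (Rabs_pos_eq (INR N)) by apply pos_INR. lra.
Qed.

Lemma dya1_range k : 0 <= dya1 k <= 1.
Proof. destruct k; [cbn; lra | apply dya_dyadic]. Qed.

Lemma path_bracket (c : R -> A) :
  (forall t, 0 <= t <= 1 -> forall eps, 0 < eps -> exists delta, 0 < delta /\
     forall s, 0 <= s <= 1 -> Rabs (s - t) < delta -> ns_norm (ns_sub (c s) (c t)) < eps) ->
  bdd p (field (fun k => c (dya k))) /\ bdd p (field (fun k => c (dya1 k))) /\
  apx p (op_comp E (bracket (field (fun k => c (dya1 k))) S0 (field (fun k => c (dya k))))).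
Proof.
  intros Hc. destruct (Sop_bdd (p := p) nn bb bb_circ) as [BS OS]. fold S0 in BS, OS.
  assert (Happ : forall eps, 0 < eps -> exists N, forall v : nat -> R, (forall k, 0 <= v k <= 1) ->
    forall k, ns_norm (ns_sub (c (v k)) (interp c N N (v k))) <= eps).
  { intros eps He. destruct (uniform_continuity c Hc (eps / 2)) as [N [HN HcN]]; [lra |].
    exists N. intros v Hv k. apply interp_uniform; auto. }
  assert (Bc : forall v : nat -> R, (forall k, 0 <= v k <= 1) ->
    (forall N, bdd p (field (fun k => interp c N N (v k)))) -> bdd p (field (fun k => c (v k)))).
  { intros v Hv HB. destruct (Happ 1) as [N HN]; [lra |].
    apply (bdd_eqv _ (oadd (field (fun k => interp c N N (v k))) (field (fun k => ns_sub (c (v k)) (interp c N N (v k)))))).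
    - intros x Hx. unfold oadd. rewrite field_sub by assumption. extensionality g. unfold vadd, vsub. ring.
    - apply bdd_add; [apply HB | apply (bdd_field _ 1), HN, Hv]. }
  assert (R0 : forall k, 0 <= dya k <= 1) by (intros; apply dya_dyadic).
  assert (B0 : bdd p (field (fun k => c (dya k)))) by (apply Bc; [exact R0 | intros; apply interp_bracket]).
  assert (B1 : bdd p (field (fun k => c (dya1 k)))) by (apply Bc; [exact dya1_range | intros; apply interp_bracket]).
  split; [assumption |]. split; [assumption |].
  apply apx_lim; [apply bdd_comp; [apply bdd_msk | apply bdd_bracket; assumption] |].
  (* Replacing the path by an interpolant within e changes each field by at most M e, and the
     bracket with S of norm 2 by at most 4 M e; [M + 1] allows M = 0. *)
  intros eps He. set (e := eps / (4 * (M + 1))).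
  assert (Pe : 0 < e) by (apply Rdiv_lt_0_compat; lra).
  destruct (Happ e Pe) as [N HN].
  destruct (interp_bracket c N N) as [I0 [I1 HI]]. eexists. split; [exact HI |].
  assert (Hob : forall v : nat -> R, (forall k, 0 <= v k <= 1) ->
    ob p (op_sub (field (fun k => c (v k))) (field (fun k => interp c N N (v k)))) (M * e)).
  { intros v Hv. eapply ob_eqv; [intros x Hx; symmetry; apply field_sub, Hx |].
    apply ob_field, HN, Hv. }
  apply (ob_eqv _ (op_comp E (bracket (op_sub (field (fun k => c (dya1 k))) (field (fun k => interp c N N (dya1 k)))) S0
      (op_sub (field (fun k => c (dya k))) (field (fun k => interp c N N (dya k))))))).
  - intros x Hx. unfold op_comp at 3. rewrite bracket_sub by assumption. symmetry. apply msk_sub.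
  - apply (ob_le _ (1 * (M * e * 2 + 2 * (M * e)))).
    + assert (E4 : e * (4 * (M + 1)) = eps) by (unfold e; field; lra). nra.
    + apply ob_comp; [apply ob_msk |]. apply ob_bracket; [apply Hob, dya1_range | assumption | apply Hob, R0].
Qed.

End Fields.

(** * The ambient space *)

Definition carrier : Type := (nat + nat * (nat + nat))%type.

(** The k-th copy of [eta] sits at position k + 1, position 0 being reserved for [psi]. *)
Definition emb (x : carrier) : nat * (nat + nat) :=
  match x with inl i => (0%nat, inl i) | inr (k, j) => (S k, j) end.
Definition emb_inv (g : nat * (nat + nat)) : option carrier :=
  match g with (O, inl i) => Some (inl i) | (O, inr _) => None | (S k, j) => Some (inr (k, j)) end.
Definition incl_op : op carrier (nat * (nat + nat)) := pull emb_inv.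
Definition res_op : op (nat * (nat + nat)) carrier := fun y x => y (emb x).
Definition cut (T : op (nat * (nat + nat)) (nat * (nat + nat))) : op carrier carrier :=
  op_comp res_op (op_comp T incl_op).

Definition first_in (i : nat + nat) : option carrier := match i with inl n => Some (inl n) | inr _ => None end.
Definition first_out (x : carrier) : option (nat + nat) := match x with inl n => Some (inl n) | inr _ => None end.
(** The upper left block of K placed on the first summand: it carries the compact discrepancy
    between [eta] and [psi] at position 0. *)
Definition corner (K : op (nat + nat) (nat + nat)) : op carrier carrier :=
  op_comp (pull first_out) (op_comp K (pull first_in)).

Lemma emb_inj x y : emb x = emb y -> x = y.
Proof. destruct x as [i|[k j]], y as [i'|[k' j']]; cbn; congruence. Qed.

Lemma emb_inv_pinj : pinj emb_inv.
Proof. intros [[|k] [i|i]] [[|k'] [i'|i']] x; cbn; congruence. Qed.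

Lemma res_incl x : res_op (incl_op x) = x.
Proof. extensionality i. destruct i as [i|[k j]]; reflexivity. Qed.

Lemma incl_res y : incl_op (res_op y) = msk (fun g => ~ unused g) y.
Proof.
  extensionality g. unfold incl_op, res_op, pull, msk. destruct g as [[|k] [i|i]]; cbn; em; tauto.
Qed.

Lemma res_msk y : res_op (msk (fun g => ~ unused g) y) = res_op y.
Proof.
  extensionality x. unfold res_op, msk. em; [reflexivity |]. exfalso. destruct x as [i|[k j]]; cbn in *; tauto.
Qed.

Section Cut.
Context (nn : nat + nat -> nat) (bb : nat + nat -> Cx).
Context (bb_circ : forall i, circ (bb i)).
Context (nn_inr : forall n, nn (inr n) = 0%nat) (bb_inr : forall n, bb (inr n) = C0).
Let S0 := Sop nn bb.
Let S1 := Sinv nn bb.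

Lemma S0_inr y k n : S0 y (k, inr n) = y (k, inr n).
Proof. unfold S0, Sop. cbn [fst snd]. rewrite nn_inr, bb_inr. cbn [sig]. ring. Qed.

Lemma S1_inr y k n : S1 y (k, inr n) = y (k, inr n).
Proof.
  unfold S1, Sinv. cbn [fst snd]. rewrite nn_inr, bb_inr. cbn [sigi].
  replace (Cconj C0) with C0 by (unfold Cconj, C0; cbn; f_equal; ring). ring.
Qed.

Lemma incl_cut_S0 x : incl_op (cut S0 x) = S0 (incl_op x).
Proof.
  unfold cut, op_comp. rewrite incl_res. extensionality g. unfold msk. em; [reflexivity |].
  destruct g as [[|k] [i|i]]; cbn in *; try tauto. rewrite S0_inr. reflexivity.
Qed.

Lemma incl_cut_S1 x : incl_op (cut S1 x) = S1 (incl_op x).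
Proof.
  unfold cut, op_comp. rewrite incl_res. extensionality g. unfold msk. em; [reflexivity |].
  destruct g as [[|k] [i|i]]; cbn in *; try tauto. rewrite S1_inr. reflexivity.
Qed.

Lemma cut_S0_res y : cut S0 (res_op y) = res_op (S0 y).
Proof.
  unfold cut, op_comp. rewrite incl_res. extensionality x. unfold res_op.
  assert (H : forall g, ~ unused g -> S0 (msk (fun g => ~ unused g) y) g = S0 y g).
  { intros [k [i|i]] Hg.
    - unfold S0, Sop, msk. cbn [fst snd]. destruct (sig (nn (inl i)) k), (sig (S (nn (inl i))) k); repeat em; cbn in *; tauto.
    - rewrite !S0_inr. unfold msk. em; tauto. }
  apply H. destruct x as [i|[k j]]; cbn; tauto.
Qed.

Lemma cut_S0_S1 x : cut S0 (cut S1 x) = x.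
Proof.
  unfold cut at 1, op_comp. rewrite incl_cut_S1. unfold S0, S1. rewrite Sop_Sinv by assumption. apply res_incl.
Qed.

Lemma cut_S1_S0 x : cut S1 (cut S0 x) = x.
Proof.
  unfold cut at 1, op_comp. rewrite incl_cut_S0. unfold S0, S1. rewrite Sinv_Sop by assumption. apply res_incl.
Qed.

End Cut.

Section CutBounds.
Context {p : R} {Hp : exponent p}.

Lemma bdd_incl : bdd p incl_op.
Proof. apply bdd_pull, emb_inv_pinj. Qed.

Lemma bdd_res : bdd p res_op.
Proof. apply (bdd_reindex emb), emb_inj. Qed.

Lemma bdd_cut T : bdd p T -> bdd p (cut T).
Proof. intros. apply bdd_comp; [apply bdd_res |]. apply bdd_comp; [assumption | apply bdd_incl]. Qed.

Lemma ob_cut T al : ob p T al -> ob p (cut T) al.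
Proof.
  intros H. replace al with (1 * (al * 1)) by ring. apply ob_comp; [apply (ob_reindex emb), emb_inj |].
  apply ob_comp; [assumption | apply ob_pull, emb_inv_pinj].
Qed.

Lemma apx_corner K : apx p K -> apx p (corner K).
Proof.
  intros H. apply apx_comp_l; [| apply apx_comp_r; [assumption |]]; apply bdd_pull.
  - intros [i|x] [i'|x'] [j|j]; cbn; congruence.
  - intros [i|i] [i'|i'] [j|j]; cbn; congruence.
Qed.

Lemma apx_cut T : apx p (op_comp (msk (fun g => ~ unused g)) T) -> apx p (cut T).
Proof.
  intros H. apply (apx_eqv _ (op_comp res_op (op_comp (op_comp (msk (fun g => ~ unused g)) T) incl_op))).
  - intros x _. unfold cut, op_comp. rewrite res_msk. reflexivity.
  - apply apx_comp_l; [apply bdd_res |]. apply apx_comp_r; [assumption | apply bdd_incl].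
Qed.

End CutBounds.

Lemma chi_comm_dsum2 (T1 T2 : op nat nat) p x : is_lin_op p T1 -> is_lin_op p T2 -> exponent p -> in_lp p x ->
  comm (dsum2 T1 T2) chi x = vzero.
Proof.
  intros L1 L2 Hp Hx. extensionality j. unfold comm, op_sub, op_comp, mul, vzero.
  assert (Z1 : forall T : op nat nat, is_lin_op p T -> T (fun _ => C0) = vzero) by (intros; apply (lin_zero (p := p)); assumption).
  destruct j as [j|j]; cbn.
  - replace (fun i : nat => Cmul C1 (x (inl i))) with (fun i : nat => x (inl i)) by (extensionality i; ring). ring.
  - replace (fun i : nat => Cmul C0 (x (inr i))) with (fun _ : nat => C0) by (extensionality i; ring).
    rewrite Z1 by assumption. unfold vzero. ring.
Qed.

Theorem theorem7p18 (p : R) (A1 A2 : NormedSpace)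
  (psi psim1 : A2 -> op nat nat) (eta : A2 -> op (nat + nat) (nat + nat))
  (tau : R -> A1 -> A2) :
  1 < p ->
  complete A1 -> separable A1 -> complete A2 -> separable A2 ->
  (forall a, is_bdd_op p (psi a)) ->
  (forall a, is_bdd_op p (psim1 a)) ->
  (* eta : A2 -> B(l^p + l^p) is a bounded linear map *)
  (forall a, is_bdd_op p (eta a)) ->
  (forall a b x, in_lp p x -> forall j, eta (ns_add a b) x j = Cadd (eta a x j) (eta b x j)) ->
  (forall (c : Cx) a x, in_lp p x -> forall j, eta (ns_scal c a) x j = Cmul c (eta a x j)) ->
  (exists M, 0 <= M /\ forall a, op_bound p (eta a) (M * ns_norm a)) ->
  (forall t, 0 <= t <= 1 -> bounded_linear (tau t)) ->
  (* (1) *)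
  (forall a, is_compact_op p (op_sub (eta a) (dsum2 (psi a) (psim1 a)))) ->
  (* (2) *)
  (forall (a : A1) t, 0 <= t <= 1 -> forall eps, 0 < eps -> exists delta, 0 < delta /\
      forall s, 0 <= s <= 1 -> Rabs (s - t) < delta ->
        ns_norm (ns_sub (tau s a) (tau t a)) < eps) ->
  exists v : nat -> R,
    (forall k, dyadic (v k) /\ 0 <= v k <= 1) /\
    similar_mod_compact p
      (fun a : A1 => dsum2 (psi (tau 0 a)) (dsum_seq (fun k => eta (tau (v k) a))))
      (fun a : A1 => dsum2 (psi (tau 1 a)) (dsum_seq (fun k => eta (tau (v k) a))))
      16 /\
    (p = 2 ->
     unitarily_equiv_mod_compact p
      (fun a : A1 => dsum2 (psi (tau 0 a)) (dsum_seq (fun k => eta (tau (v k) a))))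
      (fun a : A1 => dsum2 (psi (tau 1 a)) (dsum_seq (fun k => eta (tau (v k) a))))).
Proof.
  intros p_gt1 _ _ _ [d Hd] Hpsi Hpsim1 Heta Hadd Hscal [M [HM HetaM]] _ Hcompact Hcont.
  assert (Hp : exponent p) by exact p_gt1.
  assert (eta_bdd : forall a, bdd p (eta a)) by (intros; apply is_bdd_op_bdd, Heta).
  assert (eta_add : forall a b x, in_lp p x -> eta (ns_add a b) x = vadd (eta a x) (eta b x)).
  { intros a b x Hx. extensionality j. apply Hadd, Hx. }
  assert (eta_scal : forall c a x, in_lp p x -> eta (ns_scal c a) x = vscal c (eta a x)).
  { intros c a x Hx. extensionality j. apply Hscal, Hx. }
  assert (eta_ob : forall a, ob p (eta a) (M * ns_norm a)).
  { intros a. apply op_bound_ob; [| apply HetaM]. apply Rmult_le_pos; [assumption | apply ns_norm_nonneg]. }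
  set (K := fun a => op_sub (eta a) (dsum2 (psi a) (psim1 a))).
  assert (HK : forall a, apx p (K a)) by (intros; apply compact_apx, Hcompact).
  assert (chi_le : forall i, Cmod (chi i) <= 1).
  { intros [n|n]; cbn; rewrite ?Cmod_0, ?Cmod_1; lra. }
  (* The block diagonal part commutes with [chi], so only the compact difference [K a]
     contributes. *)
  assert (Hchi : forall a, apx p (comm (eta a) chi)).
  { intros a. apply (apx_eqv _ (comm (K a) chi)).
    - intros x Hx.
      pose proof (chi_comm_dsum2 (psi a) (psim1 a) p x (proj1 (Hpsi a)) (proj1 (Hpsim1 a)) Hp Hx) as H0.
      extensionality j. apply (f_equal (fun y => y j)) in H0. revert H0.
      unfold comm, K, op_sub, op_comp. generalize (eta a (mul chi x) j) (dsum2 (psi a) (psim1 a) (mul chi x) j).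
      intros u w. unfold mul, vzero. intros H0.
      replace (Csub u (Cmul (chi j) (eta a x j))) with
        (Cadd (Csub (Csub u w) (Cmul (chi j) (Csub (eta a x j) (dsum2 (psi a) (psim1 a) x j))))
              (Csub w (Cmul (chi j) (dsum2 (psi a) (psim1 a) x j)))) by ring.
      rewrite H0. ring.
    - assert (Bc : bdd p (mul chi)) by (apply (bdd_mul _ 1); [lra | assumption]).
      apply apx_sub; [apply apx_comp_r | apply apx_comp_l]; auto. }
  destruct (multipliers (fun r => eta (d r))) as [be [nn [Hcirc [Hbelow [Habove [Hnn [Hbe [Hfin [Hcapx Hcob]]]]]]]]].
  { intros r. auto. }
  set (bb := fun i => be (nn i) i).
  assert (bb_circ : forall i, circ (bb i)) by (intros; apply Hcirc).
  assert (bb_inr : forall n, bb (inr n) = C0) by (intros; apply Hbe).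
  set (S0 := Sop nn bb). set (S1 := Sinv nn bb).
  assert (Hamp : forall b, apx p (bracket (amp (eta b)) S0 (amp (eta b)))).
  { apply (amp_bracket_dense eta M eta_bdd eta_add eta_scal HM eta_ob nn bb bb_circ d Hd).
    intros r. apply (bracket_apx be nn Hcirc Hbelow Habove (eta (d r)) r); auto. }
  set (D := fun (t : R) (a : A1) =>
    dsum2 (psi (tau t a)) (dsum_seq (fun k => eta (tau (dya (S k)) a))) : op carrier carrier).
  assert (Hpath := fun a => path_bracket eta M eta_bdd eta_add eta_scal HM eta_ob nn bb bb_circ Hnn bb_inr Hfin Hamp
    (fun t => tau t a) (Hcont a)).
  (* Since [dya 0 = 0], the cut field has the upper left block of [eta (tau 0 a)] where [D] has
     [psi (tau 0 a)]; the corner corrects this, and all other summands agree. *)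
  assert (HD0 : forall a x, D 0 a x = vsub (cut (field eta (fun k => tau (dya k) a)) x) (corner (K (tau 0 a)) x)).
  { intros a x. extensionality i. destruct i as [i|[k j]].
    - change (psi (tau 0 a) (fun i => x (inl i)) i =
        Csub (eta (tau 0 a) (pull first_in x) (inl i))
          (Csub (eta (tau 0 a) (pull first_in x) (inl i)) (psi (tau 0 a) (fun i => x (inl i)) i))). ring.
    - change (eta (tau (dya (S k)) a) (fun i => x (inr (k, i))) j =
        Csub (eta (tau (dya (S k)) a) (fun i => x (inr (k, i))) j) C0). ring. }
  assert (HD1 : forall a x, D 1 a x = vsub (cut (field eta (fun k => tau (dya1 k) a)) x) (corner (K (tau 1 a)) x)).
  { intros a x. extensionality i. destruct i as [i|[k j]].
    - change (psi (tau 1 a) (fun i => x (inl i)) i =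
        Csub (eta (tau 1 a) (pull first_in x) (inl i))
          (Csub (eta (tau 1 a) (pull first_in x) (inl i)) (psi (tau 1 a) (fun i => x (inl i)) i))). ring.
    - change (eta (tau (dya (S k)) a) (fun i => x (inr (k, i))) j =
        Csub (eta (tau (dya (S k)) a) (fun i => x (inr (k, i))) j) C0). ring. }
  destruct (Sop_bdd (p := p) nn bb bb_circ) as [BS0 OS0]. destruct (Sinv_bdd (p := p) nn bb bb_circ) as [BS1 OS1].
  fold S0 in BS0, OS0. fold S1 in BS1, OS1.
  assert (BC0 : bdd p (cut S0)) by (apply bdd_cut, BS0).
  assert (BC1 : bdd p (cut S1)) by (apply bdd_cut, BS1).
  assert (Hinv : is_invertible p (cut S0) (cut S1)).
  { split; [apply is_bdd_op_bdd, BC0 |]. split; [apply is_bdd_op_bdd, BC1 |]. split.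
    - intros x _ i. unfold S0, S1. rewrite cut_S1_S0; auto.
    - intros x _ i. unfold S0, S1. rewrite cut_S0_S1; auto. }
  assert (Hfinal : forall a, is_compact_op p (op_sub (D 1 a) (op_comp (cut S0) (op_comp (D 0 a) (cut S1))))).
  { intros a. apply apx_compact. destruct (Hpath a) as [B0 [B1 HZ]]. fold S0 in HZ.
    (* With x = S z, the difference at x is the cut bracket at z, minus the corner at time 1 applied
       to x, plus S applied to the corner at time 0 of z. *)
    apply (apx_eqv _ (oadd (op_sub (op_comp (cut (bracket (field eta (fun k => tau (dya1 k) a)) S0 (field eta (fun k => tau (dya k) a)))) (cut S1))
        (corner (K (tau 1 a)))) (op_comp (cut S0) (op_comp (corner (K (tau 0 a))) (cut S1))))).
    - intros x Hx. set (z := cut S1 x).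
      assert (Hz : in_lp p z) by (apply bdd_in; assumption).
      assert (Ex : x = cut S0 z) by (unfold z, S0, S1; rewrite cut_S0_S1; auto).
      unfold oadd, op_sub, op_comp. fold z. rewrite HD1, HD0.
      rewrite (lin_sub (p := p) (cut S0)); [| apply BC0 | | ].
      2:{ apply bdd_in; [apply bdd_cut, B0 | assumption]. }
      2:{ apply bdd_in; [apply apx_bdd, apx_corner, HK | assumption]. }
      assert (E1 : cut (field eta (fun k => tau (dya1 k) a)) x =
        res_op (field eta (fun k => tau (dya1 k) a) (S0 (incl_op z)))).
      { rewrite Ex. unfold cut at 1, op_comp. unfold S0. rewrite incl_cut_S0; auto. }
      assert (E0 : cut S0 (cut (field eta (fun k => tau (dya k) a)) z) =
        res_op (S0 (field eta (fun k => tau (dya k) a) (incl_op z)))).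
      { unfold cut at 2, op_comp. unfold S0. rewrite cut_S0_res; auto. }
      rewrite E1, E0. extensionality i. unfold vadd, vsub.
      change (cut (bracket (field eta (fun k => tau (dya1 k) a)) S0 (field eta (fun k => tau (dya k) a))) z i) with
        (Csub (res_op (field eta (fun k => tau (dya1 k) a) (S0 (incl_op z))) i)
              (res_op (S0 (field eta (fun k => tau (dya k) a) (incl_op z))) i)).
      ring.
    - apply apx_add.
      + apply apx_sub; [| apply apx_corner, HK]. apply apx_comp_r; [apply apx_cut, HZ | assumption].
      + apply apx_comp_l; [assumption |]. apply apx_comp_r; [apply apx_corner, HK | assumption]. }
  exists (fun k => dya (S k)). split; [intros k; apply dya_dyadic |]. split.
  (* The product of the bounds is 4, below 16. *)
  - exists (cut S0), (cut S1), 2, 2. split; [assumption |]. split; [lra |]. split; [lra |].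
    split; [apply ob_op_bound, ob_cut, OS0 |]. split; [apply ob_op_bound, ob_cut, OS1 |]. split; [lra |].
    exact Hfinal.
  - intros E2. exists (cut S0), (cut S1). split; [assumption |]. split; [| exact Hfinal].
    subst p. intros x _ c.
    assert (Hc : forall T : op (nat * (nat + nat)) (nat * (nat + nat)),
      (forall y c, lp_bound 2 y c -> lp_bound 2 (T y) c) -> forall y, lp_bound 2 y c -> lp_bound 2 (cut T y) c).
    { intros T HT y Hy. apply (lp_bound_reindex 2 emb); [apply emb_inj |]. apply HT.
      apply lp_bound_pull; [apply emb_inv_pinj | assumption]. }
    split.
    + apply Hc. intros. apply Sop_contraction; assumption.
    (* Isometry follows from contractivity of the inverse. *)
    + intros H. apply (Hc S1) in H; [| intros; apply Sinv_contraction; assumption].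
      unfold S0, S1 in H. rewrite cut_S1_S0 in H; auto.
Qed.
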